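(* Let $\mathcal{G}$ be a periodic graph and $p=6$. Then: (i) if $\mathcal{G}$ satisfies assumption (H$_{per}$), i.e., for every edge $e\in E(\mathcal{G})$ removing $e$ from $\mathcal{G}$ generates only non-compact connected components, then $\mu_{\mathcal{G}}=\mu_{\mathbb{R}}$ and $$\mathcal{E}_{\mathcal{G}}(\mu)=\begin{cases}0 & \text{if }\mu\le\mu_{\mathbb{R}},\\ -\infty & \text{if }\mu>\mu_{\mathbb{R}};\end{cases}$$ (ii) if $\mathcal{G}$ has a terminal edge, then $\mu_{\mathcal{G}}=\mu_{\mathbb{R}^+}$ and $$\mathcal{E}_{\mathcal{G}}(\mu)=\begin{cases}0 & \text{if }\mu\le\mu_{\mathbb{R}^+},\\ -\infty & \text{if }\mu>\mu_{\mathbb{R}^+}.\end{cases}$$ Moreover, in both cases the infimum $\mathcal{E}_{\mathcal{G}}(\mu)$ is never attained, i.e., for no $\mu>0$ does there exist $u\in H^1_\mu(\mathcal{G})$ with $E(u,\mathcal{G})=\mathcal{E}_{\mathcal{G}}(\mu)$.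
   Context: Metric graphs. A connected metric graph $\mathcal{G}=(V(\mathcal{G}),E(\mathcal{G}))$ is a connected space made up of segments (the edges) glued together at some points (the vertices) according to the topology of the graph; multiple edges and self-loops are allowed. Each edge $e$ is identified with an interval $I_e=[0,\ell_e]$, $0<\ell_e<+\infty$, through a coordinate $x_e$. A compact graph is a metric graph with finitely many vertices and edges, all of finite length. A terminal edge is an edge incident to a vertex of degree $1$. Removing an edge means removing its interior, while its endpoints stay in the graph. Periodic graphs. Let $\mathcal{K}$ be a connected compact graph, $D,R\subset V(\mathcal{K})$ two non-empty sets with $D\cap R=\emptyset$, and $\sigma:D\to R$ a bijection. Take copies $\{\mathcal{K}_i\}_{i\in\mathbb{Z}}$ of $\mathcal{K}$, with $D_i,R_i\subset V(\mathcal{K}_i)$ the corresponding copies of $D,R$, and regard $\sigma$ as a map from $D_i$ to $R_{i+1}$ for every $i\in\mathbb{Z}$. On the disjoint union $\mathbb{G}=\bigcup_{i\in\mathbb{Z}}\mathcal{K}_i$ consider the equivalence relation $\sim$ that identifies each $v\in D_i$ with $\sigma(v)\in R_{i+1}$, for every $i\in\mathbb{Z}$ (and no other distinct points). The quotient $\mathcal{G}=\mathbb{G}/\!\sim$ is called a periodic graph with periodicity cell $\mathcal{K}$ and pasting rule $\sigma$. It is assumed throughout that a periodic graph has at least one vertex of degree at least $3$. Function spaces. A function $u:\mathcal{G}\to\mathbb{R}$ is a family $\{u_e\}_{e\in E(\mathcal{G})}$ with $u_e:I_e\to\mathbb{R}$. $L^p(\mathcal{G})$ is the space of functions with $u_e\in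 L^p(I_e)$ for all $e$ and $\|u\|_{L^p(\mathcal{G})}^p=\int_{\mathcal{G}}|u|^p\,dx=\sum_{e}\int_{I_e}|u_e|^p\,dx_e<\infty$. $H^1(\mathcal{G})$ is the space of continuous functions $u:\mathcal{G}\to\mathbb{R}$ with $u_e\in H^1(I_e)$ for all $e$ and $u,u'\in L^2(\mathcal{G})$. All functions are real-valued. For $\mu>0$, $H^1_\mu(\mathcal{G})=\{u\in H^1(\mathcal{G}):\|u\|_{L^2(\mathcal{G})}^2=\mu\}$. Energy and critical mass ($p=6$). $E(u,\mathcal{G})=\frac12\int_{\mathcal{G}}|u'|^2\,dx-\frac16\int_{\mathcal{G}}|u|^6\,dx$ and $\mathcal{E}_{\mathcal{G}}(\mu)=\inf_{u\in H^1_\mu(\mathcal{G})}E(u,\mathcal{G})$ for $\mu>0$. The critical mass is $\mu_{\mathcal{G}}=\sqrt{3/C_{\mathcal{G}}}$, where $C_{\mathcal{G}}$ is the optimal (smallest) constant in the Gagliardo-Nirenberg inequality $\|u\|_{L^6(\mathcal{G})}^6\le C_{\mathcal{G}}\|u\|_{L^2(\mathcal{G})}^4\|u'\|_{L^2(\mathcal{G})}^2$ for all $u\in H^1(\mathcal{G})$. For the real line and the half-line $\mathbb{R}^+=[0,+\infty)$ the corresponding values are $\mu_{\mathbb{R}}=\frac{\sqrt3}{2}\pi$ and $\mu_{\mathbb{R}^+}=\frac{\sqrt3}{4}\pi$. *)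

(* Defs.v *)
From HB Require Import structures.
From Stdlib Require Import Relations.
From mathcomp Require Import all_boot all_order all_algebra generic_quotient.
From mathcomp Require Import finmap.
From mathcomp Require Import all_classical all_reals all_analysis.

Set Implicit Arguments.
Unset Strict Implicit.
Unset Printing Implicit Defensive.

Import Order.TTheory GRing.Theory Num.Theory.
Import numFieldNormedType.Exports.

Local Open Scope classical_set_scope.
Local Open Scope ring_scope.

(* The edge [e] is the interval [0, elen e], whose point 0 is glued to the
   vertex [esrc e] and whose point [elen e] is glued to [etgt e].  Multiple
   edges and self-loops are allowed; the orientation only fixes a coordinate. *)
Record metric_graph (R : realType) := MetricGraph {
  vertex : choiceType ;
  edge : choiceType ;
  esrc : edge -> vertex ;
  etgt : edge -> vertex ;
  elen : edge -> R ;
  elen_gt0 : forall e, 0 < elen e }.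

Section Graphs.
Variable R : realType.
Implicit Type G : metric_graph R.

Definition connected_to G : relation (vertex G) :=
  clos_refl_sym_trans (vertex G)
    (fun v w => exists e : edge G, esrc e = v /\ etgt e = w).

Definition connected_graph G := forall v w : vertex G, connected_to v w.

Definition compact_graph G :=
  finite_set [set: vertex G] /\ finite_set [set: edge G].

(* An edge-end is an edge with a boolean (false: source, true: target), so
   that a self-loop counts twice in the degree. *)
Definition edge_ends G (v : vertex G) : set (edge G * bool) :=
  [set x | (if x.2 then etgt x.1 else esrc x.1) = v].

(* [fset_set] is set to be empty on infinite sets: the definition is meaningful
   for graphs, like the periodic ones, whose vertices have finite degree. *)
Definition degree G (v : vertex G) : nat := #|` fset_set (edge_ends v)|.

Definition terminal_edge G (e : edge G) :=
  exists v : vertex G, (esrc e = v \/ etgt e = v) /\ degree v = 1%N.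

(* Only the open interval is removed: all vertices stay. *)
Definition remove_edge G (e : edge G) : metric_graph R :=
  @MetricGraph R (vertex G) {f : edge G | f != e}
    (fun f => esrc (val f)) (fun f => etgt (val f)) (fun f => elen (val f))
    (fun f => elen_gt0 (val f)).

(* Every connected component contains a vertex, hence it is the component of
   some [v]; all edges have finite length, so that it is compact when it has
   finitely many vertices and edges. *)
Definition compact_component G (v : vertex G) :=
  finite_set [set w : vertex G | connected_to v w] /\
  finite_set [set e : edge G | connected_to v (esrc e)].

Definition Hper G :=
  forall (e : edge G) (v : vertex (remove_edge e)), ~ compact_component v.

End Graphs.

(* The values of [pasting] outside [dset] are irrelevant. *)
Record periodicity_cell (R : realType) := PeriodicityCell {
  cell : metric_graph R ;
  cell_connected : connected_graph cell ;
  cell_compact : compact_graph cell ;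
  dset : set (vertex cell) ;
  rset : set (vertex cell) ;
  dset_neq0 : dset !=set0 ;
  rset_neq0 : rset !=set0 ;
  drset_disj : dset `&` rset = set0 ;
  pasting : vertex cell -> vertex cell ;
  pasting_bij : set_bij dset rset pasting }.

Arguments dset {R} p _.
Arguments rset {R} p _.
Arguments pasting {R} p _.

Section PeriodicGraph.
Variables (R : realType) (K : periodicity_cell R).

Let T : choiceType := (int * vertex (cell K))%type.

Definition pasted (x y : T) : bool :=
  (x.2 \in dset K) && (y == (x.1 + 1, pasting K x.2)).

Definition paste_rel : rel T := fun x y => [|| x == y, pasted x y | pasted y x].

Lemma pastedP x y :
  reflect (dset K x.2 /\ y = (x.1 + 1, pasting K x.2)) (pasted x y).
Proof.
apply: (iffP andP) => [[/set_mem xD /eqP ->]|[xD ->]] //.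
by split=> //; exact/mem_set.
Qed.

Lemma pasted2F x y z : pasted x y -> pasted y z -> False.
Proof.
move=> /pastedP[xD ->] /pastedP[/= yD _].
have [fun_p _ _] := pasting_bij K.
have : (dset K `&` rset K) (pasting K x.2) by split=> //; exact: fun_p.
by rewrite drset_disj.
Qed.

Lemma pasted_fun x y z : pasted x y -> pasted x z -> y = z.
Proof. by move=> /pastedP[_ ->] /pastedP[_ ->]. Qed.

Lemma pasted_inj x y z : pasted x z -> pasted y z -> x = y.
Proof.
have [_ inj_p _] := pasting_bij K.
case: x y => [i v] [j w] /pastedP[/= vD ->] /pastedP[/= wD [/addIr -> vw]].
by congr (_, _); apply: inj_p vw; exact/mem_set.
Qed.

Lemma paste_rel_refl : reflexive paste_rel.
Proof. by move=> x; rewrite /paste_rel eqxx. Qed.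

Lemma paste_rel_sym : symmetric paste_rel.
Proof. by move=> x y; rewrite /paste_rel eq_sym [pasted x y || _]orbC. Qed.

Lemma paste_rel_trans : transitive paste_rel.
Proof.
move=> y x z /or3P[/eqP -> //|xy|yx] /or3P[/eqP <-|yz|zy].
- by rewrite /paste_rel xy orbT.
- by case: (pasted2F xy yz).
- by rewrite (pasted_inj xy zy) paste_rel_refl.
- by rewrite /paste_rel yx !orbT.
- by rewrite (pasted_fun yx yz) paste_rel_refl.
- by case: (pasted2F zy yx).
Qed.

Canonical paste_equiv :=
  EquivRel paste_rel paste_rel_refl paste_rel_sym paste_rel_trans.

Definition periodic_vertex : choiceType := {eq_quot paste_rel}%qT.

Definition periodic_graph : metric_graph R :=
  @MetricGraph R periodic_vertex (int * edge (cell K))%type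
    (fun e => (\pi_{eq_quot paste_rel} (e.1, esrc e.2))%qT)
    (fun e => (\pi_{eq_quot paste_rel} (e.1, etgt e.2))%qT)
    (fun e => elen e.2) (fun e => elen_gt0 e.2).

End PeriodicGraph.

Section Interval.
Variable R : realType.
Implicit Types (l : R) (f g phi : R -> R).
Local Notation mu := (@lebesgue_measure R).

(* A function on [0, l] is given by a total function R -> R whose values
   outside [0, l] are ignored. *)
Definition Lp_interval (p : nat) l f :=
  measurable_fun `[0, l] f /\
  (\int[mu]_(x in `[0%R, l]) (`|f x| ^+ p)%:E < +oo)%E.

Definition test_function l phi :=
  [/\ forall x, derivable phi x 1, continuous (derive1 phi) &
      exists a b : R, [/\ 0 < a, b < l & forall x, phi x != 0 -> a <= x <= b]].

Definition is_weak_derivative l f g :=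
  forall phi, test_function l phi ->
    \int[mu]_(x in `[0, l]) (f x * derive1 phi x) =
    - \int[mu]_(x in `[0, l]) (g x * phi x).

Definition H1_interval l f :=
  Lp_interval 2 l f /\
  exists g, Lp_interval 2 l g /\ is_weak_derivative l f g.

(* A chosen weak derivative in L^2, unique almost everywhere; the default value
   0 is never used on H^1. *)
Definition weak_derivative l f : R -> R :=
  xget (cst 0) [set g | Lp_interval 2 l g /\ is_weak_derivative l f g].

End Interval.

Section Functions.
Variables (R : realType) (G : metric_graph R).
Local Notation mu := (@lebesgue_measure R).

Definition graph_fun := edge G -> R -> R.
Implicit Type u : graph_fun.

Definition graph_continuous u :=
  (forall e, {within `[0, elen e], continuous (u e)}) /\
  exists w : vertex G -> R,
    forall e, u e 0 = w (esrc e) /\ u e (elen e) = w (etgt e).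

(* The p-th power of the L^p norm on the graph. *)
Definition int_pow (p : nat) u : \bar R :=
  \esum_(e in [set: edge G])
    (\int[mu]_(x in `[0%R, elen e]) (`|u e x| ^+ p)%:E)%E.

Definition Lp_graph (p : nat) u :=
  (forall e, Lp_interval p (elen e) (u e)) /\ (int_pow p u < +oo)%E.

Definition graph_derivative u : graph_fun :=
  fun e => weak_derivative (elen e) (u e).

Definition H1 : set graph_fun :=
  [set u | [/\ graph_continuous u, forall e, H1_interval (elen e) (u e),
               Lp_graph 2 u & Lp_graph 2 (graph_derivative u)]].

Definition H1_mass (m : R) : set graph_fun :=
  [set u | H1 u /\ int_pow 2 u = m%:E].

Definition energy u : \bar R :=
  ((2^-1)%:E * int_pow 2 (graph_derivative u) - (6^-1)%:E * int_pow 6 u)%E.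

Definition ground_energy (m : R) : \bar R := ereal_inf (energy @` H1_mass m).

Definition GN_constant : R :=
  inf [set C : R | forall u, H1 u ->
    (int_pow 6 u <= C%:E * int_pow 2 u ^+ 2 * int_pow 2 (graph_derivative u))%E].

Definition critical_mass : R := Num.sqrt (3 / GN_constant).

End Functions.

(* The known critical masses of the real line and of the half-line. *)
Definition mu_line (R : realType) : R := Num.sqrt 3 / 2 * pi.
Definition mu_halfline (R : realType) : R := Num.sqrt 3 / 4 * pi.

(* Main.v *)
From Stdlib Require Import Relations.
From mathcomp Require Import all_boot all_order all_algebra generic_quotient.
From mathcomp Require Import finmap ring lra zify.
From mathcomp Require Import all_classical all_reals all_analysis.
From mathcomp Require Import measurable_realfun.
Require Import Defs.

Set Implicit Arguments.
Unset Strict Implicit.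
Unset Printing Implicit Defensive.

Import Order.TTheory GRing.Theory Num.Theory.
Import numFieldNormedType.Exports.

Local Open Scope classical_set_scope.
Local Open Scope ring_scope.

(** For T > 0 let f t = t sqrt ((T^4 - t^4) / 3) be the speed, at height t, of the
    soliton of maximum T ([profile_speed]), and let Phi be its primitive that
    vanishes at 0 ([profile_action]); Phi T = T^4 / 6 * (sqrt 3 / 4 * pi).

    Lower bounds. Let u have mass m and let T be the maximum of |u|. Since
    f(u)^2 = (T^4 u^2 - u^6) / 3, the number E(u) + T^4 m / 6 is the integral of
    (u'^2 + f(u)^2) / 2, which is at least the integral of |u' f(u)|, that is, the
    total variation of Phi(u) over the graph. This function has the value Phi T
    at the peak and tends to 0 at infinity. If from the peak there are k
    independent ways to infinity, its variation is at least k Phi T, whence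
    E(u) >= T^4 / 6 (k sqrt 3 / 4 pi - m) ([energy_gt]). A periodic graph always
    offers one way ([periodic_escaping]). Under [Hper] every nonempty finite set of
    vertices is left by at least two edges, and integration over the superlevel
    sets of Phi(|u|) gives k = 2 ([Hper_escaping], [cut_esum_ge]). The inequality
    is strict: an edge far away, where |u| < T, can be left out of the count, so
    that equality would force |u'| = |f(u)| everywhere and f(u) = 0 at some point
    of that edge; but then u has a zero, and |u'| <= T^2 |u| makes it vanish
    identically. To find an edge that can be left out when k = 2 one uses
    a vertex of degree at least 3 ([Hper_far_edge_cut]). Weighting the
    arithmetic-geometric inequality differently gives in the same way the
    Gagliardo-Nirenberg inequality with constant 3 / (k sqrt 3 / 4 pi)^2
    ([gagliardo_nirenberg]).

    Upper bounds. Functions that decrease linearly over N cells show that the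
    infimum of the energy is at most 0 for every mass ([spread_energy]). A soliton
    concentrated inside an edge, and half a soliton concentrated at a vertex of
    degree 1, show that it is - oo above the masses with k = 2 and k = 1
    respectively ([concentrated_inside], [concentrated_at_tip]).

    Thus for masses up to the threshold the infimum is 0 while all energies are
    positive, and above the threshold it is - oo while all energies are finite.
    A smaller Gagliardo-Nirenberg constant would make energies nonnegative for
    some masses above the threshold ([critical_mass_eq]). *)


(** * Integrals over segments *)

Section SegmentIntegrals.
Variable R : realType.
Local Notation mu := (@lebesgue_measure R).
Implicit Types (a b c d : R) (f g F : R -> R).

Definition seg_integrable a b f := mu.-integrable `[a, b] (EFin \o f).

Definition seg_int a b f : R := \int[mu]_(x in `[a, b]) f x.

Lemma seg_integrableS a b c d f : a <= c -> d <= b ->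
  seg_integrable a b f -> seg_integrable c d f.
Proof.
move=> ac db; apply: integrableS => //.
by apply: subset_itv; rewrite bnd_simp.
Qed.

Lemma seg_int_split a b c f : a <= c -> c <= b -> seg_integrable a b f ->
  seg_int a b f = seg_int a c f + seg_int c b f.
Proof.
move=> ac cb fi; apply/eqP; rewrite addrC -subr_eq; apply/eqP.
rewrite /seg_int Rintegral_itvB ?bnd_simp//.
rewrite Rintegral_itv_obnd_cbnd//.
apply: integrableS fi => //.
by apply: subset_itv; rewrite bnd_simp.
Qed.

Lemma seg_int1 a f : seg_int a a f = 0.
Proof. by rewrite /seg_int set_itv1 Rintegral_set1. Qed.

Lemma seg_integrable_measurable a b f :
  seg_integrable a b f -> measurable_fun `[a, b] f.
Proof. by move=> /measurable_int /measurable_EFinP. Qed.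

Lemma continuous_seg_integrable a b f :
  {within `[a, b], continuous f} -> seg_integrable a b f.
Proof. by move=> fc; apply: continuous_compact_integrable => //; exact: segment_compact. Qed.

Lemma continuous_seg_integrableT a b f : continuous f -> seg_integrable a b f.
Proof. by move=> fc; apply: continuous_seg_integrable; exact: continuous_subspaceT. Qed.

Lemma seg_integrable_cst a b k : seg_integrable a b (cst k).
Proof. by apply: continuous_seg_integrableT => x; exact: cvg_cst. Qed.

Lemma seg_int_cst a b k : a <= b -> seg_int a b (cst k) = k * (b - a).
Proof.
move=> ab; rewrite /seg_int Rintegral_cst//= lebesgue_measure_itv/= lte_fin.
by case: ltgtP ab => // -> _; rewrite subrr.
Qed.

Lemma seg_integrable_dom a b f g : measurable_fun `[a, b] f ->
  (forall x, a <= x <= b -> `|f x| <= g x) ->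
  seg_integrable a b g -> seg_integrable a b f.
Proof.
move=> mf fg; apply: le_integrable => //; first exact/measurable_EFinP.
move=> x /=; rewrite in_itv/= => /fg fgx.
by rewrite lee_fin (le_trans fgx)// ler_norm.
Qed.

Lemma seg_integrableD a b f g : seg_integrable a b f -> seg_integrable a b g ->
  seg_integrable a b (fun x => f x + g x).
Proof. by move=> fi gi; exact: (integrableD _ fi gi). Qed.

Lemma seg_integrableZ a b k f : seg_integrable a b f ->
  seg_integrable a b (fun x => k * f x).
Proof. by move=> fi; exact: (integrableZl _ _ fi). Qed.

Lemma seg_integrableB a b f g : seg_integrable a b f -> seg_integrable a b g ->
  seg_integrable a b (fun x => f x - g x).
Proof. by move=> fi gi; exact: (integrableB _ fi gi). Qed.

Lemma seg_integrable_norm a b f : seg_integrable a b f ->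
  seg_integrable a b (fun x => `|f x|).
Proof. by move=> fi; exact: integrable_norm. Qed.

Lemma seg_intD a b f g : seg_integrable a b f -> seg_integrable a b g ->
  seg_int a b (fun x => f x + g x) = seg_int a b f + seg_int a b g.
Proof. by move=> fi gi; rewrite /seg_int RintegralD. Qed.

Lemma seg_intB a b f g : seg_integrable a b f -> seg_integrable a b g ->
  seg_int a b (fun x => f x - g x) = seg_int a b f - seg_int a b g.
Proof. by move=> fi gi; rewrite /seg_int RintegralB. Qed.

Lemma seg_intZ a b k f : seg_integrable a b f ->
  seg_int a b (fun x => k * f x) = k * seg_int a b f.
Proof. by move=> fi; rewrite /seg_int RintegralZl. Qed.

Lemma le_seg_int a b f g : seg_integrable a b f -> seg_integrable a b g ->
  (forall x, a <= x <= b -> f x <= g x) -> seg_int a b f <= seg_int a b g.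
Proof.
by move=> fi gi fg; apply: le_Rintegral => // x; rewrite /= in_itv; exact: fg.
Qed.

Lemma seg_int_ge0 a b f : (forall x, a <= x <= b -> 0 <= f x) ->
  0 <= seg_int a b f.
Proof. by move=> f0; apply: Rintegral_ge0 => x; rewrite /= in_itv; exact: f0. Qed.

Lemma eq_seg_int a b f g : (forall x, a <= x <= b -> f x = g x) ->
  seg_int a b f = seg_int a b g.
Proof.
by move=> fg; apply: eq_Rintegral => x; rewrite inE/= in_itv; exact: fg.
Qed.

Lemma le_norm_seg_int a b f : seg_integrable a b f ->
  `|seg_int a b f| <= seg_int a b (fun x => `|f x|).
Proof. by move=> fi; exact: le_normr_Rintegral. Qed.

Lemma seg_intS a b c d f : a <= c -> c <= d -> d <= b -> seg_integrable a b f ->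
  (forall x, a <= x <= b -> 0 <= f x) -> seg_int c d f <= seg_int a b f.
Proof.
move=> ac cd db fi f0.
rewrite (@seg_int_split a b c)//; last exact: le_trans db.
rewrite (@seg_int_split c b d)//; last exact: seg_integrableS fi.
rewrite addrCA lerDl addr_ge0// seg_int_ge0// => x /andP[x1 x2]; apply: f0.
  by rewrite x1 (le_trans x2)// (le_trans cd).
by rewrite x2 (le_trans ac)// (le_trans cd).
Qed.

Lemma EFin_seg_int a b f : seg_integrable a b f ->
  (seg_int a b f)%:E = (\int[mu]_(x in `[a, b]) (f x)%:E)%E.
Proof. by move=> fi; rewrite /seg_int fineK//; exact: integrable_fin_num. Qed.

Lemma seg_integrable_ge0 a b f : measurable_fun `[a, b] f ->
  (forall x, 0 <= f x) -> (\int[mu]_(x in `[a, b]) (f x)%:E < +oo)%E ->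
  seg_integrable a b f.
Proof.
move=> mf f0 foo; apply/integrableP; split; first exact/measurable_EFinP.
by under eq_integral do rewrite /= ger0_norm//.
Qed.

Lemma seg_int_FTC a b F f : a <= b -> (forall x : R, is_derive x 1 F (f x)) ->
  continuous f -> seg_int a b f = F b - F a.
Proof.
rewrite le_eqVlt => /predU1P[<- _ _|ab dF cf].
  by rewrite seg_int1 subrr.
apply: EFin_inj; rewrite EFin_seg_int; last exact: continuous_seg_integrableT.
have cF : continuous F.
  by move=> x; apply/differentiable_continuous/derivable1_diffP; case: (dF x).
rewrite (@continuous_FTC2 _ f F)//.
- exact: continuous_subspaceT.
- split.
  + by move=> x _; case: (dF x).
  + exact/cvg_at_right_filter/cF.
  + exact/cvg_at_left_filter/cF.
- by move=> x _; rewrite derive1E; exact: derive_val.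
Qed.

(** A property of subsegments that is additive and holds locally around every
    point holds globally: the supremum of the points reachable from the left
    end is reachable and cannot be an interior point. *)
Lemma segment_induction (Q : R -> R -> Prop) a b : a <= b ->
  (forall x y z, a <= x -> x <= y -> y <= z -> z <= b ->
     Q x y -> Q y z -> Q x z) ->
  (forall x, a <= x <= b -> exists2 d : R, 0 < d &
     forall y z, a <= y -> y <= x -> x <= z -> z <= b ->
       x - d < y -> z < x + d -> Q y z) ->
  Q a b.
Proof.
move=> ab Qtrans Qloc.
pose S := [set x | a <= x <= b /\ Q a x].
have Sa : S a.
  split; first by rewrite lexx.
  have [|d d0 H] := Qloc a; first by rewrite lexx.
  by apply: H; rewrite ?ltrDl ?ltrBlDr ?ltrDl.
have Sub : has_sup S by split; [exists a | exists b => x [/andP[]]].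
pose s := sup S.
have sab : a <= s <= b.
  apply/andP; split; first by apply: ub_le_sup Sa; case: Sub.
  by apply: ge_sup; [exists a | move=> x [/andP[]]].
have [d d0 H] := Qloc s sab.
have [x [xab Qx] sx] := sup_adherent d0 Sub.
have xs : x <= s by apply: ub_le_sup; [case: Sub | split].
move: (xab) (sab) => /andP[ax xb] /andP[as_ sb].
have Qz z : s <= z -> z <= b -> z < s + d -> Q a z.
  by move=> sz zb zd; apply: (Qtrans a x z) => //; [exact: le_trans sz | exact: H].
have [sltb|bs] := ltP s b; last first.
  by apply: Qz => //; rewrite (le_lt_trans bs)// ltrDl.
pose z := Num.min b (s + d / 2).
have sz : s < z by rewrite lt_min sltb ltrDl divr_gt0.
have zb : z <= b by rewrite ge_min lexx.
have Sz : S z.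
  split; first by rewrite zb (le_trans as_)// ltW.
  apply: Qz => //; first exact: ltW.
  by rewrite gt_min ltrD2l gtr_pMr// invf_lt1 ?ltr1n ?orbT.
have : z <= s by apply: ub_le_sup Sz; case: Sub.
by rewrite leNgt sz.
Qed.

End SegmentIntegrals.

(** * Absolutely continuous functions on a segment *)

Section WeakDerivatives.
Variable R : realType.
Local Notation mu := (@lebesgue_measure R).
Implicit Types (a b l x y : R) (f g u : R -> R).

Lemma within_continuous_eps a b f x e : {within `[a, b], continuous f} ->
  a <= x <= b -> 0 < e ->
  exists2 d : R, 0 < d & forall y, a <= y <= b -> `|x - y| < d -> `|f x - f y| <= e.
Proof.
move=> /subspace_continuousP fc xab e0.
have /fc/cvgrPdist_le/(_ e e0) : `[a, b]%classic x by rewrite /= in_itv.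
rewrite near_withinE => /nbhs_ballP[d /= d0 H]; exists d => // y yab xy.
by apply: H => //=; rewrite in_itv.
Qed.

Lemma seg_int_norm_sqr a b f : a <= b -> seg_integrable a b f ->
  seg_integrable a b (fun x => f x ^+ 2) ->
  seg_int a b (fun x => `|f x|) ^+ 2 <= (b - a) * seg_int a b (fun x => f x ^+ 2).
Proof.
move=> ab fi f2i; move: (ab); rewrite le_eqVlt => /predU1P[<-|ltab].
  by rewrite !seg_int1 expr0n/= mulr0.
set B := seg_int a b _; pose k := B / (b - a).
have ba0 : 0 < b - a by rewrite subr_gt0.
have ai : seg_integrable a b (fun x => `|f x|) by exact: seg_integrable_norm.
have ci := seg_integrable_cst a b (k ^+ 2).
have zi := seg_integrableZ (2 * k) ai.
have : 0 <= seg_int a b (fun x => (f x ^+ 2 - 2 * k * `|f x|) + cst (k ^+ 2) x).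
  apply: seg_int_ge0 => x _ /=; rewrite -real_normK ?num_real//.
  by rewrite (_ : _ + _ = (`|f x| - k) ^+ 2) ?sqr_ge0//; ring.
rewrite seg_intD//; last exact: seg_integrableB.
rewrite seg_intB// seg_intZ// seg_int_cst// -/B.
rewrite (_ : _ + _ = seg_int a b (fun x => f x ^+ 2) - B ^+ 2 / (b - a)); last first.
  by rewrite /k; field; rewrite gt_eqF.
by rewrite subr_ge0 ler_pdivrMr// mulrC.
Qed.

Lemma Lp2_integrable l g : Lp_interval 2 l g ->
  seg_integrable 0 l (fun x => g x ^+ 2) /\ seg_integrable 0 l g.
Proof.
move=> [mg gfin].
have g2i : seg_integrable 0 l (fun x => g x ^+ 2).
  apply: seg_integrable_ge0; first exact: measurable_funX.
    by move=> x; exact: sqr_ge0.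
  by under eq_integral do rewrite -real_normK ?num_real//.
split=> //.
apply: (@seg_integrable_dom _ _ _ _ (fun x => cst 1 x + g x ^+ 2)) => //.
  move=> x _ /=; have := sqr_ge0 (`|g x| - 1).
  rewrite -[g x ^+ 2]real_normK ?num_real//; have := normr_ge0 (g x); nra.
by apply: seg_integrableD => //; exact: seg_integrable_cst.
Qed.

Lemma is_derive_quadratic f x d k :
  (forall h, `|f (x + h) - f x - h * d| <= k * h ^+ 2) -> is_derive x 1 f d.
Proof.
move=> H.
have H2 : (fun h => h^-1 *: (f (h *: 1 + x) - f x)) @ 0^' --> d.
  apply/cvgrPdist_le => e e0; near=> h.
  have h0 : h != 0 by near: h; exact: nbhs_dnbhs_neq.
  have -> : d - h^-1 *: (f (h *: 1 + x) - f x) = - (h^-1 * (f (x + h) - f x - h * d)).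
    by rewrite /GRing.scale /= mulr1 [h + x]addrC; field.
  rewrite normrN normrM normfV ler_pdivrMl ?normr_gt0//.
  apply: (le_trans (H h)); rewrite -real_normK ?num_real// expr2 mulrA.
  rewrite [leRHS]mulrC ler_wpM2r//.
  have k1 : 0 < `|k| + 1 by rewrite ltr_pwDr.
  apply: (@le_trans _ _ ((`|k| + 1) * `|h|)).
    by rewrite ler_wpM2r// (le_trans (ler_norm k))// lerDl.
  rewrite -ler_pdivlMl//; near: h; apply: dnbhs0_le.
  by rewrite mulr_gt0 ?invr_gt0.
by split; [apply/cvg_ex; exists d | exact: cvg_lim H2].
Unshelve. all: by end_near. Qed.

(** Test functions need only be continuously differentiable, so second
    differences of the positive part and of half its square provide a bump of
    integral one and its primitive. *)
Definition ramp x : R := Num.max 0 x.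
Definition ramp2 x : R := ramp x ^+ 2 / 2.
Definition hat x : R := ramp x - 2 * ramp (x - 1) + ramp (x - 2).
Definition smooth_step x : R := ramp2 x - 2 * ramp2 (x - 1) + ramp2 (x - 2).

Lemma rampP x : (x <= 0 /\ ramp x = 0) \/ (0 <= x /\ ramp x = x).
Proof. by rewrite /ramp; case: (leP 0 x) => ?; [right|left; split=> //; exact: ltW]. Qed.

Lemma ramp_continuous : continuous ramp.
Proof. by move=> x; apply: (@continuous_max _ _ (cst 0) id) => //; exact: cvg_cst. Qed.

Lemma hat_continuous : continuous hat.
Proof.
have sh k : continuous (fun x => ramp (x - k)).
  move=> x; apply: (@continuous_comp _ _ _ (fun x => x - k) ramp).
    by apply: cvgB; [exact: cvg_id|exact: cvg_cst].
  exact: ramp_continuous.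
move=> x; apply: cvgD; last exact: sh.
apply: cvgB; first exact: ramp_continuous.
by apply: cvgM; [exact: cvg_cst|exact: sh].
Qed.

Lemma is_derive_ramp2 x : is_derive x 1 ramp2 (ramp x).
Proof.
apply: (@is_derive_quadratic _ _ _ 1) => h; rewrite /ramp2.
case: (rampP x) => -[? ->]; case: (rampP (x + h)) => -[? ->];
  by rewrite ler_norml; apply/andP; split; nra.
Qed.

Lemma is_derive_smooth_step x : is_derive x 1 smooth_step (hat x).
Proof.
have sh k : is_derive x 1 (fun x => ramp2 (x - k)) (ramp (x - k)).
  have := is_derive_ramp2 (x - k) => H.
  have := @is_derive1_comp _ ramp2 (fun x => x - k) x (ramp (x - k)) 1 H.
  by rewrite mulr1; apply; apply: is_derive_eq; rewrite subr0.
exact: (is_deriveD (is_deriveB (is_derive_ramp2 x) (is_deriveZ 2 (sh 1))) (sh 2)).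
Qed.

Lemma hat_ge0 x : 0 <= hat x.
Proof.
by rewrite /hat; case: (rampP x) => -[? ->]; case: (rampP (x - 1)) => -[? ->];
  case: (rampP (x - 2)) => -[? ->]; lra.
Qed.

Lemma hat_out x : x <= 0 \/ 2 <= x -> hat x = 0.
Proof.
by rewrite /hat; case: (rampP x) => -[? ->]; case: (rampP (x - 1)) => -[? ->];
  case: (rampP (x - 2)) => -[? ->]; lra.
Qed.

Lemma smooth_step0 x : x <= 0 -> smooth_step x = 0.
Proof.
by rewrite /smooth_step /ramp2; case: (rampP x) => -[? ->];
  case: (rampP (x - 1)) => -[? ->]; case: (rampP (x - 2)) => -[? ->]; nra.
Qed.

Lemma smooth_step1 x : 2 <= x -> smooth_step x = 1.
Proof.
move=> x2; rewrite /smooth_step /ramp2 /ramp !max_r; try lra.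
Qed.

Lemma smooth_step_itv x : 0 <= smooth_step x <= 1.
Proof.
by rewrite /smooth_step /ramp2; case: (rampP x) => -[? ->];
  case: (rampP (x - 1)) => -[? ->]; case: (rampP (x - 2)) => -[? ->];
  apply/andP; split; nra.
Qed.

Lemma scaled_hat_continuous (c d : R) : continuous (fun x => hat ((x - c) / d) / d).
Proof.
move=> x; apply: cvgM; last exact: cvg_cst.
apply: (@continuous_comp _ _ _ (fun x => (x - c) / d) hat); last exact: hat_continuous.
by apply: cvgM; [apply: cvgB; [exact: cvg_id|exact: cvg_cst]|exact: cvg_cst].
Qed.

Lemma within_continuousM (A : set R) f h : {within A, continuous f} ->
  continuous h -> {within A, continuous (fun x => f x * h x)}.
Proof.
by move=> fc hc x; apply: cvgM; [exact: fc|apply: continuous_subspaceT].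
Qed.

Lemma is_derive_affine (c k x : R) : is_derive x 1 (fun x => (x - c) / k) k^-1.
Proof.
have := is_deriveM (is_deriveB (is_derive_id x 1) (is_derive_cst c x 1)) (is_derive_cst k^-1 x 1).
by move=> H; apply: is_derive_eq; rewrite /= scaler0 add0r subr0 /GRing.scale/= mulr1.
Qed.

Lemma is_derive_scaled_step (c d x : R) :
  is_derive x 1 (fun x => smooth_step ((x - c) / d)) (hat ((x - c) / d) / d).
Proof.
exact: (@is_derive1_comp _ (@smooth_step) (fun x => (x - c) / d) x _ _
  (is_derive_smooth_step ((x - c) / d)) (is_derive_affine c d x)).
Qed.

(** The test function rises from 0 to 1 on [a, a + 2 d] and falls
    back on [b, b + 2 d]. *)
Lemma test_function_bump l a b d : 0 < a -> a < b -> 0 < d -> b + 2 * d < l ->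
  test_function l (fun x => smooth_step ((x - a) / d) - smooth_step ((x - b) / d)) /\
  (forall x : R, is_derive x 1
     (fun x => smooth_step ((x - a) / d) - smooth_step ((x - b) / d))
     (hat ((x - a) / d) / d - hat ((x - b) / d) / d)).
Proof.
move=> a0 ab d0 bl.
have dn : d != 0 by rewrite gt_eqF.
have D (x : R) : is_derive x 1
     (fun x => smooth_step ((x - a) / d) - smooth_step ((x - b) / d))
     (hat ((x - a) / d) / d - hat ((x - b) / d) / d).
  exact: is_deriveB (is_derive_scaled_step a d x) (is_derive_scaled_step b d x).
split=> //; split.
- by move=> x; case: (D x).
- set F := fun x => _; have -> : derive1 F = fun x => hat ((x - a) / d) / d - hat ((x - b) / d) / d.
    by apply/funext => x; rewrite derive1E; exact: derive_val.
  by move=> x; apply: cvgB; exact: scaled_hat_continuous.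
- exists a, (b + 2 * d); split=> // x; case: (ltP x a) => xa.
    rewrite !smooth_step0 ?subrr ?eqxx//; rewrite pmulr_lle0 ?invr_gt0//; lra.
  case: (leP x (b + 2 * d)) => // xb.
  by rewrite !smooth_step1 ?subrr ?eqxx// ler_pdivlMr//; lra.
Qed.

(** The rescaled bump is an approximate unit to the right of [a]. *)
Lemma seg_int_hat l a d f e : 0 <= a -> 0 < d -> a + 2 * d <= l ->
  {within `[0, l], continuous f} ->
  (forall x, a <= x <= a + 2 * d -> `|f x - f a| <= e) ->
  `|seg_int 0 l (fun x => f x * (hat ((x - a) / d) / d)) - f a| <= e.
Proof.
move=> a0 d0 al fc fe.
have l0 : 0 <= l by nra.
have hc := @scaled_hat_continuous a d.
pose h x := hat ((x - a) / d) / d.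
have hi : seg_integrable 0 l h by exact: continuous_seg_integrableT.
have h1 : seg_int 0 l h = 1.
  rewrite (seg_int_FTC l0 (is_derive_scaled_step a d) hc).
  rewrite smooth_step1 ?ler_pdivlMr//; last lra.
  by rewrite smooth_step0 ?subr0// pmulr_lle0 ?invr_gt0//; lra.
have fhc : {within `[0, l], continuous (fun x => f x * h x)}.
  move=> x; apply: cvgM; first exact: fc.
  by apply: continuous_subspaceT.
have fhi := continuous_seg_integrable fhc.
have -> : seg_int 0 l (fun x => f x * h x) - f a =
    seg_int 0 l (fun x => f x * h x - f a * h x).
  by rewrite seg_intB ?seg_intZ ?h1 ?mulr1//; exact: seg_integrableZ.
have di : seg_integrable 0 l (fun x => f x * h x - f a * h x).
  by apply: seg_integrableB => //; exact: seg_integrableZ.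
apply: (le_trans (le_norm_seg_int di)).
rewrite -[leRHS]mulr1 -h1 -seg_intZ//; apply: le_seg_int => //.
- exact: seg_integrable_norm.
- exact: seg_integrableZ.
move=> x _; rewrite -mulrBl normrM.
have h0 : 0 <= h x by rewrite /h divr_ge0 ?hat_ge0// ltW.
rewrite (ger0_norm h0).
have [xa|xa] := leP x a.
  by rewrite /h hat_out ?mul0r ?mulr0//; left; rewrite pmulr_lle0 ?invr_gt0//; lra.
have [xb|xb] := leP (a + 2 * d) x.
  by rewrite /h hat_out ?mul0r ?mulr0//; right; rewrite ler_pdivlMr//; lra.
by rewrite ler_wpM2r// fe// !ltW.
Qed.

(** By Cauchy-Schwarz the integral of |g| is at most of the order of the square
    root of the length. *)
Lemma small_seg_int_norm l g e : 0 <= l -> seg_integrable 0 l g ->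
  seg_integrable 0 l (fun x => g x ^+ 2) -> 0 < e ->
  exists2 d : R, 0 < d & forall x y, 0 <= x -> x <= y -> y <= l -> y - x <= d ->
    seg_int x y (fun x => `|g x|) <= e.
Proof.
move=> l0 gi g2i e0; set N := seg_int 0 l (fun x => g x ^+ 2).
have N0 : 0 <= N by apply: seg_int_ge0 => *; exact: sqr_ge0.
exists (e ^+ 2 / (N + 1)) => [|x y x0 xy yl yx].
  by rewrite divr_gt0 ?exprn_gt0// ltr_wpDl.
have [gi' g2i'] := (seg_integrableS x0 yl gi, seg_integrableS x0 yl g2i).
have B0 : 0 <= seg_int x y (fun x => `|g x|) by apply: seg_int_ge0.
rewrite -(@ler_pXn2r _ 2)// ?nnegrE//; last exact: ltW.
apply: (le_trans (seg_int_norm_sqr xy gi' g2i')).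
have N' : seg_int x y (fun x => g x ^+ 2) <= N.
  by apply: seg_intS => // *; exact: sqr_ge0.
rewrite ler_pdivlMr ?ltr_wpDl// in yx.
apply: le_trans yx; rewrite ler_wpM2l// ?subr_ge0//.
by rewrite (le_trans N')// lerDl.
Qed.

(** Test with a bump that rises just after [x] and falls just after [y]: its
    derivative extracts [f x - f y], and the bump itself the integral of [g].
    Each of the two values of f and of the three short pieces of the integral of
    g contributes an error [e]. *)
Lemma weak_derivative_increment_interior l f g e x y : 0 < e ->
  {within `[0, l], continuous f} -> seg_integrable 0 l g ->
  seg_integrable 0 l (fun x => g x ^+ 2) -> is_weak_derivative l f g ->
  0 < x -> x < y -> y < l -> `|f y - f x - seg_int x y g| <= 5 * e.
Proof.
move=> e0 fc gi g2i fg x0 xy yl.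
have l0 : 0 <= l by lra.
have [d1 d10 fx] : exists2 d : R, 0 < d & forall z, 0 <= z <= l -> `|x - z| < d -> `|f x - f z| <= e.
  by apply: within_continuous_eps => //; lra.
have [d2 d20 fy] : exists2 d : R, 0 < d & forall z, 0 <= z <= l -> `|y - z| < d -> `|f y - f z| <= e.
  by apply: within_continuous_eps => //; lra.
have [d3 d30 gs] := small_seg_int_norm l0 gi g2i e0.
have [d [d0 xyd yld d1d [d2d d3d]]] : exists d, [/\ 0 < d, x + 2 * d <= y, y + 2 * d < l,
    2 * d < d1 & 2 * d < d2 /\ 2 * d < d3].
  exists (Num.min (Num.min (y - x) (l - y)) (Num.min d1 (Num.min d2 d3)) / 4).
  set m := Num.min _ _.
  have : 0 < m by rewrite !lt_min d10 d20 d30 !subr_gt0 xy yl.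
  have : m <= y - x by rewrite !ge_min lexx.
  have : m <= l - y by rewrite !ge_min lexx ?orbT.
  have : m <= d1 by rewrite !ge_min lexx ?orbT.
  have : m <= d2 by rewrite !ge_min lexx ?orbT.
  have : m <= d3 by rewrite !ge_min lexx ?orbT.
  by split; lra.
have [x0l xl xd xdl] : [/\ 0 <= x, x <= l, x <= x + 2 * d & x + 2 * d <= l] by split; lra.
have [y0 yl' yd ydl] : [/\ 0 <= y, y <= l, y <= y + 2 * d & y + 2 * d <= l] by split; lra.
have xd0 : 0 <= x + 2 * d by lra.
have yd0 : 0 <= y + 2 * d by lra.
have fxd z : x <= z <= x + 2 * d -> `|f z - f x| <= e.
  by move=> zx; rewrite distrC; apply: fx; [lra|rewrite ltr_norml; lra].
have fyd z : y <= z <= y + 2 * d -> `|f z - f y| <= e.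
  by move=> zx; rewrite distrC; apply: fy; [lra|rewrite ltr_norml; lra].
have small a h : 0 <= a -> a <= a + 2 * d -> a + 2 * d <= l -> seg_integrable 0 l h ->
    (forall z, `|h z| <= `|g z|) -> `|seg_int a (a + 2 * d) h| <= e.
  move=> a0 ad al hi hg.
  have hi' := seg_integrableS a0 al hi; have gi' := seg_integrableS a0 al gi.
  apply: (le_trans (le_norm_seg_int hi')).
  apply: (le_trans _ (gs a (a + 2 * d) a0 ad al _)); last by rewrite addrAC subrr add0r ltW.
  by apply: le_seg_int => //; exact: seg_integrable_norm.
have below c z : z <= c -> (z - c) / d <= 0 by move=> zc; rewrite pmulr_lle0 ?invr_gt0// subr_le0.
have above c z : c + 2 * d <= z -> 2 <= (z - c) / d.
  by move=> cz; rewrite ler_pdivlMr// lerBrDl.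
have [tphi dphi] := test_function_bump x0 xy d0 yld.
set phi := (fun x0 => _) in tphi dphi.
have pc : continuous phi.
  by move=> z; apply/differentiable_continuous/derivable1_diffP; case: (dphi z).
have := fg _ tphi.
have -> : derive1 phi = fun z => hat ((z - x) / d) / d - hat ((z - y) / d) / d.
  by apply/funext => z; rewrite derive1E; exact: derive_val.
rewrite -!/(seg_int _ _ _) => E.
have phi_le1 z : `|phi z| <= 1.
  rewrite /phi; have := smooth_step_itv ((z - x) / d).
  have := smooth_step_itv ((z - y) / d) => /andP[? ?] /andP[? ?].
  by rewrite ler_norml; lra.
have gpi : seg_integrable 0 l (fun z => g z * phi z).
  apply: (@seg_integrable_dom _ _ _ _ (fun x => `|g x|)); last exact: seg_integrable_norm.
    apply: measurable_funM; first exact: seg_integrable_measurable.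
    by apply: seg_integrable_measurable; exact: continuous_seg_integrableT.
  by move=> z _; rewrite normrM ler_piMr.
have hc c : seg_integrable 0 l (fun z => f z * (hat ((z - c) / d) / d)).
  apply: continuous_seg_integrable; apply: within_continuousM => //.
  exact: scaled_hat_continuous.
have Hx := @seg_int_hat l x d f e; have Hy := @seg_int_hat l y d f e.
move: E; under eq_seg_int do rewrite mulrBr.
rewrite seg_intB// => E.
have {}Hx : `|seg_int 0 l (fun z => f z * (hat ((z - x) / d) / d)) - f x| <= e by exact: Hx.
have {}Hy : `|seg_int 0 l (fun z => f z * (hat ((z - y) / d) / d)) - f y| <= e by exact: Hy.
(* The bump vanishes, rises, equals 1, falls and vanishes again on the five
   pieces whose integrals are S1, S2, S3, S4 and S5. *)
have S1 : seg_int 0 x (fun z => g z * phi z) = 0.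
  rewrite (@eq_seg_int _ _ _ _ (cst 0)) ?seg_int_cst ?mul0r// => z /andP[_ zx] /=.
  by rewrite /phi !smooth_step0 ?subr0 ?mulr0//; apply: below => //; exact: le_trans zx (ltW xy).
have S5 : seg_int (y + 2 * d) l (fun z => g z * phi z) = 0.
  rewrite (@eq_seg_int _ _ _ _ (cst 0)) ?seg_int_cst ?mul0r// => z /andP[yz _] /=.
  rewrite /phi !smooth_step1 ?subrr ?mulr0//; apply: above => //.
  by apply: le_trans yz; rewrite lerD2r ltW.
have S3 : seg_int (x + 2 * d) y (fun z => g z * phi z) = seg_int (x + 2 * d) y g.
  apply: eq_seg_int => z /andP[xz zy] /=.
  by rewrite /phi smooth_step1 ?smooth_step0 ?subr0 ?mulr1//; [exact: below|exact: above].
have gp_le z : `|g z * phi z| <= `|g z| by rewrite normrM ler_piMr.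
have S2 : `|seg_int x (x + 2 * d) (fun z => g z * phi z)| <= e by exact: small.
have S2' : `|seg_int x (x + 2 * d) g| <= e by exact: small.
have S4 : `|seg_int y (y + 2 * d) (fun z => g z * phi z)| <= e by exact: small.
have E1 : seg_int 0 l (fun z => g z * phi z) =
    seg_int 0 x (fun z => g z * phi z) + (seg_int x (x + 2 * d) (fun z => g z * phi z) +
    (seg_int (x + 2 * d) y (fun z => g z * phi z) + (seg_int y (y + 2 * d) (fun z => g z * phi z) +
     seg_int (y + 2 * d) l (fun z => g z * phi z)))).
  have sub s t : 0 <= s -> t <= l -> seg_integrable s t (fun z => g z * phi z).
    by move=> s0 tl; exact: seg_integrableS gpi.
  rewrite -(@seg_int_split _ y l)// ?sub// -(@seg_int_split _ (x + 2 * d) l)// ?sub//.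
  by rewrite -(@seg_int_split _ x l)// ?sub// -(@seg_int_split _ 0 l)// ?sub.
have E2 : seg_int x y g = seg_int x (x + 2 * d) g + seg_int (x + 2 * d) y g.
  by rewrite -seg_int_split//; exact: seg_integrableS gi.
move: Hx Hy S2 S2' S4 E E1 E2; rewrite S1 S5 S3 !ler_norml; clear; lra.
Qed.

(** A weak derivative is a density of the increments, up to the end points by
    continuity. *)
Lemma weak_derivative_increment l f g x y :
  {within `[0, l], continuous f} -> seg_integrable 0 l g ->
  seg_integrable 0 l (fun x => g x ^+ 2) -> is_weak_derivative l f g ->
  0 <= x -> x <= y -> y <= l -> f y - f x = seg_int x y g.
Proof.
move=> fc gi g2i fg x0; rewrite le_eqVlt => /predU1P[<-|xy] yl.
  by rewrite seg_int1 subrr.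
have l0 : 0 <= l by lra.
apply/eqP; rewrite -subr_eq0 -normr_le0; apply/ler_addgt0Pr => e' e'0; rewrite add0r.
pose e := e' / 9; have e0 : 0 < e by rewrite divr_gt0.
have [d1 d10 fx] : exists2 d : R, 0 < d & forall z, 0 <= z <= l -> `|x - z| < d -> `|f x - f z| <= e.
  by apply: within_continuous_eps => //; lra.
have [d2 d20 fy] : exists2 d : R, 0 < d & forall z, 0 <= z <= l -> `|y - z| < d -> `|f y - f z| <= e.
  by apply: within_continuous_eps => //; lra.
have [d3 d30 gs] := small_seg_int_norm l0 gi g2i e0.
pose m := Num.min (y - x) (Num.min d1 (Num.min d2 d3)) / 3.
have m0 : 0 < m by rewrite divr_gt0// !lt_min d10 d20 d30 !subr_gt0 xy.
have m1 : 3 * m <= y - x by rewrite /m mulrC divfK// !ge_min lexx.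
have m2 : 3 * m <= d1 by rewrite /m mulrC divfK// !ge_min lexx ?orbT.
have m3 : 3 * m <= d2 by rewrite /m mulrC divfK// !ge_min lexx ?orbT.
have m4 : 3 * m <= d3 by rewrite /m mulrC divfK// !ge_min lexx ?orbT.
have H := @weak_derivative_increment_interior l f g e (x + m) (y - m) e0 fc gi g2i fg.
have [xm xmy yml ym] : [/\ x <= x + m, x + m < y - m, y - m < l & y - m <= y] by split; lra.
have [xm0 yml0 xml ymy] : [/\ 0 < x + m, 0 <= y - m, x + m <= l & y - m <= l] by split; lra.
have {}H : `|f (y - m) - f (x + m) - seg_int (x + m) (y - m) g| <= 5 * e by exact: H.
have {}fx : `|f x - f (x + m)| <= e by apply: fx; rewrite ?ltr_norml; lra.
have {}fy : `|f y - f (y - m)| <= e by apply: fy; rewrite ?ltr_norml; lra.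
have E : seg_int x y g = seg_int x (x + m) g + (seg_int (x + m) (y - m) g + seg_int (y - m) y g).
  have xmyl : x + m <= y by rewrite (le_trans (ltW xmy)).
  rewrite -(@seg_int_split _ (x + m) y)//; [|exact: ltW|exact: seg_integrableS (ltW xm0) yl gi].
  by rewrite -seg_int_split//; exact: seg_integrableS gi.
have small a : 0 <= a -> a + m <= l -> `|seg_int a (a + m) g| <= e.
  move=> a0 al; apply: (le_trans (le_norm_seg_int (seg_integrableS a0 al gi))).
  by apply: gs => //; [rewrite lerDl ltW|rewrite addrAC subrr add0r; clear -m4 m0; lra].
have Sx : `|seg_int x (x + m) g| <= e by exact: small.
have Sy : `|seg_int (y - m) y g| <= e by have := small (y - m); rewrite subrK; apply.
have e9 : e' = 9 * e by rewrite /e; field.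
move: H fx fy Sx Sy; rewrite E e9 !ler_norml; clear; lra.
Qed.

End WeakDerivatives.

Section SobolevFunctions.
Variable R : realType.
Local Notation mu := (@lebesgue_measure R).
Implicit Types (a b l x y : R) (f g u : R -> R).

Lemma weak_derivativeP l f : H1_interval l f ->
  Lp_interval 2 l (weak_derivative l f) /\ is_weak_derivative l f (weak_derivative l f).
Proof.
by move=> [_ [g gP]]; rewrite /weak_derivative; case: xgetP => [h _ hP|/(_ g)] //.
Qed.

Lemma continuousX f n : continuous f -> continuous (fun x => `|f x| ^+ n).
Proof.
move=> fc x; apply: (@continuous_comp _ _ _ (fun x => `|f x|) (fun y : R => y ^+ n)).
  by apply: (@continuous_comp _ _ _ f (fun y : R => `|y|)); [exact: fc|exact: norm_continuous].
exact: exprn_continuous.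
Qed.

Lemma continuous_Lp p l f : continuous f -> Lp_interval p l f.
Proof.
move=> fc; split.
  by apply: seg_integrable_measurable; exact: continuous_seg_integrableT.
rewrite -EFin_seg_int ?ltry//.
by apply: continuous_seg_integrableT; exact: continuousX.
Qed.

Lemma C1_weak_derivative l f f' : 0 <= l -> (forall x : R, is_derive x 1 f (f' x)) ->
  continuous f' -> is_weak_derivative l f f'.
Proof.
move=> l0 df f'c phi [dphi phi'c [a [b [a0 bl supp]]]].
have fc : continuous f.
  by move=> x; apply/differentiable_continuous/derivable1_diffP; case: (df x).
have pc : continuous phi.
  by move=> x; apply/differentiable_continuous/derivable1_diffP; exact: dphi.
have dp (x : R) : is_derive x 1 phi (derive1 phi x).
  by split; [exact: dphi|rewrite derive1E].
pose F x := f x * phi x.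
have dF (x : R) : is_derive x 1 F (f x * derive1 phi x + f' x * phi x).
  have := is_deriveM (df x) (dp x) => H.
  by apply: is_derive_eq; rewrite /GRing.scale/= [phi x * _]mulrC.
have c1 : continuous (fun x => f x * derive1 phi x).
  by move=> x; apply: cvgM; [exact: fc|exact: phi'c].
have c2 : continuous (fun x => f' x * phi x).
  by move=> x; apply: cvgM; [exact: f'c|exact: pc].
have cs : continuous (fun x => f x * derive1 phi x + f' x * phi x).
  by move=> x; apply: cvgD; [exact: c1|exact: c2].
have := seg_int_FTC l0 dF cs.
have z x : x <= 0 \/ l <= x -> phi x = 0.
  move=> xl; apply/eqP; apply: contraT => /supp; lra.
rewrite /F !z; [|by lra..].
rewrite !mulr0 subrr seg_intD; [|exact: continuous_seg_integrableT..].
by move/eqP; rewrite addr_eq0 => /eqP.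
Qed.

Lemma C1_H1_interval l f f' : 0 <= l -> (forall x : R, is_derive x 1 f (f' x)) ->
  continuous f' -> H1_interval l f.
Proof.
move=> l0 df f'c; have fc : continuous f.
  by move=> x; apply/differentiable_continuous/derivable1_diffP; case: (df x).
split; first exact: continuous_Lp.
by exists f'; split; [exact: continuous_Lp|exact: C1_weak_derivative].
Qed.

(** Both functions are densities of the increments of the same function; the
    integral of their difference is constant, so that by Lebesgue
    differentiation they agree almost everywhere. *)
Lemma weak_derivative_C1 l f f' p : 0 <= l -> (forall x : R, is_derive x 1 f (f' x)) ->
  continuous f' ->
  (\int[mu]_(x in `[0%R, l]) (`|weak_derivative l f x| ^+ p)%:E =
   (seg_int 0 l (fun x => `|f' x| ^+ p))%:E)%E.
Proof.
move=> l0 df f'c; have fc : continuous f.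
  by move=> x; apply/differentiable_continuous/derivable1_diffP; case: (df x).
have [gL gw] := weak_derivativeP (C1_H1_interval l0 df f'c).
set g := weak_derivative l f in gL gw *.
have [g2i gi] := Lp2_integrable gL.
have fi : seg_integrable 0 l f' by exact: continuous_seg_integrableT.
have gE x : 0 <= x -> x <= l -> seg_int 0 x (fun t => g t - f' t) = 0.
  move=> x0 xl; rewrite seg_intB; [|exact: seg_integrableS gi|exact: seg_integrableS fi].
  rewrite -(weak_derivative_increment _ gi g2i gw)//; last exact: continuous_subspaceT.
  by rewrite (seg_int_FTC x0 df f'c) subrr.
pose h := (fun t => g t - f' t) \_ `[0, l].
have hi : mu.-integrable setT (EFin \o h).
  rewrite /h (_ : EFin \o _ = (EFin \o (fun t => g t - f' t)) \_ `[0, l]); last first.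
    by apply/funext => x /=; rewrite !patchE; case: ifP.
  rewrite -integrable_mkcond//; exact: seg_integrableB.
have hl : locally_integrable setT h.
  by apply: integrable_locally => //; exact: seg_integrableB.
have F0 x : \int[mu]_(t in `]-oo, x]) h t = 0.
  rewrite /h -Rintegral_mkcondr.
  have [x0|x0] := ltP x 0.
    rewrite (_ : _ `&` _ = set0) ?Rintegral_set0//.
    by apply/seteqP; split => // t [] /=; rewrite !in_itv/=; lra.
  rewrite (_ : _ `&` _ = `[0, Num.min x l]%classic); last first.
    apply/seteqP; split => t /=; rewrite !in_itv/= le_min.
      by move=> [-> /andP[-> ->]].
    by move=> /and3P[-> -> ->].
  by apply: gE; [rewrite le_min x0|rewrite ge_min lexx orbT].
have := @FTC1Ny _ h _ hl; cbv zeta; move=> /(_ _)/wrap[].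
  by move=> y; apply: integrableS hi.
move=> ae; rewrite EFin_seg_int; last first.
  by apply: continuous_seg_integrableT; exact: continuousX.
apply: ae_eq_integral => //.
- apply/measurable_EFinP/measurable_funX/measurableT_comp => //.
  exact: seg_integrable_measurable.
- apply/measurable_EFinP/measurable_funX/measurableT_comp => //.
  exact: seg_integrable_measurable.
apply: (@filterS _ _ (ae_filter_ringOfSetsType mu) _ _ _ ae) => x; rewrite (_ : (fun x => _) = cst 0); last exact/funext.
rewrite derive1_cst => -[_ hx] xl; congr (_ %:E); congr (`|_| ^+ p).
by apply/eqP; rewrite -subr_eq0; apply/eqP; rewrite hx /h patchE mem_set.
Qed.

Variables (l : R) (u g : R -> R).
Hypotheses (l0 : 0 < l) (uc : {within `[0, l], continuous u})
  (gi : seg_integrable 0 l g) (g2i : seg_integrable 0 l (fun x => g x ^+ 2))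
  (incr : forall x y, 0 <= x -> x <= y -> y <= l -> u y - u x = seg_int x y g).

Lemma increment_le x y : 0 <= x -> x <= y -> y <= l ->
  `|u y - u x| <= seg_int x y (fun t => `|g t|).
Proof.
by move=> x0 xy yl; rewrite incr//; apply: le_norm_seg_int; exact: seg_integrableS gi.
Qed.

Lemma within_continuous_sqr : {within `[0, l], continuous (fun x => u x ^+ 2)}.
Proof. by move=> x; apply: cvgM; exact: uc. Qed.

(** The values of u differ pairwise by at most the integral of |g|; averaging over
    the edge compares u x with the mass. *)
Lemma sobolev_sup_bound x : 0 <= x <= l ->
  u x ^+ 2 <= 2 / l * seg_int 0 l (fun x => u x ^+ 2) + 2 * l * seg_int 0 l (fun x => g x ^+ 2).
Proof.
move=> /andP[x0 xl]; have l0' := ltW l0.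
set N := seg_int 0 l (fun x => g x ^+ 2).
set B := seg_int 0 l (fun t => `|g t|).
have B2 : B ^+ 2 <= l * N by have := seg_int_norm_sqr l0' gi g2i; rewrite subr0.
have ai := seg_integrable_norm gi.
have uB y : 0 <= y <= l -> `|u x - u y| <= B.
  move=> /andP[y0 yl]; have [xy|/ltW yx] := leP x y.
    rewrite distrC; apply: (le_trans (increment_le x0 xy yl)).
    exact: seg_intS.
  by apply: (le_trans (increment_le y0 yx xl)); exact: seg_intS.
have u2i := continuous_seg_integrable within_continuous_sqr.
have zi := seg_integrableZ 2 u2i.
have ci k := seg_integrable_cst 0 l k.
have : seg_int 0 l (cst (u x ^+ 2)) <=
       seg_int 0 l (fun y => 2 * u y ^+ 2 + cst (2 * B ^+ 2) y).
  apply: le_seg_int; [exact: ci|exact: seg_integrableD|move=> y yl /=].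
  have := uB y yl; rewrite ler_norml => /andP[h1 h2].
  have B0 : 0 <= B by apply: seg_int_ge0.
  have : (u x - u y) ^+ 2 <= B ^+ 2.
    nra.
  have := sqr_ge0 (u x - 2 * u y); nra.
rewrite seg_intD// seg_intZ// !seg_int_cst// subr0 => H.
rewrite -(ler_pM2r l0) (le_trans H)//.
set S := seg_int 0 l _.
have -> : (2 / l * S + 2 * l * N) * l = 2 * S + 2 * (l * N) * l.
  by field; rewrite gt_eqF.
by rewrite lerD2l ler_wpM2r// ler_wpM2l.
Qed.

(** If a segment of length at most 1 / (2 C) contains a zero, the maximum of the
    modulus on it is at most half of itself; zeros therefore propagate. *)
Lemma gronwall_zero (C a : R) : 0 <= C ->
  (forall x y, 0 <= x -> x <= y -> y <= l -> `|u y - u x| <= C * seg_int x y (fun t => `|u t|)) ->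
  0 <= a <= l -> u a = 0 -> forall x, 0 <= x <= l -> u x = 0.
Proof.
move=> C0 uC al ua.
pose d := (4 * C + 1)^-1.
have d0 : 0 < d by rewrite invr_gt0; lra.
have nc : {within `[0, l], continuous (fun t => `|u t|)}.
  by move=> t; apply: cvg_norm; exact: uc.
have ni := continuous_seg_integrable nc.
have Cd : C * (2 * d) <= 2^-1.
  rewrite /d mulrA ler_pdivrMr; lra.
have key x y : 0 <= x -> x <= y -> y <= l -> y - x <= 2 * d ->
    (u x = 0 \/ u y = 0) -> u x = 0 /\ u y = 0.
  move=> x0 xy yl yxd uxy.
  have ncxy : {within `[x, y], continuous (fun t => `|u t|)}.
    apply: continuous_subspaceW nc; apply: subset_itv; rewrite bnd_simp//.
  have [w] := EVT_max xy ncxy; rewrite in_itv/= => /andP[xw wy] wmax.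
  set M := `|u w| in wmax.
  have M0 : 0 <= M by exact: normr_ge0.
  have intM s t : x <= s -> s <= t -> t <= y -> seg_int s t (fun t => `|u t|) <= M * (2 * d).
    move=> xs st ty.
    have ni' : seg_integrable s t (fun t => `|u t|) by apply: seg_integrableS ni; lra.
    apply: (@le_trans _ _ (seg_int s t (cst M))).
      apply: le_seg_int => //; first exact: seg_integrable_cst.
      by move=> r rst; apply: wmax; rewrite in_itv/=; lra.
    by rewrite seg_int_cst// ler_wpM2l//; lra.
  have step s t : x <= s -> s <= t -> t <= y -> `|u t - u s| <= M / 2.
    move=> xs st ty; apply: (le_trans (uC s t _ _ _)); [lra|lra|lra|].
    apply: (@le_trans _ _ (C * (M * (2 * d)))); first by rewrite ler_wpM2l// intM.
    by rewrite mulrCA ler_wpM2l.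
  have {}M0 : M <= M / 2.
    case: uxy => u0.
      by have := step x w; rewrite u0 subr0; apply.
    by have := step w y; rewrite u0 sub0r normrN; apply.
  have z t : x <= t <= y -> u t = 0.
    by move=> txy; apply/eqP; rewrite -normr_le0 (le_trans (wmax _ _))//; lra.
  by split; apply: z; rewrite lexx xy.
pose Q (x y : R) := u x = 0 <-> u y = 0.
have Qxy x y : 0 <= x -> x <= y -> y <= l -> Q x y.
  move=> x0 xy yl; apply: segment_induction => //.
    by move=> s t r _ _ _ _; rewrite /Q => -> .
  move=> s /andP[xs sy]; exists d => // t r xt ts sr ry td rd; rewrite /Q.
  have K : u t = 0 \/ u r = 0 -> u t = 0 /\ u r = 0 by apply: key; lra.
  by split=> h; [have [] := K (or_introl h)|have [] := K (or_intror h)].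
move=> x /andP[x0 xl]; move: al => /andP[a0 al].
have [ax|/ltW xa] := leP a x.
  by have [H _] := Qxy a x a0 ax xl; exact: H.
by have [_ H] := Qxy x a x0 xa al; exact: H.
Qed.

Variables (T : R) (Phi phi : R -> R).
Hypotheses (uT : forall x, 0 <= x <= l -> `|u x| <= T) (phic : continuous phi)
  (Phi_le : forall p q K : R, - T <= p -> p <= q -> q <= T ->
     (forall r : R, p <= r <= q -> `|phi r| <= K) -> `|Phi q - Phi p| <= K * (q - p)).

Lemma within_continuous_comp : {within `[0, l], continuous (fun x => phi (u x))}.
Proof.
by move=> x; apply: (@continuous_comp _ _ _ (u : subspace _ -> R) phi); [exact: uc|exact: phic].
Qed.

Lemma composite_product_integrable :
  seg_integrable 0 l (fun t => `|phi (u t)| * `|g t|).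
Proof.
have pc : {within `[0, l], continuous (fun x => phi (u x) ^+ 2)}.
  by move=> x; apply: cvgM; exact: within_continuous_comp.
apply: (@seg_integrable_dom _ _ _ _ (fun t => phi (u t) ^+ 2 + g t ^+ 2)).
- apply: measurable_funM; apply: measurableT_comp => //.
    by apply: seg_integrable_measurable; apply: continuous_seg_integrable; exact: within_continuous_comp.
  exact: seg_integrable_measurable.
- move=> x _; rewrite normrM !normr_id -(real_normK (num_real (phi (u x)))).
  rewrite -(real_normK (num_real (g x))).
  have := sqr_ge0 (`|phi (u x)| - `|g x|); have := normr_ge0 (phi (u x)).
  have := normr_ge0 (g x); nra.
- by apply: seg_integrableD => //; exact: continuous_seg_integrable.
Qed.

(** As u is only absolutely continuous, the bound is first proved on small
    segments, where it follows from a Lipschitz bound for Phi near a value of u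
    at the cost of a term e |g|; these bounds add up. *)
Lemma chain_rule_le x y : 0 <= x -> x <= y -> y <= l ->
  `|Phi (u y) - Phi (u x)| <= seg_int x y (fun t => `|phi (u t)| * `|g t|).
Proof.
move=> x0 xy yl; apply/ler_addgt0Pr => e' e'0.
have ai := seg_integrable_norm gi.
have pgi := composite_product_integrable.
set B := seg_int x y (fun t => `|g t|).
have B0 : 0 <= B by exact: seg_int_ge0.
pose e := e' / (B + 1).
have e0 : 0 < e by rewrite divr_gt0// ltr_wpDl.
have hi : seg_integrable 0 l (fun t => `|phi (u t)| * `|g t| + e * `|g t|).
  by apply: seg_integrableD => //; exact: seg_integrableZ.
pose Q (s t : R) : Prop := `|Phi (u t) - Phi (u s)| <=
  seg_int s t (fun t => `|phi (u t)| * `|g t| + e * `|g t|).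
have : Q x y.
  apply: (@segment_induction _ Q x y) => //.
    move=> s t r xs st tr ry; rewrite /Q => H1 H2.
    rewrite (@seg_int_split _ _ _ t)//; last by apply: seg_integrableS hi; lra.
    by rewrite [leRHS]addrC; apply: (le_trans (ler_distD (Phi (u t)) _ _)); exact: lerD.
  move=> s /andP[xs sy].
  have sl : 0 <= s <= l by lra.
  have /cvgrPdist_le/(_ (e / 2)) := @phic (u s); rewrite divr_gt0// => /(_ isT).
  move=> /nbhs_ballP[d' /= d'0 Hphi].
  have d'20 : 0 < d' / 2 by rewrite divr_gt0.
  have [d d0 Hu] := within_continuous_eps uc sl d'20.
  exists d => // t r xt ts sr ry td rd; rewrite /Q.
  have near z : t <= z <= r -> `|u s - u z| <= d' / 2.
    by move=> tzr; apply: Hu; [lra|rewrite ltr_norml; lra].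
  have near_phi v : `|u s - v| <= d' / 2 -> `|phi (u s) - phi v| <= e / 2.
    by move=> h; apply: Hphi; rewrite /ball/= (le_lt_trans h)//; lra.
  pose K := `|phi (u s)| + e / 2.
  have phiK v : `|u s - v| <= d' / 2 -> `|phi v| <= K.
    move=> /near_phi h; rewrite /K -lerBlDl (le_trans (lerB_dist _ _))//.
    by rewrite distrC.
  have Kphi z : t <= z <= r -> K <= `|phi (u z)| + e.
    move=> /near/near_phi h; rewrite /K.
    by have := le_trans (lerB_dist _ _) h; lra.
  have [nt nr] : `|u s - u t| <= d' / 2 /\ `|u s - u r| <= d' / 2.
    by split; apply: near; lra.
  have Tt := uT (_ : 0 <= t <= l); have Tr := uT (_ : 0 <= r <= l).
  have {}Tt : `|u t| <= T by apply: Tt; lra.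
  have {}Tr : `|u r| <= T by apply: Tr; lra.
  have step : `|Phi (u r) - Phi (u t)| <= K * `|u r - u t|.
    rewrite !ler_norml in nt nr Tt Tr.
    have [tr|/ltW rt] := leP (u t) (u r).
      rewrite [X in _ * X]ger0_norm ?subr_ge0//; apply: Phi_le; [lra|done|lra|].
      by move=> v v_; apply: phiK; rewrite ler_norml; lra.
    rewrite distrC [X in _ * X]distrC [X in _ * X]ger0_norm ?subr_ge0//.
    apply: Phi_le; [lra|done|lra|].
    by move=> v v_; apply: phiK; rewrite ler_norml; lra.
  apply: (le_trans step).
  have K0 : 0 <= K by rewrite addr_ge0// ltW// divr_gt0.
  apply: (@le_trans _ _ (K * seg_int t r (fun t => `|g t|))).
    by rewrite ler_wpM2l// increment_le//; lra.
  have ai' : seg_integrable t r (fun t => `|g t|) by apply: seg_integrableS ai; lra.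
  rewrite -seg_intZ//; apply: le_seg_int; first exact: seg_integrableZ.
    by apply: seg_integrableS hi; lra.
  by move=> z tzr; rewrite -mulrDl ler_wpM2r// Kphi.
rewrite /Q seg_intD; first last.
- by apply: seg_integrableZ; apply: seg_integrableS ai.
- exact: seg_integrableS pgi.
rewrite seg_intZ; last exact: seg_integrableS ai.
move/le_trans; apply; rewrite lerD2l -/B /e mulrAC ler_pdivrMr ?ltr_wpDl//.
by rewrite ler_wpM2l ?ltW// ltrDl.
Qed.

End SobolevFunctions.

(** * Cuts of graphs *)

Section Cuts.
Variables (R : realType) (G : metric_graph R).
Implicit Types (A B : set (edge G)) (S : set (vertex G)) (v w : vertex G).

Definition reach A : relation (vertex G) :=
  clos_refl_sym_trans (vertex G)
    (fun v w => exists e, [/\ A e, esrc e = v & etgt e = w]).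

Lemma reach_edge A e : A e -> reach A (esrc e) (etgt e).
Proof. by move=> Ae; apply: rst_step; exists e. Qed.

Lemma reachS A B v w : A `<=` B -> reach A v w -> reach B v w.
Proof.
move=> AB; elim=> [x y [e [Ae ? ?]]|x|x y _|x y z _ + _].
- by apply: rst_step; exists e; split=> //; exact: AB.
- exact: rst_refl.
- exact: rst_sym.
- exact: rst_trans.
Qed.

Definition cuts S (e : edge G) :=
  (S (esrc e) /\ ~ S (etgt e)) \/ (~ S (esrc e) /\ S (etgt e)).

Lemma not_cuts S e : ~ cuts S e -> (S (esrc e) <-> S (etgt e)).
Proof.
by rewrite /cuts => nc; have [s|s] := pselect (S (esrc e));
  have [t|t] := pselect (S (etgt e)); split=> //; case: nc; [left|right].
Qed.

Lemma reach_closed S A v w : (forall e, A e -> ~ cuts S e) ->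
  reach A v w -> S v <-> S w.
Proof.
move=> nc; elim=> [x y [e [Ae <- <-]]|x|x y _ H|x y z _ H1 _ H2] //.
- by apply: not_cuts; exact: nc.
- by split=> /H.
- by rewrite H1.
Qed.

Lemma reach_cut S A v w : S v -> ~ S w -> reach A v w -> exists2 e, A e & cuts S e.
Proof.
move=> Sv Sw vw; apply: contrapT => H; apply: Sw.
have nc e : A e -> ~ cuts S e by move=> Ae ce; apply: H; exists e.
exact/(reach_closed nc vw).
Qed.

Definition end_of (x : edge G * bool) : vertex G :=
  if x.2 then etgt x.1 else esrc x.1.

(** A path that arrives at [v] can be stopped at its first arrival, so that it
    uses a single edge at [v], which moreover is not a loop. *)
Lemma reach_first_arrival A x v : reach A x v -> x <> v ->
  exists p, [/\ end_of p = v, end_of (p.1, ~~ p.2) <> v &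
    reach (fun f => A f /\ ((esrc f <> v /\ etgt f <> v) \/ f = p.1)) x v].
Proof.
move=> /clos_rst_rst1n_iff; elim=> [//|{}x y z].
case: (pselect (x = z)) => // xz.
move=> + _ IH _.
case: (pselect (y = z)) => [yz [[e [Ae ex ey]]|[e [Ae ey ex]]]|yz E].
- exists (e, true); split=> //=; first by rewrite /end_of/= ey.
  + by rewrite /end_of/= ex.
  + by rewrite -ex -yz -ey; apply: reach_edge; split=> //; right.
- exists (e, false); split=> //=; first by rewrite /end_of/= ey.
  + by rewrite /end_of/= ex.
  + by rewrite -ex -yz -ey; apply: rst_sym; apply: reach_edge; split=> //; right.
have [p [pz pz' yz']] := IH yz; exists p; split=> //.
apply: rst_trans yz'.
case: E => -[e [Ae]].
- move=> ex ey; rewrite -ex -ey; apply: reach_edge; split=> //.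
  by left; rewrite ex ey.
- move=> ey ex; rewrite -ex -ey; apply: rst_sym; apply: reach_edge; split=> //.
  by left; rewrite ex ey.
Qed.

(** A finite set left by at most one edge [f] would make the component of its
    vertices in the graph without [f] compact. *)
Lemma Hper_cut S a f : Hper G ->
  (forall S, finite_set S -> finite_set [set e : edge G | S (esrc e)]) ->
  finite_set S -> S a -> exists2 e, e <> f & cuts S e.
Proof.
move=> hper locfin finS Sa; apply: contrapT => H; apply: (hper f a).
have sub w : @connected_to R (remove_edge f) a w -> S w.
  move=> aw; suff : reach (fun e => e <> f) a w.
    by move/(@reach_closed S) => /(_ _)/wrap[e ef ce|<-//]; apply: H; exists e.
  elim: aw => [x y [e [ex ey]]|x|x y _|x y z _ + _].
  - by apply: rst_step; exists (val e); split=> //; apply/eqP; exact: (valP e).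
  - exact: rst_refl.
  - exact: rst_sym.
  - exact: rst_trans.
split; first by apply: sub_finite_set finS => w; exact: sub.
apply: (@sub_finite_set _ _ (val @^-1` [set e : edge G | S (esrc e)])).
  by move=> e /= /sub.
by apply: finite_preimage; [move=> x y _ _; exact: val_inj|exact: locfin].
Qed.

End Cuts.

(** * Cuts of periodic graphs *)

Section PeriodicCuts.
Variables (R : realType) (K : periodicity_cell R).
Local Notation G := (periodic_graph K).
Implicit Types (S : set (vertex G)) (i j k c : int) (x y : vertex (cell K)) (e f : edge G).

Definition cell_vertex i x : vertex G := (\pi_{eq_quot (@paste_rel R K)} (i, x))%qT.

Lemma cell_vertex_eq i j x y : cell_vertex i x = cell_vertex j y <->
  paste_rel (i, x) (j, y).
Proof.
by split=> [/eqquotP//|H]; apply/eqquotP.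
Qed.

Lemma cell_vertexP (v : vertex G) : exists i x, v = cell_vertex i x.
Proof.
by case E : (repr v) => [i x]; exists i, x; rewrite /cell_vertex -E reprK.
Qed.

Lemma cell_vertex_index i j x y : cell_vertex i x = cell_vertex j y ->
  i <= j + 1 /\ j <= i + 1.
Proof.
move=> /cell_vertex_eq /or3P[/eqP[-> _]|/pastedP[_ [-> _]]|/pastedP[_ [-> _]]] /=; lia.
Qed.

Lemma cell_vertex_shift i j x y k : cell_vertex i x = cell_vertex j y ->
  cell_vertex (i + k) x = cell_vertex (j + k) y.
Proof.
move=> /cell_vertex_eq H; apply/cell_vertex_eq; move: H.
move=> /or3P[/eqP[-> ->]|/pastedP[/= xD [-> ->]]|/pastedP[/= xD [-> ->]]].
- exact: paste_rel_refl.
- by apply/or3P/Or32; apply/pastedP; split=> //=; congr (_, _); ring.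
- by apply/or3P/Or33; apply/pastedP; split=> //=; congr (_, _); ring.
Qed.

Lemma cell_vertex_glue i x : dset K x ->
  cell_vertex i x = cell_vertex (i + 1) (pasting K x).
Proof. by move=> xD; apply/cell_vertex_eq/or3P/Or32; apply/pastedP. Qed.

Lemma esrc_cell e : esrc e = cell_vertex e.1 (esrc e.2).
Proof. by []. Qed.

Lemma etgt_cell e : etgt e = cell_vertex e.1 (etgt e.2).
Proof. by []. Qed.

Lemma finite_index_bound S : finite_set S ->
  exists N : int, forall i x, S (cell_vertex i x) -> - N <= i <= N.
Proof.
move=> /finite_seqP[s ->].
suff [N [_ H]] : exists N : int, 0 <= N /\
    forall i x, cell_vertex i x \in s -> - N <= i <= N by exists N.
elim: s => [|v s [N [N0 IH]]]; first by exists 0.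
have [j [y ->]] := cell_vertexP v.
exists (N + (if 0 <= j then j else - j) + 1); split; first by case: ifP; lia.
move=> i x; rewrite inE => /orP[/eqP/cell_vertex_index|/IH]; case: ifP; lia.
Qed.

Lemma finite_index_edges (N : int) : finite_set [set e : edge G | - N <= e.1 <= N].
Proof.
have finE : finite_set [set: edge (cell K)] by case: (cell_compact K).
have finI : finite_set [set i : int | - N <= i <= N].
  pose F (n : nat) : int := n%:Z - N.
  pose M : nat := (absz (N + N)).+1.
  have sub : [set i : int | - N <= i <= N] `<=` [set F n | n in `I_M].
    by move=> i /= iN; exists (absz (i + N)); rewrite /= /F /M; lia.
  by apply: (sub_finite_set sub); exact/finite_image/finite_II.
by apply: sub_finite_set (finite_setX finI finE) => -[i e].
Qed.

Lemma periodic_locally_finite S : finite_set S ->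
  finite_set [set e | S (esrc e)].
Proof.
move=> /finite_index_bound[N H]; apply: sub_finite_set (finite_index_edges N) => e He.
exact: (H _ _ He).
Qed.

Lemma reach_cell i x y : reach (fun e => e.1 = i) (cell_vertex i x) (cell_vertex i y).
Proof.
have := @cell_connected R K x y; elim=> [{}x {}y [e [<- <-]]|{}x|{}x {}y _|{}x {}y z _ + _].
- exact: (@reach_edge _ G _ (i, e)).
- exact: rst_refl.
- exact: rst_sym.
- exact: rst_trans.
Qed.

Lemma reach_cells i j x y : i <= j ->
  reach (fun e => i <= e.1 <= j) (cell_vertex i x) (cell_vertex j y).
Proof.
move=> ij; have -> : j = i + `|j - i|%N%:Z by lia.
elim: `|j - i|%N y => [|n IH] y.
  by rewrite addr0; apply: reachS (reach_cell i x y) => e /= ->; rewrite lexx.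
have [d dD] := dset_neq0 K.
apply: rst_trans.
  by apply: reachS (IH d) => e /=; lia.
rewrite cell_vertex_glue// (_ : i + n%:Z + 1 = i + n.+1%:Z); last lia.
by apply: reachS (reach_cell _ _ _) => e /= ->; lia.
Qed.

(** The graph is unbounded to the right and to the left, hence a finite set
    cannot contain the vertices reached there. *)
Lemma cut_right S i x : finite_set S -> S (cell_vertex i x) ->
  exists2 e, i <= e.1 & cuts S e.
Proof.
move=> /finite_index_bound[N H] Sx.
have [||e e1 ce] := @reach_cut _ G S (fun e => i <= e.1) (cell_vertex i x) (cell_vertex (`|N| + `|i| + 1) x) Sx.
- by move=> /H; lia.
- by apply: reachS (@reach_cells i (`|N| + `|i| + 1) x x _) => [e /= /andP[]//|]; lia.
- by exists e.
Qed.

Lemma cut_left S i x : finite_set S -> S (cell_vertex i x) ->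
  exists2 e, e.1 <= i & cuts S e.
Proof.
move=> /finite_index_bound[N H] Sx.
have [||e e1 ce] := @reach_cut _ G S (fun e => e.1 <= i) (cell_vertex i x) (cell_vertex (- (`|N| + `|i| + 1)) x) Sx.
- by move=> /H; lia.
- apply: rst_sym.
  by apply: reachS (@reach_cells (- (`|N| + `|i| + 1)) i x x _) => [e /= /andP[]//|]; lia.
- by exists e.
Qed.

Lemma degree3_ends (v : vertex G) : (3 <= degree v)%N ->
  exists s : seq (edge G * bool),
    [/\ uniq s, (3 <= size s)%N & forall p, p \in s -> end_of p = v].
Proof.
rewrite /degree => d3; exists (fset_set (edge_ends v)); split=> //.
  exact: fset_uniq.
have [fin|inf] := pselect (finite_set (edge_ends v)).
  by move=> p; rewrite in_fset_set// inE.
by move: d3; rewrite /fset_set; case: pselect.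
Qed.

(** At a translate of a vertex of degree at least three that lies far to the
    right, some edge is neither the one through which a path arriving from the
    left first reaches that vertex nor the one through which a path arriving
    from the right does. Both ends of the graph remain connected without it. *)
Lemma bypassed_edge (i J : int) x : (exists v : vertex G, (3 <= degree v)%N) ->
  exists e1 : edge G, [/\ J <= e1.1, i < e1.1 &
    forall j y, e1.1 + 2 < j ->
      reach (fun e => i <= e.1 /\ e <> e1) (cell_vertex i x) (cell_vertex j y)].
Proof.
move=> [v0 /degree3_ends[s [us s3 send]]].
have [k0 [z v0E]] := cell_vertexP v0.
pose k : int := `|i| + `|J| + 3; pose v := cell_vertex k z.
have [||p [pv pv' pr]] := @reach_first_arrival _ G (fun e => i <= e.1) (cell_vertex i x) v.
- by apply: reachS (@reach_cells i k x z _) => [e /= /andP[]//|]; lia.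
- by move=> /cell_vertex_index; lia.
have [||q [qv qv' qr]] := @reach_first_arrival _ G (fun e => k <= e.1) (cell_vertex (k + 2) x) v.
- by apply: rst_sym; apply: reachS (@reach_cells k (k + 2) z x _) => [e /= /andP[]//|]; lia.
- by move=> /cell_vertex_index; lia.
pose tr (r : edge G * bool) : edge G * bool := ((r.1.1 + (k - k0), r.1.2), r.2).
have trv r : r \in s -> end_of (tr r) = v.
  move=> /send; rewrite v0E => H.
  have vE : v = cell_vertex (k0 + (k - k0)) z by rewrite /v; congr cell_vertex; ring.
  by rewrite vE; case: r H => [[j e] []]; exact: cell_vertex_shift.
have tr_inj : injective tr.
  by move=> [[j e] b] [[j' e'] b'] [/addIr -> -> ->].
have [r rs rpq] : exists2 r : edge G * bool, r \in [seq tr r | r <- s] & r \notin [:: p; q].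
  apply/hasP; rewrite -[has _ _]negbK -all_predC; apply/negP => /allP sub.
  have : (size [seq tr r | r <- s] <= size [:: p; q])%N.
    apply: uniq_leq_size; first by rewrite map_inj_uniq.
    by move=> r /sub /=; rewrite negbK.
  by rewrite size_map => /(leq_trans s3).
have {rs}rv : end_of r = v by move: rs => /mapP[r' /trv + ->].
move: rpq; rewrite !inE negb_or => /andP[/eqP rp /eqP rq].
have other (o : edge G * bool) : end_of o = v -> end_of (o.1, ~~ o.2) <> v -> r <> o -> r.1 <> o.1.
  case: r rv {rp rq} => [e b] rv ov ov' ro; case: o ov ov' ro => [f c] /= ov ov' ro ef.
  subst f; move: rv ov ov' ro; case: b; case: c => //.
have {}rp := other p pv pv' rp; have {}rq := other q qv qv' rq.
have r_inc : esrc r.1 = v \/ etgt r.1 = v.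
  by move: rv; rewrite /end_of; case: ifP => _ ->; [right|left].
have r_index : k - 1 <= r.1.1 <= k + 1.
  by case: r_inc; rewrite ?esrc_cell ?etgt_cell => /cell_vertex_index; lia.
exists r.1; split; [lia|lia|move=> j y rj].
apply: rst_trans.
  apply: reachS pr => e /= [ei ev]; split=> // er; subst e.
  by case: ev => // -[]; case: r_inc.
apply: rst_trans.
  apply: rst_sym; apply: reachS qr => e /= [ek ev]; split; first lia.
  by move=> er; subst e; case: ev => // -[]; case: r_inc.
apply: reachS (@reach_cells (k + 2) j x y _) => [e /= /andP[ke _]|]; last lia.
split; first lia.
by move=> er; move: ke r_index; rewrite er => h1 /andP[_ /(le_trans h1)]; lia.
Qed.

(** Suppose that [f] and [e1] are the only edges leaving S, and let S' be what
    can be reached from the given vertex without them, a finite set. By [Hper]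
    some edge other than [f] leaves S', and it can only be [e1]; so S' stretches
    from the cell [i0] to the far right and contains a whole intermediate cell
    [c]. Going from that cell to the left one leaves S', necessarily through [f],
    which therefore lies to the left of [c]. But one can also go to infinity on
    the right bypassing [e1], so that [f] lies to the right of [c]. *)
Lemma Hper_far_edge_cut (i0 J : int) : Hper G ->
  (exists v : vertex G, (3 <= degree v)%N) ->
  exists2 e1 : edge G, J <= e1.1 &
    forall S x f, finite_set S -> S (cell_vertex i0 x) ->
      exists e, [/\ e <> f, e <> e1 & cuts S e].
Proof.
move=> hper deg3; have [d0 d0D] := dset_neq0 K.
have [e1 [e1J e1i bypass]] := bypassed_edge (i0 + 3) J d0 deg3.
exists e1 => // S x f finS Sx; apply: contrapT => nocut.
pose B := [set e : edge G | e <> f /\ e <> e1].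
pose S' := [set w | reach B (cell_vertex i0 x) w].
have S'S : S' `<=` S.
  move=> w /(@reach_closed _ _ S)H; apply/H => // e [ef ee1] ce.
  by apply: nocut; exists e.
have finS' := sub_finite_set S'S finS.
have S'x : S' (cell_vertex i0 x) by exact: rst_refl.
have S'B e : cuts S' e -> e = f \/ e = e1.
  move=> ce; apply: contrapT => /not_orP[ef ee1].
  have Be : B e by [].
  case: ce => -[h1 h2].
    by apply: h2; apply: rst_trans h1 _; exact: reach_edge.
  by apply: h1; apply: rst_trans h2 _; apply: rst_sym; exact: reach_edge.
have S'r A v w : (forall e, A e -> B e) -> reach A v w -> S' v -> S' w.
  by move=> AB vw S'v; apply: rst_trans S'v _; exact: reachS vw.
have [e2 e2f ce2] := Hper_cut f hper (@periodic_locally_finite) finS' S'x.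
have e21 : e2 = e1 by case: (S'B _ ce2).
have [c [ci0 cf ce1]] : exists c, [/\ i0 < c, c <> f.1 & c < i0 + 3].
  case: (pselect (i0 + 1 = f.1)) => [E|E]; first by exists (i0 + 2); split; lia.
  by exists (i0 + 1); split=> //; lia.
have cB e : e.1 = c -> B e.
  by move=> ec; split=> E; subst e; lia.
have [z S'z] : exists z, S' (cell_vertex c z).
  pose U := [set w : vertex G | exists2 i, i < c & exists y, w = cell_vertex i y].
  have [t S't tU] : exists2 t, S' t & ~ U t.
    subst e2; case: ce2 => -[S1 S2]; [exists (esrc e1)|exists (etgt e1)] => //;
      by rewrite ?esrc_cell ?etgt_cell => -[i ic [y /cell_vertex_index]]; lia.
  have xU : (S' `&` U) (cell_vertex i0 x) by split=> //; exists i0 => //; exists x.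
  have [|e Be ce] := reach_cut xU _ S't; first by case.
  have se : S' (esrc e) <-> S' (etgt e).
    by apply: not_cuts => /S'B; case: Be => ? ? [].
  have [[se1 ue1]|[se1 ue1]] : (S' (esrc e) /\ (U (esrc e) /\ ~ U (etgt e))) \/
                 (S' (etgt e) /\ (U (etgt e) /\ ~ U (esrc e))).
    by move: ce; rewrite /cuts /setI /=; tauto.
  - exists (esrc e.2); suff <- : e.1 = c by [].
    case: ue1 => -[i ic [y]]; rewrite esrc_cell => /cell_vertex_index ie nU.
    suff : ~ e.1 < c by lia.
    by move=> ec; apply: nU; exists e.1 => //; exists (etgt e.2).
  - exists (etgt e.2); suff <- : e.1 = c by [].
    case: ue1 => -[i ic [y]]; rewrite etgt_cell => /cell_vertex_index ie nU.
    suff : ~ e.1 < c by lia.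
    by move=> ec; apply: nU; exists e.1 => //; exists (esrc e.2).
have S'c y : S' (cell_vertex c y) by apply: S'r S'z; [exact: cB|exact: reach_cell].
have f_left : f.1 <= c - 1.
  have [r rR] := rset_neq0 K.
  have [_ _ surj] := pasting_bij K; have [d dD dr] := surj _ rR.
  have S'd : S' (cell_vertex (c - 1) d).
    by rewrite cell_vertex_glue// subrK; exact: S'c.
  have [e ec /S'B[<-//|ee1]] := cut_left finS' S'd.
  by move: ec; rewrite ee1 => /(lt_le_trans e1i); lia.
have [N SN] := finite_index_bound finS'.
have S'd : S' (cell_vertex (c + 1) (pasting K d0)).
  by rewrite -cell_vertex_glue//; exact: S'c.
have [||e [ce ee1] /S'B[ef|//]] := @reach_cut _ G S' (fun e => c + 1 <= e.1 /\ e <> e1)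
    (cell_vertex (c + 1) (pasting K d0)) (cell_vertex (`|N| + `|e1.1| + 3) d0) S'd.
- by move=> /SN; lia.
- apply: rst_trans.
    apply: reachS (@reach_cells (c + 1) (i0 + 3) (pasting K d0) d0 _); last lia.
    move=> e /= ec; split; first lia.
    by move=> ee; move: ec; rewrite ee => /andP[_ /(lt_le_trans e1i)]; lia.
  apply: reachS (bypass (`|N| + `|e1.1| + 3) d0 _); last lia.
  by move=> e /= [ec ee]; split=> //; lia.
by subst e; lia.
Qed.

End PeriodicCuts.

(** * The layer-cake bound *)

Section LayerCake.
Variable R : realType.
Local Notation mu := (@lebesgue_measure R).

(** Integrating the hypothesis over the levels above [eps] gives at least the sum
    on the left and at most the total variation on the right. *)
Lemma layer_cake (I : Type) (E : seq I) (p q : I -> R) (cs : seq R) (eps : R) :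
  (forall t, eps < t ->
     \sum_(c <- cs) (t < c)%R%:R <=
     \sum_(e <- E) (Num.min (p e) (q e) <= t < Num.max (p e) (q e))%R%:R :> R) ->
  \sum_(c <- cs) (c - eps) <= \sum_(e <- E) `|p e - q e|.
Proof.
move=> H; rewrite -lee_fin -!sumEFin.
pose D := `]eps, +oo[%classic : set R.
pose A e := `[Num.min (p e) (q e), Num.max (p e) (q e)[%classic : set R.
pose B c := `]-oo, c[%classic : set R.
apply: (@le_trans _ _ (\sum_(c <- cs) mu (B c `&` D))%E).
  apply: lee_sum => c _.
  rewrite (_ : B c `&` D = `]eps, c[%classic); last first.
    by apply/seteqP; split => t /=; rewrite /B /D /= !in_itv/= ?andbT; [move=> [-> ->]|move=> /andP[-> ->]].
  rewrite lebesgue_measure_itv/= lte_fin; case: ltP => [//|ce].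
  by rewrite lee_fin subr_le0.
apply: (@le_trans _ _ (\sum_(e <- E) mu (A e `&` D))%E); last first.
  apply: lee_sum => e _; apply: (@le_trans _ _ (mu (A e))).
    by apply: le_measure; rewrite ?inE /=; [apply: measurableI; exact: measurable_itv|exact: measurable_itv|exact: subIsetl].
  rewrite lebesgue_measure_itv/= lte_fin; case: ltP => [_|_]; last by rewrite lee_fin.
  rewrite -EFinB lee_fin; case: (leP (p e) (q e)) => pq.
    by rewrite distrC ler_norm.
  by rewrite ler_norm.
have mI (X : set R) : measurable X -> mu (X `&` D) = (\int[mu]_(x in D) (\1_X x)%:E)%E.
  by move=> mX; rewrite integral_indic//; exact: measurable_itv.
have mfI (X : set R) : measurable X -> measurable_fun D (fun x => (\1_X x)%:E : \bar R).
  by move=> mX; apply/measurable_EFinP; apply: measurable_funTS; exact: measurable_indic.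
have mA e : measurable (A e) by exact: measurable_itv.
have mB c : measurable (B c) by exact: measurable_itv.
rewrite (eq_bigr (fun c => \int[mu]_(x in D) (\1_(B c) x)%:E)%E (fun c _ => mI _ (mB c))).
rewrite [leRHS](eq_bigr (fun e => \int[mu]_(x in D) (\1_(A e) x)%:E)%E (fun e _ => mI _ (mA e))).
rewrite -!ge0_integral_sum//; last 4 first.
- exact: measurable_itv.
- by move=> c; exact: mfI.
- exact: measurable_itv.
- by move=> c; exact: mfI.
apply: ge0_le_integral => //.
- exact: measurable_itv.
- by move=> t _; apply: sume_ge0 => c _; rewrite lee_fin.
- by apply: emeasurable_sum => c; exact: mfI.
- by apply: emeasurable_sum => c; exact: mfI.
move=> t; rewrite /D /= in_itv/= andbT => /H; rewrite -lee_fin -!sumEFin => h.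
have iB c : \1_(B c) t = (t < c)%R%:R :> R by rewrite indicE /B mem_setE in_itv/=.
have iA e : \1_(A e) t = (Num.min (p e) (q e) <= t < Num.max (p e) (q e))%R%:R :> R.
  by rewrite indicE /A mem_setE in_itv/=.
by rewrite (eq_bigr _ (fun c _ => congr1 EFin (iB c))) (eq_bigr _ (fun e _ => congr1 EFin (iA e))).
Qed.

Variable G : metric_graph R.

Lemma cut_level (w : vertex G -> R) t e : cuts [set v | t < w v] e ->
  Num.min (w (esrc e)) (w (etgt e)) <= t < Num.max (w (esrc e)) (w (etgt e)).
Proof.
by rewrite /cuts/= => -[[h1 /negP]|[/negP + h2]]; rewrite -leNgt => h;
  rewrite ge_min lt_max ?h1 ?h2 h ?orbT.
Qed.

Hypothesis locally_finite : forall S : set (vertex G), finite_set S ->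
  finite_set [set e : edge G | S (esrc e) \/ S (etgt e)].

(** The layer-cake bound applies to the finitely many edges with an end above a
    small level, which then tends to 0. *)
Lemma cut_esum_ge (w : vertex G -> R) (A : set (edge G)) (cs : seq R) :
  (forall t, 0 < t -> finite_set [set v | t < w v]) ->
  (forall t, 0 < t -> exists s : seq (edge G),
     [/\ uniq s, (count (fun c => t < c)%R cs <= size s)%N &
      forall e, e \in s -> A e /\ cuts [set v | t < w v] e]) ->
  ((\sum_(c <- cs) c)%:E <= \esum_(e in A) (`|w (esrc e) - w (etgt e)|)%:E)%E.
Proof.
move=> fin cut; apply/lee_addgt0Pr => d d0.
pose n : R := (size cs)%:R + 1.
have n0 : 0 < n by rewrite ltr_wpDl.
pose eps := d / n; have eps0 : 0 < eps by rewrite divr_gt0.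
pose S := [set v | eps < w v].
pose F := [set e : edge G | A e /\ (S (esrc e) \/ S (etgt e))].
have finF : finite_set F.
  by apply: sub_finite_set (locally_finite (fin _ eps0)) => e [].
apply: (@le_trans _ _ ((\sum_(e \in F) `|w (esrc e) - w (etgt e)|)%:E + d%:E)%E); last first.
  rewrite leeD2r//; apply: esum_ge; exists F; first by split=> // e [].
  by rewrite -fsumEFin.
rewrite -EFinD lee_fin fsbig_finite//=.
have : \sum_(c <- cs) (c - eps) <= \sum_(e <- fset_set F) `|w (esrc e) - w (etgt e)|.
  apply: layer_cake => t et.
  have [s [us cs_s sP]] := cut t (lt_trans eps0 et).
  have countE (J : Type) (r : seq J) (P : pred J) :
      \sum_(x <- r) (P x)%:R = (count P r)%:R :> R.
    by elim: r => [|x r IH]; rewrite ?big_nil// big_cons /= IH natrD.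
  rewrite !countE ler_nat (leq_trans cs_s)// -size_filter.
  apply: uniq_leq_size => // e /sP[Ae ce]; rewrite mem_filter cut_level//=.
  rewrite in_fset_set// inE; split=> //.
  by case: ce => -[/= h1 h2]; [left|right]; rewrite /S /=; exact: lt_trans et _.
rewrite sumrB => h.
have := lerD h (_ : \sum_(c <- cs) eps <= d).
rewrite subrK; apply.
rewrite big_const_seq count_predT iter_addr_0 -mulr_natr /eps mulrAC ler_pdivrMr//.
by rewrite ler_wpM2l ?ltW// ltrDl.
Qed.

End LayerCake.

(** * The soliton profile *)

Section Profile.
Variable R : realType.
Implicit Types (x y p q t T : R).

Lemma lipschitz_within_continuous (f : R -> R) (a b L : R) :
  (forall x y, a <= x <= b -> a <= y <= b -> `|f x - f y| <= L * `|x - y|) ->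
  {within `[a, b], continuous f}.
Proof.
move=> H; apply/subspace_continuousP => x; rewrite /= in_itv/= => xab.
apply/cvgrPdist_le => e e0; rewrite near_withinE.
have L0 : 0 < `|L| + 1 by rewrite ltr_pwDr.
apply/nbhs_ballP; exists (e / (`|L| + 1)) => /=; first by rewrite divr_gt0.
move=> y /= xy; rewrite in_itv/= => yab; apply: (le_trans (H _ _ xab yab)).
apply: (@le_trans _ _ ((`|L| + 1) * `|x - y|)).
  by rewrite ler_wpM2r// (le_trans (ler_norm L))// lerDl.
by rewrite mulrC -ler_pdivlMr// ltW.
Qed.

(** Twice the primitive of sqrt (1 - y^2) that vanishes at 0. *)
Definition half_disc y : R := y * Num.sqrt (1 - y ^+ 2) + asin y.

Lemma half_disc0 : half_disc 0 = 0.
Proof.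
rewrite /half_disc mul0r add0r; have h := @sinK R 0; rewrite sin0 in h; apply: h.
by rewrite in_itv/= oppr_le0 divr_ge0 ?pi_ge0.
Qed.

Lemma half_disc1 : half_disc 1 = pi / 2.
Proof.
rewrite /half_disc expr1n subrr sqrtr0 mulr0 add0r.
have h := @sinK R (pi / 2); rewrite sin_pihalf in h; apply: h.
by rewrite in_itv/= lexx andbT -subr_ge0 opprK -splitr pi_ge0.
Qed.

Lemma is_derive_half_disc y : -1 < y < 1 ->
  is_derive y 1 half_disc (2 * Num.sqrt (1 - y ^+ 2)).
Proof.
move=> y1; have s0 : 0 < 1 - y ^+ 2 by nra.
have ds : is_derive y 1 (fun y : R => 1 - y ^+ 2) (- (2 * y)).
  have := is_deriveB (is_derive_cst (1 : R) y (1 : R)) (@is_deriveX _ _ id 2 y 1 1 (is_derive_id y (1 : R))).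
  by move=> H; apply: is_derive_eq; rewrite /= sub0r expr1 /GRing.scale/= mulr1.
have dq := @is_derive1_comp _ (@Num.sqrt R) (fun y : R => 1 - y ^+ 2) y _ _ (is_derive1_sqrt s0) ds.
have := is_deriveD (is_deriveM (is_derive_id y 1) dq) (is_derive1_asin y1).
move=> H; apply: is_derive_eq; rewrite /= /GRing.scale/=.
have q0 : 0 < Num.sqrt (1 - y ^+ 2) by rewrite sqrtr_gt0.
have q2 : Num.sqrt (1 - y ^+ 2) ^+ 2 = 1 - y ^+ 2 by rewrite sqr_sqrtr// ltW.
set s := Num.sqrt _ in q0 q2 *.
have -> : y * ((2 * s)^-1 * - (2 * y)) + s * 1 + s^-1 = (1 - y ^+ 2 + s ^+ 2) / s.
  by field; rewrite gt_eqF.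
by rewrite -q2; field; rewrite gt_eqF.
Qed.

(** In the angle coordinate the function is sin cos + id, whose derivative is
    2 cos^2; comparing it with sin avoids the end points, where arcsin is not
    differentiable. *)
Lemma half_disc_lipschitz x y : -1 <= x -> x <= y -> y <= 1 ->
  `|half_disc y - half_disc x| <= 2 * (y - x).
Proof.
move=> x1; rewrite le_eqVlt => /predU1P[->|xy] y1.
  by rewrite !subrr normr0 mulr0.
have xI : -1 <= x <= 1 by lra.
have yI : -1 <= y <= 1 by lra.
have [a1 b1] : - (pi / 2) <= asin x /\ asin y <= pi / 2.
  by rewrite asin_geNpi2// asin_lepi2.
have [a2 b2] : asin x <= pi / 2 /\ - (pi / 2) <= asin y.
  by rewrite asin_geNpi2// asin_lepi2.
have sx : sin (asin x) = x by rewrite asinK// in_itv.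
have sy : sin (asin y) = y by rewrite asinK// in_itv.
have axy : asin x < asin y.
  by rewrite -ltr_sin ?sx ?sy// in_itv/= ?a1 ?a2 ?b1 ?b2.
pose F (t : R) := sin t * cos t + t.
have dF (t : R) : is_derive t 1 F (2 * cos t ^+ 2).
  have := is_deriveD (is_deriveM (is_derive_sin t) (is_derive_cos t)) (is_derive_id t 1).
  move=> H; apply: is_derive_eq; rewrite /= /GRing.scale/= .
  by have := cos2Dsin2 t; lra.
have Fx (z : R) : -1 <= z <= 1 -> half_disc z = F (asin z).
  by move=> zI; rewrite /half_disc /F cos_asin// asinK// in_itv.
have cF : continuous F.
  by move=> t; apply/differentiable_continuous/derivable1_diffP; case: (dF t).
have cI (c : R) : c \in `]asin x, asin y[ -> 0 < cos c.
  rewrite in_itv/= => /andP[c1 c2]; apply: cos_gt0_pihalf.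
  by rewrite (le_lt_trans a1 c1) (lt_le_trans c2 b1).
have cn0 (c : R) : c \in `]asin x, asin y[ -> cos c != 0.
  by move=> /cI; rewrite lt0r => /andP[].
have [c cI' E] := cauchy_MVT axy (continuous_subspaceT cF)
  (continuous_subspaceT (@continuous_sin R)) (fun t _ => dF t) (fun t _ => is_derive_sin t) cn0.
have c0 := cI c cI'.
rewrite !Fx//; move: E; rewrite sx sy => E.
have -> : F (asin y) - F (asin x) = 2 * cos c * (y - x).
  have yx : y - x != 0 by rewrite subr_eq0 gt_eqF.
  have -> : 2 * cos c = 2 * cos c ^+ 2 / cos c by field; rewrite gt_eqF.
  by rewrite E divfK.
have yx0 : 0 <= y - x by lra.
rewrite ger0_norm; last by rewrite mulr_ge0// mulr_ge0// ltW.
by rewrite ler_wpM2r// ger_pMr// cos_le1.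
Qed.

Lemma half_disc_lipschitz_norm x y : -1 <= x <= 1 -> -1 <= y <= 1 ->
  `|half_disc y - half_disc x| <= 2 * `|y - x|.
Proof.
move=> /andP[x1 x2] /andP[y1 y2]; have [xy|/ltW yx] := leP x y.
  by rewrite [X in _ * X]ger0_norm ?subr_ge0//; exact: half_disc_lipschitz.
rewrite distrC [X in _ * X]distrC [X in _ * X]ger0_norm ?subr_ge0//.
exact: half_disc_lipschitz.
Qed.

(** The soliton of maximum [T] solves u'^2 = u^2 (T^4 - u^4) / 3. *)
Definition profile_speed T t : R :=
  T ^+ 2 / Num.sqrt 3 * (t * Num.sqrt (1 - (t ^+ 2 / T ^+ 2) ^+ 2)).

(** The primitive of the speed that vanishes at 0. *)
Definition profile_action T t : R :=
  T ^+ 4 / (4 * Num.sqrt 3) * half_disc (t ^+ 2 / T ^+ 2).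

Variable T : R.
Hypothesis T0 : 0 < T.

Let sqrt3 : 0 < Num.sqrt (3 : R). Proof. by rewrite sqrtr_gt0. Qed.
Let sqrt3E : Num.sqrt (3 : R) ^+ 2 = 3. Proof. by rewrite sqr_sqrtr. Qed.

Lemma profile_ratio t : `|t| <= T -> 0 <= t ^+ 2 / T ^+ 2 <= 1.
Proof.
move=> tT; rewrite divr_ge0 ?sqr_ge0//= ler_pdivrMr ?exprn_gt0// mul1r.
by rewrite -[t ^+ 2]real_normK ?num_real// ler_pXn2r ?nnegrE// ltW.
Qed.

Lemma profile_speed_sqr t : `|t| <= T ->
  profile_speed T t ^+ 2 = (T ^+ 4 * t ^+ 2 - t ^+ 6) / 3.
Proof.
move=> /profile_ratio tT; rewrite /profile_speed.
have E : Num.sqrt (1 - (t ^+ 2 / T ^+ 2) ^+ 2) ^+ 2 = 1 - (t ^+ 2 / T ^+ 2) ^+ 2.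
  by rewrite sqr_sqrtr// subr_ge0; case/andP: tT => ? ?; rewrite expr_le1.
set s := Num.sqrt (1 - _) in E *.
have -> : (T ^+ 2 / Num.sqrt 3 * (t * s)) ^+ 2 =
    T ^+ 4 / Num.sqrt 3 ^+ 2 * (t ^+ 2 * s ^+ 2) by field; rewrite gt_eqF.
by rewrite E sqrt3E; field; rewrite gt_eqF.
Qed.

Lemma profile_speed_continuous : continuous (profile_speed T).
Proof.
move=> t; apply: cvgM; first exact: cvg_cst.
apply: cvgM; first exact: cvg_id.
apply: (@continuous_comp _ _ _ (fun t => 1 - (t ^+ 2 / T ^+ 2) ^+ 2) Num.sqrt); last exact: sqrt_continuous.
apply: cvgB; first exact: cvg_cst.
apply: (@continuous_comp _ _ _ (fun t => t ^+ 2 / T ^+ 2) (fun y : R => y ^+ 2)); last exact: exprn_continuous.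
by apply: cvgM; [exact: exprn_continuous|exact: cvg_cst].
Qed.

Lemma profile_speed_le t : `|profile_speed T t| <= T ^+ 2 * `|t|.
Proof.
rewrite /profile_speed (normrM (_ / _)) (normrM (T ^+ 2)) (normrM t) normfV.
rewrite (ger0_norm (sqr_ge0 T)) (ger0_norm (ltW sqrt3)).
rewrite (ger0_norm (sqrtr_ge0 _)) -mulrA ler_wpM2l ?sqr_ge0//.
have h1 : Num.sqrt (1 - (t ^+ 2 / T ^+ 2) ^+ 2) <= 1.
  by rewrite -[leRHS]sqrtr1 ler_wsqrtr// gerBl sqr_ge0.
have h2 : (Num.sqrt 3)^-1 <= 1 :> R.
  by rewrite invf_le1// -[leLHS]sqrtr1 ler_wsqrtr// ler1n.
have h3 : 0 <= (Num.sqrt 3)^-1 :> R by rewrite invr_ge0 ltW.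
have a0 := sqrtr_ge0 (1 - (t ^+ 2 / T ^+ 2) ^+ 2).
set a := Num.sqrt (1 - _) in h1 a0 *.
by rewrite -[leRHS]mul1r ler_pM ?mulr_ge0// ler_piMr.
Qed.

Lemma profile_speed_eq0 t : `|t| < T -> profile_speed T t = 0 -> t = 0.
Proof.
move=> tT E; have := profile_speed_sqr (ltW tT); rewrite E expr0n/=.
move/esym/eqP; rewrite mulf_eq0 invr_eq0 pnatr_eq0 orbF.
rewrite (_ : _ - _ = t ^+ 2 * (T ^+ 4 - t ^+ 4)); last by ring.
rewrite mulf_eq0 sqrf_eq0 => /orP[/eqP//|]; rewrite subr_eq0 => /eqP TE.
have : `|t| ^+ 4 < T ^+ 4 by rewrite ltr_pXn2r ?nnegrE// ltW.
by rewrite -normrX ger0_norm ?TE ?ltxx// exprn_even_ge0.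
Qed.

Lemma profile_action0 : profile_action T 0 = 0.
Proof. by rewrite /profile_action expr0n/= mul0r half_disc0 mulr0. Qed.

Lemma profile_action_max : profile_action T T = T ^+ 4 / 6 * (Num.sqrt 3 / 4 * pi).
Proof.
rewrite /profile_action divff ?expf_neq0 ?gt_eqF// half_disc1.
rewrite (_ : 6 = 2 * Num.sqrt 3 ^+ 2 :> R); last by rewrite sqrt3E; ring.
by field; rewrite gt_eqF.
Qed.

Lemma profile_actionN t : profile_action T (- t) = profile_action T t.
Proof. by rewrite /profile_action sqrrN. Qed.

Lemma is_derive_profile_action t : - T < t < T ->
  is_derive t 1 (profile_action T) (profile_speed T t).
Proof.
move=> tT.
have T2 : 0 < T ^+ 2 by rewrite exprn_gt0.
have y1 : -1 < t ^+ 2 / T ^+ 2 < 1.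
  apply/andP; split; first by rewrite (@lt_le_trans _ _ 0)// divr_ge0// sqr_ge0.
  by rewrite ltr_pdivrMr// mul1r; nra.
have dy : is_derive t 1 (fun t : R => t ^+ 2 / T ^+ 2) (2 * t / T ^+ 2).
  have := is_deriveM (is_deriveX 2 (is_derive_id t 1)) (is_derive_cst (T ^+ 2)^-1 t 1).
  move=> H; apply: is_derive_eq; rewrite /= /GRing.scale/= expr1; ring.
have dc := @is_derive1_comp _ half_disc (fun t : R => t ^+ 2 / T ^+ 2) t _ _ (is_derive_half_disc y1) dy.
have := is_deriveM (is_derive_cst (T ^+ 4 / (4 * Num.sqrt 3)) t 1) dc.
move=> H; apply: is_derive_eq; rewrite /= /GRing.scale/= /profile_speed.
by field; rewrite !gt_eqF.
Qed.

Lemma profile_action_continuous : {within `[- T, T], continuous (profile_action T)}.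
Proof.
pose k := T ^+ 4 / (4 * Num.sqrt 3).
have k0 : 0 <= k by rewrite divr_ge0 ?exprn_ge0 ?mulr_ge0 ?ltW.
have T2 : 0 < T ^+ 2 by rewrite exprn_gt0.
apply: (@lipschitz_within_continuous _ _ _ (k * (2 * (2 * T / T ^+ 2)))) => x y xT yT.
rewrite /profile_action -mulrBr normrM (ger0_norm k0) -[leRHS]mulrA ler_wpM2l//.
have [xr yr] : -1 <= x ^+ 2 / T ^+ 2 <= 1 /\ -1 <= y ^+ 2 / T ^+ 2 <= 1.
  have [|x1 x2] := andP (@profile_ratio x _); first by rewrite ler_norml.
  have [|y1 y2] := andP (@profile_ratio y _); first by rewrite ler_norml.
  by split; lra.
apply: (le_trans (half_disc_lipschitz_norm yr xr)).
have v0 : 0 <= (T ^+ 2)^-1 by rewrite invr_ge0 ltW.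
rewrite -mulrBl normrM (ger0_norm v0) subr_sqr normrM.
have h : 0 <= 2 * T - `|x + y| by rewrite subr_ge0 ler_norml; lra.
have := mulr_ge0 (mulr_ge0 (normr_ge0 (x - y)) v0) h; lra.
Qed.

Lemma profile_action_le p q (K : R) : - T <= p -> p <= q -> q <= T ->
  (forall r, p <= r <= q -> `|profile_speed T r| <= K) ->
  `|profile_action T q - profile_action T p| <= K * (q - p).
Proof.
move=> Tp pq qT HK.
have [||c cpq ->] := @MVT_segment R (profile_action T) (profile_speed T) p q pq.
- move=> x; rewrite in_itv/= => xpq; apply: is_derive_profile_action; lra.
- apply: continuous_subspaceW profile_action_continuous.
  by apply: subset_itv; rewrite bnd_simp.
move: cpq; rewrite in_itv/= => cpq.
by rewrite normrM [X in _ * X]ger0_norm ?subr_ge0// ler_wpM2r ?subr_ge0// HK.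
Qed.

Lemma profile_action_sqr_le t : `|t| <= T -> profile_action T t <= T ^+ 2 * t ^+ 2.
Proof.
move=> tT.
wlog t0 : t tT / 0 <= t.
  move=> H; have [/H->//|/ltW t0] := leP 0 t.
  by have := H (- t); rewrite profile_actionN sqrrN normrN oppr_ge0; apply.
have tT' : t <= T by rewrite (le_trans (ler_norm t)).
have := @profile_action_le 0 t (T ^+ 2 * t) _ t0 tT'.
rewrite oppr_le0 ltW// profile_action0 !subr0 => /(_ isT)/(_ _)/wrap[].
  move=> r r0t; apply: (le_trans (profile_speed_le r)).
  by rewrite ler_wpM2l ?sqr_ge0// ger0_norm; lra.
by move=> h; rewrite (le_trans (ler_norm _))// (le_trans h)// expr2 mulrA.
Qed.

Lemma profile_action_le_max t : `|t| <= T -> profile_action T t <= profile_action T T.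
Proof.
move=> tT.
wlog t0 : t tT / 0 <= t.
  move=> H; have [/H->//|/ltW t0] := leP 0 t.
  by have := H (- t); rewrite profile_actionN normrN oppr_ge0; apply.
have tT' : t <= T by rewrite (le_trans (ler_norm t)).
have [||c ctT] := @MVT_segment R (profile_action T) (profile_speed T) t T tT'.
- move=> x; rewrite in_itv/= => xtT; apply: is_derive_profile_action; lra.
- apply: continuous_subspaceW profile_action_continuous.
  by apply: subset_itv; rewrite bnd_simp//; lra.
move: ctT; rewrite in_itv/= => ctT E.
rewrite -subr_ge0 E mulr_ge0 ?subr_ge0// /profile_speed.
by rewrite mulr_ge0 ?divr_ge0 ?sqr_ge0 ?sqrtr_ge0// mulr_ge0 ?sqrtr_ge0//; lra.
Qed.

End Profile.

(** * The energy of one edge *)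

Section EdgeEnergy.
Variable R : realType.
Variables (l T : R) (u g : R -> R).
Hypotheses (l0 : 0 < l) (T0 : 0 < T) (uc : {within `[0, l], continuous u})
  (gi : seg_integrable 0 l g) (g2i : seg_integrable 0 l (fun x => g x ^+ 2))
  (incr : forall x y, 0 <= x -> x <= y -> y <= l -> u y - u x = seg_int x y g)
  (uT : forall x, 0 <= x <= l -> `|u x| <= T).

Local Notation phi := (profile_speed T).
Local Notation Phi := (profile_action T).

Definition edge_variation : R := seg_int 0 l (fun x => `|phi (u x)| * `|g x|).
Definition edge_defect : R := seg_int 0 l (fun x => (`|phi (u x)| - `|g x|) ^+ 2).

Lemma edge_variation_ge0 : 0 <= edge_variation.
Proof. by apply: seg_int_ge0 => x _; rewrite mulr_ge0. Qed.

Lemma edge_defect_ge0 : 0 <= edge_defect.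
Proof. by apply: seg_int_ge0 => x _; rewrite sqr_ge0. Qed.

Let phic : continuous phi.
Proof. exact: profile_speed_continuous. Qed.

Let phiuc := @within_continuous_comp R l u uc phi phic.

Let phi2c : {within `[0, l], continuous (fun x => phi (u x) ^+ 2)}.
Proof. by move=> x; apply: cvgM; exact: phiuc. Qed.

Let vi : seg_integrable 0 l (fun x => `|phi (u x)| * `|g x|).
Proof. exact: (composite_product_integrable uc gi g2i phic). Qed.

Lemma edge_defectE x : (`|phi (u x)| - `|g x|) ^+ 2 =
  (phi (u x) ^+ 2 + g x ^+ 2) - 2 * (`|phi (u x)| * `|g x|).
Proof. by rewrite -[g x ^+ 2]real_normK ?num_real// -[phi _ ^+ 2]real_normK ?num_real//; ring. Qed.

Lemma edge_defect_integrable : seg_integrable 0 l (fun x => (`|phi (u x)| - `|g x|) ^+ 2).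
Proof.
rewrite (_ : (fun x => _) = fun x => (phi (u x) ^+ 2 + g x ^+ 2) - 2 * (`|phi (u x)| * `|g x|)).
  apply: seg_integrableB; last exact: (seg_integrableZ 2 vi).
  by apply: seg_integrableD => //; exact: continuous_seg_integrable.
by apply/funext => x; exact: edge_defectE.
Qed.

Lemma within_continuousX n : {within `[0, l], continuous (fun x => u x ^+ n)}.
Proof.
by move=> x; apply: (@continuous_comp _ _ _ (u : subspace _ -> R) (fun y : R => y ^+ n)); [exact: uc|exact: exprn_continuous].
Qed.

(** The soliton equation makes the energy density plus the multiplier term a
    product plus half of a square. *)
Lemma edge_energy_identity :
  2^-1 * seg_int 0 l (fun x => g x ^+ 2) + T ^+ 4 / 6 * seg_int 0 l (fun x => u x ^+ 2) =
  edge_variation + 2^-1 * edge_defect + 6^-1 * seg_int 0 l (fun x => u x ^+ 6).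
Proof.
have u2i := continuous_seg_integrable (@within_continuousX 2).
have u6i := continuous_seg_integrable (@within_continuousX 6).
have di := edge_defect_integrable.
rewrite /edge_variation /edge_defect -(seg_intZ 2^-1 g2i) -(seg_intZ (T ^+ 4 / 6) u2i).
rewrite -(seg_intZ 2^-1 di) -(seg_intZ 6^-1 u6i).
have [gz uz] := (seg_integrableZ 2^-1 g2i, seg_integrableZ (T ^+ 4 / 6) u2i).
have [dz sz] := (seg_integrableZ 2^-1 di, seg_integrableZ 6^-1 u6i).
rewrite -(seg_intD gz uz) -(seg_intD vi dz) -(seg_intD (seg_integrableD vi dz) sz).
apply: eq_seg_int => x /uT xT.
by rewrite edge_defectE profile_speed_sqr//; field.
Qed.

(** The same square, completed after weighting |u'| by [k]. *)
Lemma edge_weighted_energy (k : R) :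
  2 * k * edge_variation + 3^-1 * seg_int 0 l (fun x => u x ^+ 6) <=
  k ^+ 2 * seg_int 0 l (fun x => g x ^+ 2) + T ^+ 4 / 3 * seg_int 0 l (fun x => u x ^+ 2).
Proof.
have u2i := continuous_seg_integrable (@within_continuousX 2).
have u6i := continuous_seg_integrable (@within_continuousX 6).
have [gz uz] := (seg_integrableZ (k ^+ 2) g2i, seg_integrableZ (T ^+ 4 / 3) u2i).
have [vz sz] := (seg_integrableZ (2 * k) vi, seg_integrableZ 3^-1 u6i).
rewrite /edge_variation -(seg_intZ _ g2i) -(seg_intZ _ u2i) -(seg_intZ _ vi) -(seg_intZ _ u6i).
rewrite -(seg_intD gz uz) -(seg_intD vz sz).
apply: le_seg_int; [exact: seg_integrableD|exact: seg_integrableD|move=> x /uT xT].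
have := profile_speed_sqr T0 xT; have := sqr_ge0 (`|phi (u x)| - k * `|g x|).
rewrite -[g x ^+ 2]real_normK ?num_real// -[phi (u x) ^+ 2]real_normK ?num_real//.
lra.
Qed.

Lemma edge_variation_ge x y : 0 <= x -> x <= y -> y <= l ->
  `|Phi (u y) - Phi (u x)| <= seg_int x y (fun t => `|phi (u t)| * `|g t|).
Proof.
apply: (chain_rule_le uc gi g2i incr uT phic) => p q K; exact: profile_action_le.
Qed.

Lemma edge_variation_ends : `|Phi (u 0) - Phi (u l)| <= edge_variation.
Proof. by rewrite distrC; apply: edge_variation_ge => //; exact: ltW. Qed.

Lemma edge_variation_peak x : 0 <= x <= l ->
  2 * Phi (u x) - Phi (u 0) - Phi (u l) <= edge_variation.
Proof.
move=> /andP[x0 xl]; rewrite /edge_variation (@seg_int_split _ _ _ x) ?vi//.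
have h1 := edge_variation_ge (lexx 0) x0 xl.
have h2 := edge_variation_ge x0 xl (lexx l).
move: (le_trans (ler_norm _) h1) h2; rewrite distrC => ? /(le_trans (ler_norm _)); lra.
Qed.

(** Without defect |u'| is at most T^2 |u|. *)
Lemma edge_defect0_propagate a : edge_defect = 0 -> 0 <= a <= l -> u a = 0 ->
  forall x, 0 <= x <= l -> u x = 0.
Proof.
move=> d0; apply: (gronwall_zero uc (sqr_ge0 T)).
move=> x y x0 xy yl.
pose h t := `|phi (u t)| - `|g t|.
have pc : {within `[0, l], continuous (fun t => `|phi (u t)|)}.
  by move=> t; apply: cvg_norm; exact: phiuc.
have nc : {within `[0, l], continuous (fun t => `|u t|)}.
  by move=> t; apply: cvg_norm; exact: uc.
have pi := continuous_seg_integrable pc.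
have ni := continuous_seg_integrable nc.
have hi : seg_integrable 0 l h by apply: seg_integrableB => //; exact: seg_integrable_norm.
have h2i := edge_defect_integrable.
have sub f : seg_integrable 0 l f -> seg_integrable x y f by exact: seg_integrableS.
have h0 : seg_int x y (fun t => `|h t|) = 0.
  apply/eqP; rewrite -sqrf_eq0; apply/eqP/le_anti; rewrite sqr_ge0 andbT.
  apply: (le_trans (seg_int_norm_sqr xy (sub _ hi) (sub _ h2i))).
  have : seg_int x y (fun t => h t ^+ 2) <= 0.
    by rewrite -d0; apply: seg_intS => // t _; exact: sqr_ge0.
  by move=> ?; rewrite mulr_ge0_le0// subr_ge0.
apply: (le_trans (increment_le gi incr x0 xy yl)).
apply: (@le_trans _ _ (seg_int x y (fun t => T ^+ 2 * `|u t| + `|h t|))).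
  apply: le_seg_int.
  - by apply: sub; exact: seg_integrable_norm.
  - apply: seg_integrableD; last by apply: sub; exact: seg_integrable_norm.
    by apply: seg_integrableZ; exact: sub.
  move=> t txy; have := profile_speed_le T (u t).
  have : - `|h t| <= h t by rewrite lerNl -normrN ler_norm.
  rewrite /h; lra.
rewrite seg_intD; first last.
- by apply: sub; exact: seg_integrable_norm.
- by apply: seg_integrableZ; exact: sub.
by rewrite h0 addr0 seg_intZ//; exact: sub.
Qed.

(** If both integrals vanish, so does the integral of the squared speed along u. *)
Lemma edge_rigid : edge_defect = 0 -> edge_variation = 0 ->
  exists2 x, 0 <= x <= l & u x = 0 \/ T <= `|u x|.
Proof.
move=> d0 v0; apply: contrapT => H.
have [c cl cmin] := EVT_min (ltW l0) phi2c.
rewrite in_itv/= in cl.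
have phi0 : 0 < phi (u c) ^+ 2.
  rewrite lt_def sqr_ge0 andbT sqrf_eq0; apply/eqP => E; apply: H; exists c => //.
  have [?|cT] := leP T `|u c|; first by right.
  by left; exact: profile_speed_eq0 E.
have phi2i := continuous_seg_integrable phi2c.
have di := edge_defect_integrable.
have zi : seg_integrable 0 l (fun x => 2 * (`|phi (u x)| * `|g x|)) by exact: (seg_integrableZ 2 vi).
have : seg_int 0 l (cst (phi (u c) ^+ 2)) <=
    seg_int 0 l (fun x => (`|phi (u x)| - `|g x|) ^+ 2 + 2 * (`|phi (u x)| * `|g x|)).
  apply: le_seg_int; [exact: seg_integrable_cst|exact: seg_integrableD|].
  move=> x xl /=; rewrite edge_defectE subrK.
  by rewrite (le_trans (cmin x _)) ?in_itv// lerDl sqr_ge0.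
rewrite /edge_variation in v0; rewrite /edge_defect in d0.
rewrite (seg_intD di zi) (seg_intZ 2 vi) v0 d0 mulr0 addr0.
by rewrite seg_int_cst ?(ltW l0)// subr0 leNgt mulr_gt0.
Qed.

End EdgeEnergy.

(** * Sums over the edges *)

Section EdgeSums.
Variable R : realType.
Implicit Type I : choiceType.

Lemma esumZ I (A : set I) (f : I -> \bar R) (k : R) : 0 < k ->
  (forall i, 0 <= f i)%E ->
  (\esum_(i in A) (k%:E * f i) = k%:E * \esum_(i in A) f i)%E.
Proof.
have le (h : I -> \bar R) (c : R) : 0 < c -> (forall i, 0 <= h i)%E ->
    (\esum_(i in A) (c%:E * h i) <= c%:E * \esum_(i in A) h i)%E.
  move=> c0 h0; apply: ge_ereal_sup => _ [X [finX XA]] <-.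
  rewrite -ge0_mule_fsumr; last by move=> i; exact: h0.
  by rewrite lee_pmul2l//; apply: esum_ge; exists X.
move=> k0 f0; apply/le_anti; rewrite le//=.
have kf0 i : (0 <= k%:E * f i)%E by rewrite mule_ge0// lee_fin ltW.
rewrite -(@lee_pmul2l R k^-1%:E)// ?lte_fin ?invr_gt0//.
rewrite muleA -EFinM mulVf ?gt_eqF// mul1e.
have := le (fun i => k%:E * f i)%E k^-1; rewrite invr_gt0 => /(_ k0 kf0).
apply: le_trans; apply: le_esum => i _.
by rewrite muleA -EFinM mulVf ?gt_eqF// mul1e.
Qed.

Lemma esum_setD1 I (A : set I) (f : I -> \bar R) j : A j ->
  (forall i, A i -> 0 <= f i)%E ->
  (\esum_(i in A) f i = f j + \esum_(i in A `\ j) f i)%E.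
Proof.
move=> Aj f0; rewrite (esumID [set j])// (_ : A `&` [set j] = [set j]).
  by rewrite esum_set1 ?f0// setDE.
by apply/seteqP; split => [i []|i ->].
Qed.

Lemma esum_large_finite I (f : I -> R) d : 0 < d -> (forall i, 0 <= f i) ->
  (\esum_(i in [set: I]) (f i)%:E < +oo)%E -> finite_set [set i | d <= f i].
Proof.
move=> d0 f0 foo; apply: contrapT => inf.
have s0 : (0 <= \esum_(i in [set: I]) (f i)%:E)%E by apply: esum_ge0 => i _; rewrite lee_fin.
have sfin : (\esum_(i in [set: I]) (f i)%:E)%E \is a fin_num by rewrite ge0_fin_numE.
set s := fine (\esum_(i in [set: I]) (f i)%:E)%E.
pose n := (Num.truncn (s / d)).+1.
have [B BA nB] := infinite_set_fset n inf.
have : (\sum_(i <- B) (f i)%:E <= \esum_(i in [set: I]) (f i)%:E)%E.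
  apply: esum_ge; exists [set` B]; first by split.
  by rewrite fsbig_finite//= set_fsetK.
rewrite -(fineK sfin) -/s sumEFin lee_fin leNgt => /negP; apply.
apply: (@lt_le_trans _ _ (n%:R * d)).
  rewrite -ltr_pdivrMr// /n; exact: truncnS_gt.
apply: (@le_trans _ _ (\sum_(i <- B) d)).
  have -> : \sum_(i <- B) d = (size B)%:R * d.
    by rewrite big_const_seq count_predT iter_addr_0 mulr_natl.
  by rewrite ler_wpM2r ?(ltW d0)// ler_nat.
by rewrite !big_seq; apply: ler_sum => i iB; apply: BA.
Qed.

Lemma finite_argmax I (A : set I) (f : I -> R) : finite_set A -> A !=set0 ->
  exists2 i, A i & forall j, A j -> f j <= f i.
Proof.
move=> /finite_seqP[s ->]; elim: s => [[i]//|a s IH _].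
case: s IH => [_|b s IH].
  by exists a; rewrite /= ?inE// => j; rewrite /= inE => /eqP ->.
have [|i is_ imax] := IH; first by exists b; rewrite /= inE eqxx.
have [ai|/ltW ia] := leP (f a) (f i).
  exists i; first by rewrite /= inE is_ orbT.
  by move=> j /=; rewrite inE => /orP[/eqP ->//|]; exact: imax.
exists a; first by rewrite /= inE eqxx.
move=> j /=; rewrite inE => /orP[/eqP ->//|] js.
by apply: le_trans ia; exact: imax.
Qed.

End EdgeSums.

(** * The sharp energy bound *)

Section SharpBound.
Variables (R : realType) (G : metric_graph R).
Local Notation mu := (@lebesgue_measure R).

(** [escaping k] : after removal of a suitable edge [e1] far away, a function
    with finite superlevel sets still has, outside the edge [e0] of its peak, the
    variation of [k] descents from the peak to infinity. The subtracted term is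
    the variation that is always present on [e0] itself. *)
Definition escaping (k : nat) := forall (e0 : edge G) (F : set (edge G)), finite_set F ->
  exists2 e1, ~ F e1 & forall (w : vertex G -> R) (T : R),
    (forall t, 0 < t -> finite_set [set v | t < w v]) -> (forall v, w v <= T) ->
    ((k%:R * T - (2 * T - w (esrc e0) - w (etgt e0)))%:E <=
     \esum_(e in [set e | e <> e0 /\ e <> e1]) (`|w (esrc e) - w (etgt e)|)%:E)%E.

Variables (lmin lmax : R).
Hypotheses (lmin0 : 0 < lmin) (elen_bounds : forall e : edge G, lmin <= elen e <= lmax)
  (incident : forall v : vertex G, exists p : edge G * bool, end_of p = v)
  (conn : connected_graph G).

Variable u : graph_fun G.
Hypothesis uH1 : H1 u.

Local Notation g := (graph_derivative u).

Let uc e : {within `[0, elen e], continuous (u e)}.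
Proof. by case: uH1 => -[]. Qed.

Let gP e : Lp_interval 2 (elen e) (g e) /\ is_weak_derivative (elen e) (u e) (g e).
Proof. by case: uH1 => _ h _ _; exact: weak_derivativeP. Qed.

Let gi e : seg_integrable 0 (elen e) (g e).
Proof. by have [/Lp2_integrable[]] := gP e. Qed.

Let g2i e : seg_integrable 0 (elen e) (fun x => g e x ^+ 2).
Proof. by have [/Lp2_integrable[]] := gP e. Qed.

Let incr e x y : 0 <= x -> x <= y -> y <= elen e -> u e y - u e x = seg_int x y (g e).
Proof. by apply: weak_derivative_increment => //; case: (gP e). Qed.

Let l0 (e : edge G) : 0 < elen e. Proof. exact: elen_gt0. Qed.

Definition edge_kinetic e := seg_int 0 (elen e) (fun x => g e x ^+ 2).
Definition edge_power p e := seg_int 0 (elen e) (fun x => u e x ^+ p).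

Lemma int_pow_kinetic : int_pow 2 g = (\esum_(e in [set: edge G]) (edge_kinetic e)%:E)%E.
Proof.
apply: eq_esum => e _; rewrite EFin_seg_int//; apply: eq_integral => x _.
by rewrite real_normK ?num_real.
Qed.

Lemma int_pow_power p : ~~ odd p ->
  int_pow p u = (\esum_(e in [set: edge G]) (edge_power p e)%:E)%E.
Proof.
move=> op; apply: eq_esum => e _; rewrite EFin_seg_int; last first.
  exact/continuous_seg_integrable/within_continuousX.
by apply: eq_integral => x _; rewrite -normrX ger0_norm// exprn_even_ge0.
Qed.

Lemma edge_kinetic_ge0 e : 0 <= edge_kinetic e.
Proof. by apply: seg_int_ge0 => x _; exact: sqr_ge0. Qed.

Lemma edge_power_ge0 p e : ~~ odd p -> 0 <= edge_power p e.
Proof. by move=> op; apply: seg_int_ge0 => x _; exact: exprn_even_ge0. Qed.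

Lemma kinetic_lty : (int_pow 2 g < +oo)%E.
Proof. by case: uH1 => _ _ _ []. Qed.

Lemma mass_lty : (int_pow 2 u < +oo)%E.
Proof. by case: uH1 => _ _ []. Qed.

(** By the supremum bound each of these edges carries a fixed amount of the H^1
    norm. *)
Lemma large_edges_finite d : 0 < d ->
  finite_set [set e | exists2 x, 0 <= x <= elen e & d <= u e x ^+ 2].
Proof.
move=> d0; pose C := 2 / lmin + 2 * lmax.
have [[e0 _]|none] := pselect ([set: edge G] !=set0); last first.
  by apply: sub_finite_set (finite_set0 _) => e _; apply: none; exists e.
have lmax0 : 0 < lmax.
  by have /andP[h1 h2] := elen_bounds e0; exact: lt_le_trans (lt_le_trans lmin0 h1) h2.
have C0 : 0 < C by rewrite addr_gt0 ?divr_gt0 ?mulr_gt0.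
apply: (@sub_finite_set _ _ [set e | d / C <= edge_power 2 e + edge_kinetic e]).
  move=> e [x xl dx]; rewrite /= ler_pdivrMr// (le_trans dx)//.
  apply: (le_trans (sobolev_sup_bound (l0 e) (@uc e) (gi e) (g2i e) (@incr e) xl)).
  rewrite -/(edge_power 2 e) -/(edge_kinetic e) /C.
  have M0 := @edge_power_ge0 2 e isT; have D0 := edge_kinetic_ge0 e.
  have /andP[h1 h2] := elen_bounds e.
  have i1 : (elen e)^-1 <= lmin^-1 by rewrite lef_pV2 ?posrE.
  have i0 : 0 <= lmin^-1 by rewrite invr_ge0 ltW.
  have := mulr_ge0 M0 (_ : 0 <= lmin^-1 - (elen e)^-1); rewrite subr_ge0 => /(_ i1).
  have := mulr_ge0 D0 (_ : 0 <= lmax - elen e); rewrite subr_ge0 => /(_ h2).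
  have := mulr_ge0 M0 (ltW lmax0); have := mulr_ge0 D0 i0; lra.
apply: esum_large_finite; first by rewrite divr_gt0.
  by move=> e; rewrite addr_ge0 ?edge_power_ge0 ?edge_kinetic_ge0.
under eq_esum do rewrite EFinD.
rewrite esumD; first last.
- by move=> e _; rewrite lee_fin edge_kinetic_ge0.
- by move=> e _; rewrite lee_fin edge_power_ge0.
by rewrite -int_pow_kinetic -int_pow_power// lte_add_pinfty ?mass_lty ?kinetic_lty.
Qed.

Lemma trace_ends : exists W : vertex G -> R,
  forall e, u e 0 = W (esrc e) /\ u e (elen e) = W (etgt e).
Proof. by case: uH1 => -[]. Qed.

Lemma trace_value (W : vertex G -> R) v :
  (forall e, u e 0 = W (esrc e) /\ u e (elen e) = W (etgt e)) ->
  exists2 p : edge G * bool, end_of p = v &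
  exists2 x, 0 <= x <= elen p.1 & u p.1 x = W v.
Proof.
move=> WP; have [[e b] pv] := incident v; exists (e, b) => //=.
have [W1 W2] := WP e; move: pv; rewrite /end_of/=; case: b => <-.
  by exists (elen e); rewrite ?lexx ?(ltW (l0 e)).
by exists 0; rewrite ?lexx ?(ltW (l0 e)).
Qed.

Definition nonzero := exists e1, exists2 x1, 0 <= x1 <= elen e1 & u e1 x1 != 0.

Lemma zeroP : ~ nonzero -> forall p, ~~ odd p -> (0 < p)%N -> int_pow p u = 0%E.
Proof.
move=> H p op p0; rewrite int_pow_power//; apply: esum1 => e _; congr EFin.
rewrite /edge_power (@eq_seg_int _ _ _ _ (cst 0)) ?seg_int_cst ?mul0r ?ltW//.
move=> x xl /=; rewrite (_ : u e x = 0) ?expr0n ?gtn_eqF//.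
by apply/eqP; apply: contrapT => /negP ux; apply: H; exists e, x.
Qed.

(** Only finitely many edges compete for the maximum of |u|. *)
Lemma peak : nonzero ->
  exists e0 x0, [/\ 0 <= x0 <= elen e0, 0 < `|u e0 x0| &
    forall e x, 0 <= x <= elen e -> `|u e x| <= `|u e0 x0|].
Proof.
move=> [e1 [x1 x1l ux1]].
have d0 : 0 < u e1 x1 ^+ 2 by rewrite exprn_even_gt0.
have maxP e : exists x, 0 <= x <= elen e /\ forall y, 0 <= y <= elen e -> `|u e y| <= `|u e x|.
  have nc : {within `[0, elen e], continuous (fun t => `|u e t|)}.
    by move=> t; apply: cvg_norm; exact: uc.
  have [c] := EVT_max (ltW (l0 e)) nc; rewrite in_itv/= => cl cmax.
  by exists c; split=> // y yl; apply: cmax; rewrite in_itv.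
have [X XP] := choice maxP.
have [|e0 [x0 x0l dx0] e0max] := @finite_argmax _ _ _ (fun e => `|u e (X e)|) (large_edges_finite d0).
  by exists e1, x1.
have [Xl Xmax] := XP e0.
exists e0, (X e0); split=> //.
  apply: lt_le_trans (Xmax x0 x0l); rewrite normr_gt0 -sqrf_eq0 gt_eqF//.
  exact: lt_le_trans d0 dx0.
move=> e x xl; have [Xel Xemax] := XP e.
have [le1|lt1] := leP (u e1 x1 ^+ 2) (u e x ^+ 2).
  apply: (le_trans (Xemax x xl)); apply: (e0max e); exists x => //.
apply: le_trans (Xmax x0 x0l); rewrite -(@ler_pXn2r _ 2)// ?nnegrE// !real_normK ?num_real//.
by rewrite (le_trans (ltW lt1)).
Qed.

Definition total_variation T : \bar R :=
  \esum_(e in [set: edge G]) (edge_variation (elen e) T (u e) (g e))%:E.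

(** The edge of the peak contributes the variation from the peak to its two ends,
    the other edges what [escaping] grants for the values of the action at the
    vertices; all edges on which |u| reaches T belong to a finite set, which the
    spare edge [e1] avoids. *)
Lemma descents k : escaping k -> nonzero -> exists T e1, [/\ 0 < T,
  forall e x, 0 <= x <= elen e -> `|u e x| <= T,
  (exists e, exists2 x, 0 <= x <= elen e & `|u e x| = T),
  forall x, 0 <= x <= elen e1 -> `|u e1 x| < T &
  ((k%:R * profile_action T T + edge_variation (elen e1) T (u e1) (g e1))%:E <=
    total_variation T)%E].
Proof.
move=> esc /peak[e0 [x0 [x0l T0 umax]]].
set T := `|u e0 x0| in T0 umax.
have [W WP] := trace_ends.
have WT v : `|W v| <= T.
  by have [[e b] _ [x xl <-]] := trace_value v WP; exact: umax.
pose w v := profile_action T (W v).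
pose V e := edge_variation (elen e) T (u e) (g e).
have T2 : 0 < T ^+ 2 by rewrite exprn_gt0.
have [e1 e1F e1esc] := esc e0 _ (large_edges_finite T2).
have V0 e : 0 <= V e by exact: edge_variation_ge0.
have wfin t : 0 < t -> finite_set [set v | t < w v].
  move=> t0; have d0 : 0 < t / T ^+ 2 by rewrite divr_gt0.
  have fin := large_edges_finite d0.
  pose L := [set e : edge G | exists2 x, 0 <= x <= elen e & t / T ^+ 2 <= u e x ^+ 2].
  have sub : [set v | t < w v] `<=` (@esrc R G @` L) `|` (@etgt R G @` L); last first.
    by apply: (sub_finite_set sub); rewrite finite_setU; split; exact: finite_image.
  move=> v /= tw; have [[e b] pv [x xl ux]] := trace_value v WP.
  have eL : exists2 x, 0 <= x <= elen e & t / T ^+ 2 <= u e x ^+ 2.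
    exists x => //; rewrite ux ler_pdivrMr// mulrC.
    by rewrite (le_trans (ltW tw))// profile_action_sqr_le.
  by move: pv; rewrite /end_of/=; case: ifP => _ <-; [right|left]; exists e.
have wT v : w v <= profile_action T T by exact: profile_action_le_max.
have wE e : `|w (esrc e) - w (etgt e)| <= V e.
  have [W1 W2] := WP e; rewrite /w -W1 -W2.
  exact: (edge_variation_ends (l0 e) T0 (@uc e) (gi e) (g2i e) (@incr e) (umax e)).
have wE0 : 2 * profile_action T T - w (esrc e0) - w (etgt e0) <= V e0.
  have [W1 W2] := WP e0; rewrite /w -W1 -W2.
  have -> : profile_action T T = profile_action T (u e0 x0).
    by rewrite /T; case: (ler0P (u e0 x0)) => // _; rewrite profile_actionN.
  exact: (edge_variation_peak T0 (@uc e0) (gi e0) (g2i e0) (@incr e0) (umax e0)).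
have e10 : e1 <> e0.
  move=> E; apply: e1F; rewrite E; exists x0 => //.
  by rewrite /T real_normK ?num_real.
exists T, e1; split=> //.
- by exists e0, x0.
- move=> x xl; rewrite ltNge; apply/negP => Tx; apply: e1F; exists x => //.
  by rewrite -[u e1 x ^+ 2]real_normK ?num_real// ler_pXn2r ?nnegrE// ltW.
change ((k%:R * profile_action T T + V e1)%:E <= \esum_(e in [set: edge G]) (V e)%:E)%E.
rewrite (@esum_setD1 _ _ _ _ e0)//; last by move=> e _; rewrite lee_fin.
rewrite (@esum_setD1 _ _ _ _ e1)//; last by move=> e _; rewrite lee_fin.
rewrite (_ : _ `\ _ `\ _ = [set e | e <> e0 /\ e <> e1]); last first.
  by apply/seteqP; split => e /= => [[[]]|[]].
apply: (@le_trans _ _ ((V e0)%:E + ((V e1)%:E + (k%:R * profile_action T T -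
   (2 * profile_action T T - w (esrc e0) - w (etgt e0)))%:E))%E).
  by rewrite -!EFinD lee_fin; lra.
rewrite leeD2l// leeD2l//; apply: (le_trans (e1esc w _ wfin wT)).
by apply: le_esum => e _; rewrite lee_fin.
Qed.

(** The inequality without strictness sums [edge_energy_identity] over the edges.
    Equality would force |u'| to be the speed of the soliton of maximum T on every
    edge and the variation of the action to be zero on the distant edge [e1],
    whereas 0 < |u| < T there. *)
Theorem energy_gt k m : escaping k -> int_pow 2 u = m%:E -> 0 < m ->
  exists E T : R, [/\ energy u = E%:E, 0 < T &
    T ^+ 4 / 6 * (k%:R * (Num.sqrt 3 / 4 * pi) - m) < E].
Proof.
move=> esc um m0.
have nz0 : nonzero.
  apply: contrapT => /zeroP/(_ 2 isT isT); rewrite um => -[]; apply/eqP; rewrite gt_eqF//.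
have [T [e1 [T0 umax [e0 [x0 x0l ux0]] e1T Vge]]] := descents esc nz0.
pose V e := edge_variation (elen e) T (u e) (g e).
pose Q e := edge_defect (elen e) T (u e) (g e).
have T4 : 0 < T ^+ 4 / 6 by rewrite divr_gt0// exprn_gt0.
have V0 e : 0 <= V e by exact: edge_variation_ge0.
have Q0 e : 0 <= Q e by exact: edge_defect_ge0.
have [W WP] := trace_ends.
have VI e := edge_energy_identity T0 (@uc e) (gi e) (g2i e) (umax e).
pose tot e := 2^-1 * edge_kinetic e + T ^+ 4 / 6 * edge_power 2 e.
pose Q' e := 2^-1 * Q e; pose S' e := 6^-1 * edge_power 6 e.
have Q'0 e : 0 <= Q' e by rewrite mulr_ge0.
have S'0 e : 0 <= S' e by rewrite mulr_ge0// edge_power_ge0.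
have totE e : tot e = V e + Q' e + S' e by exact: VI.
have totsum : (\esum_(e in [set: edge G]) (tot e)%:E =
    2^-1%:E * int_pow 2 g + (T ^+ 4 / 6)%:E * m%:E)%E.
  rewrite -um int_pow_kinetic int_pow_power//.
  rewrite -!esumZ//; [|by move=> e; rewrite lee_fin ?edge_power_ge0 ?edge_kinetic_ge0..].
  rewrite -esumD; last 2 first.
  - by move=> e _; rewrite -EFinM lee_fin mulr_ge0// edge_kinetic_ge0.
  - by move=> e _; rewrite -EFinM lee_fin mulr_ge0// ?edge_power_ge0// ltW.
  by apply: eq_esum => e _; rewrite /tot EFinD !EFinM.
have kfin : int_pow 2 g \is a fin_num.
  rewrite ge0_fin_numE ?kinetic_lty// int_pow_kinetic.
  by apply: esum_ge0 => e _; rewrite lee_fin edge_kinetic_ge0.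
set d := fine (int_pow 2 g).
have dE : int_pow 2 g = d%:E by rewrite fineK.
have fin (f : edge G -> R) : (forall e, 0 <= f e <= tot e) ->
    (\esum_(e in [set: edge G]) (f e)%:E)%E = (fine (\esum_(e in [set: edge G]) (f e)%:E)%E)%:E.
  move=> ft; rewrite fineK// ge0_fin_numE; last first.
    by apply: esum_ge0 => e _; rewrite lee_fin; case/andP: (ft e).
  apply: (@le_lt_trans _ _ (\esum_(e in [set: edge G]) (tot e)%:E)%E).
    by apply: le_esum => e _; rewrite lee_fin; case/andP: (ft e).
  by rewrite totsum dE -!EFinM -EFinD ltry.
have parts e : [/\ 0 <= V e <= tot e, 0 <= Q' e <= tot e & 0 <= S' e <= tot e].
  by have := totE e; have := V0 e; have := Q'0 e; have := S'0 e; split; lra.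
have [v Vf] : exists v, (\esum_(e in [set: edge G]) (V e)%:E)%E = v%:E.
  by eexists; apply: fin => e; case: (parts e).
have [q Qf] : exists q, (\esum_(e in [set: edge G]) (Q' e)%:E)%E = q%:E.
  by eexists; apply: fin => e; case: (parts e).
have [s Sf] : exists s, (\esum_(e in [set: edge G]) (S' e)%:E)%E = s%:E.
  by eexists; apply: fin => e; case: (parts e).
have real_id : 2^-1 * d + T ^+ 4 / 6 * m = v + q + s.
  apply: EFin_inj; rewrite !EFinD !EFinM -dE -totsum -Vf -Qf -Sf.
  rewrite -esumD; [|by move=> e _; rewrite lee_fin..].
  rewrite -esumD; [|by move=> e _; rewrite ?adde_ge0 ?lee_fin..].
  by apply: eq_esum => e _; rewrite totE !EFinD.
have energyE : energy u = (2^-1 * d - s)%:E.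
  rewrite /energy dE int_pow_power// -esumZ//; last first.
    by move=> e; rewrite lee_fin edge_power_ge0.
  by rewrite EFinB EFinM -Sf; congr (_ - _)%E; apply: eq_esum => e _; rewrite EFinM.
have q0 : 0 <= q by rewrite -lee_fin -Qf; apply: esum_ge0 => e _; rewrite lee_fin.
move: Vge; rewrite /total_variation Vf lee_fin profile_action_max// -/(V e1) => Vge.
exists (2^-1 * d - s), T; split=> //.
rewrite ltNge; apply/negP => le.
have [Ve1 q00] : V e1 <= 0 /\ q <= 0 by have := V0 e1; split; nra.
have Qz e : Q e = 0.
  have h : (q%:E = (Q' e)%:E + \esum_(i in [set: edge G] `\ e) (Q' i)%:E)%E.
    by rewrite -Qf; apply: (@esum_setD1 _ _ _ (fun i => (Q' i)%:E)) => // i _; rewrite lee_fin.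
  have : ((Q' e)%:E <= q%:E)%E.
    by rewrite h leeDl// esum_ge0// => i _; rewrite lee_fin.
  by rewrite lee_fin /Q' => ?; have := Q0 e; lra.
have prop e a : 0 <= a <= elen e -> u e a = 0 -> forall x, 0 <= x <= elen e -> u e x = 0.
  exact: (edge_defect0_propagate (@uc e) (gi e) (g2i e) (@incr e) (Qz e)).
have l00 (e : edge G) : 0 <= (0 : R) <= elen e by rewrite lexx ltW.
have lll (e : edge G) : 0 <= elen e <= elen e by rewrite lexx ltW// .
have Wedge e : W (esrc e) = 0 <-> W (etgt e) = 0.
  have [W1 W2] := WP e; rewrite -W1 -W2; split => h.
    by apply: (prop e 0 (l00 e) h); exact: lll.
  by apply: (prop e (elen e) (lll e) h); exact: l00.
have Wconn v1 v2 : W v1 = 0 -> W v2 = 0.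
  have : W v1 = 0 <-> W v2 = 0.
    have := conn v1 v2; elim=> [x y [e [<- <-]]|x|x y _ h|x y z _ h1 _ h2] //.
    - by split=> /h.
    - by rewrite h1.
  by case.
have nz e x : 0 <= x <= elen e -> u e x <> 0.
  move=> xl ux; have W0 : W (esrc e) = 0.
    by have [<- _] := WP e; apply: (prop e x xl ux); exact: l00.
  have W1 := Wconn _ (esrc e0) W0.
  have u0 : u e0 0 = 0 by have [-> _] := WP e0.
  have h : u e0 x0 = 0 by apply: (prop e0 0 (l00 e0) u0).
  by move: T0; rewrite -ux0 h normr0 ltxx.
have [|x xl [/nz|Tx]] := edge_rigid (l0 e1) T0 (@uc e1) (gi e1) (g2i e1) (Qz e1).
- by apply/le_anti; rewrite -/(V e1) Ve1 V0.
- exact.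
by have := e1T x xl; rewrite ltNge Tx.
Qed.

(** Weighting the arithmetic-geometric inequality by the ratio of the mass of u to
    that of [k] half-solitons replaces the rescaling of u to the latter mass. *)
Theorem gagliardo_nirenberg k : escaping k -> (0 < k)%N ->
  (int_pow 6 u <= (3 / (k%:R * (Num.sqrt 3 / 4 * pi)) ^+ 2)%:E * int_pow 2 u ^+ 2 * int_pow 2 g)%E.
Proof.
move=> esc k0; set M := k%:R * _.
have M0 : 0 < M.
  by rewrite mulr_gt0 ?ltr0n// mulr_gt0 ?pi_gt0// divr_gt0// sqrtr_gt0.
have kfin : int_pow 2 g \is a fin_num.
  rewrite ge0_fin_numE ?kinetic_lty// int_pow_kinetic.
  by apply: esum_ge0 => e _; rewrite lee_fin edge_kinetic_ge0.
have mfin : int_pow 2 u \is a fin_num.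
  rewrite ge0_fin_numE ?mass_lty// int_pow_power//.
  by apply: esum_ge0 => e _; rewrite lee_fin edge_power_ge0.
have d0 : (0 <= int_pow 2 g)%E.
  by rewrite int_pow_kinetic; apply: esum_ge0 => e _; rewrite lee_fin edge_kinetic_ge0.
have m0 : (0 <= int_pow 2 u)%E.
  by rewrite int_pow_power//; apply: esum_ge0 => e _; rewrite lee_fin edge_power_ge0.
rewrite -(fineK kfin) -(fineK mfin).
set d := fine (int_pow 2 g); set m := fine (int_pow 2 u).
have {}d0 : 0 <= d by exact: fine_ge0.
have {}m0 : 0 <= m by exact: fine_ge0.
have rhs0 : 0 <= 3 / M ^+ 2 * m ^+ 2 * d.
  by rewrite mulr_ge0// mulr_ge0 ?sqr_ge0// divr_ge0// sqr_ge0.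
rewrite -EFin_expe -!EFinM.
have [nz0|/zeroP/(_ 6 isT isT) ->] := pselect nonzero; last by rewrite lee_fin.
have [T [e1 [T0 umax _ _ Vge]]] := descents esc nz0.
have T4 : 0 < T ^+ 4 by rewrite exprn_gt0.
have weighted (c : R) : 0 < c ->
    ((c * T ^+ 4 * M)%:E + int_pow 6 u <= (3 * c ^+ 2 * d + T ^+ 4 * m)%:E)%E.
  move=> c0.
  have V0 e : 0 <= edge_variation (elen e) T (u e) (g e) by exact: edge_variation_ge0.
  have D0 e := edge_kinetic_ge0 e.
  have P0 p e : ~~ odd p -> 0 <= edge_power p e by exact: edge_power_ge0.
  apply: (@le_trans _ _ (\esum_(e in [set: edge G])
     ((6 * c)%:E * (edge_variation (elen e) T (u e) (g e))%:E + (edge_power 6 e)%:E))%E).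
    rewrite esumD; last 2 first.
    - by move=> e _; rewrite -EFinM lee_fin mulr_ge0// mulr_ge0// ltW.
    - by move=> e _; rewrite lee_fin P0.
    rewrite -int_pow_power// leeD2r// esumZ ?mulr_gt0//.
    apply: (@le_trans _ _ ((6 * c)%:E * (k%:R * profile_action T T)%:E)%E).
      rewrite -EFinM lee_fin profile_action_max// /M le_eqVlt; apply/orP; left; apply/eqP; by field.
    rewrite lee_pmul2l ?lte_fin ?mulr_gt0//; apply: le_trans Vge.
    by rewrite lee_fin lerDl.
  apply: (@le_trans _ _ (\esum_(e in [set: edge G])
     ((3 * c ^+ 2)%:E * (edge_kinetic e)%:E + (T ^+ 4)%:E * (edge_power 2 e)%:E))%E).
    apply: le_esum => e _; rewrite -!EFinM -!EFinD lee_fin.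
    have := edge_weighted_energy T0 (@uc e) (gi e) (g2i e) (umax e) c.
    rewrite /edge_kinetic /edge_power; lra.
  rewrite esumD; last 2 first.
  - by move=> e _; rewrite -EFinM lee_fin mulr_ge0// mulr_ge0// sqr_ge0.
  - by move=> e _; rewrite -EFinM lee_fin mulr_ge0 ?P0// ltW.
  rewrite !esumZ//; [|by move=> e; rewrite lee_fin ?P0..|by rewrite mulr_gt0// exprn_gt0].
  by rewrite -int_pow_kinetic -int_pow_power// -(fineK kfin) -(fineK mfin) -!EFinM -EFinD.
have [m00|m00] := eqVneq m 0.
  pose c := T ^+ 4 * M / (3 * d + 1).
  have d1 : 0 < 3 * d + 1 by rewrite ltr_wpDl// mulr_ge0.
  have c0 : 0 < c by rewrite divr_gt0// mulr_gt0.
  have := weighted c c0; rewrite m00 mulr0 addr0 expr0n/= mulr0 mul0r.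
  move=> h; have le : 3 * c ^+ 2 * d <= c * T ^+ 4 * M.
    rewrite -mulrA [c * T ^+ 4 * M](_ : _ = c * (c * (3 * d + 1))); last first.
      by rewrite /c; field; rewrite gt_eqF.
    have := mulr_gt0 c0 c0; nra.
  have : (int_pow 6 u <= (3 * c ^+ 2 * d - c * T ^+ 4 * M)%:E)%E.
    by rewrite EFinB leeBrDl.
  by move/le_trans; apply; rewrite lee_fin subr_le0.
have m1 : 0 < m by rewrite lt_def m00.
have c0 : 0 < m / M by rewrite divr_gt0.
have := weighted _ c0.
have -> : m / M * T ^+ 4 * M = T ^+ 4 * m by field; rewrite gt_eqF.
move=> h; rewrite -(@leeD2lE _ (T ^+ 4 * m)%:E)// (le_trans h)// -EFinD lee_fin.
by rewrite le_eqVlt; apply/orP; left; apply/eqP; field; rewrite gt_eqF.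
Qed.

End SharpBound.

(** * Periodic graphs satisfy the hypotheses of the sharp bound *)

Section PeriodicEscape.
Variables (R : realType) (K : periodicity_cell R).
Local Notation G := (periodic_graph K).

Lemma connected_incident (H : metric_graph R) (x y : vertex H) : connected_to x y ->
  x <> y -> exists p : edge H * bool, end_of p = x.
Proof.
move=> /clos_rst_rst1n_iff; case=> [//|z t [] [e [h1 h2]] _ _].
- by exists (e, false).
- by exists (e, true).
Qed.

Lemma cell_incident (x : vertex (cell K)) : exists p : edge (cell K) * bool, end_of p = x.
Proof.
have [d dD] := dset_neq0 K; have [r rR] := rset_neq0 K.
have dr : d <> r.
  move=> E; have : (dset K `&` rset K) d by split=> //; rewrite E.
  by rewrite drset_disj.
have [xd|xd] := pselect (x = d); last exact: connected_incident (@cell_connected R K x d) xd.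
have xr : x <> r by rewrite xd.
exact: connected_incident (@cell_connected R K x r) xr.
Qed.

Lemma cell_has_edge : inhabited (edge (cell K)).
Proof. by have [d _] := dset_neq0 K; have [[e _] _] := cell_incident d; exists. Qed.

Lemma periodic_incident (v : vertex G) : exists p : edge G * bool, end_of p = v.
Proof.
have [i [x ->]] := cell_vertexP v; have [[e b] <-] := cell_incident x.
by exists ((i, e), b); case: b.
Qed.

Lemma periodic_elen_bounds : exists lmin lmax : R, 0 < lmin /\
  forall e : edge G, lmin <= elen e <= lmax.
Proof.
have [e0] := cell_has_edge.
have fin : finite_set [set: edge (cell K)] by case: (cell_compact K).
have ne : [set: edge (cell K)] !=set0 by exists e0.
have [e1 _ max] := finite_argmax (fun e => elen e) fin ne.
have [e2 _ min] := finite_argmax (fun e => - elen e) fin ne.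
exists (elen e2), (elen e1); split; first exact: elen_gt0.
by move=> [i e] /=; rewrite max//= -lerN2 min.
Qed.

Lemma periodic_connected : connected_graph G.
Proof.
have conn A v w : @reach R G A v w -> connected_to v w.
  elim=> [x y [e [_ ex ey]]|x|x y _|x y z _ + _].
  - by apply: rst_step; exists e.
  - exact: rst_refl.
  - exact: rst_sym.
  - exact: rst_trans.
move=> v w; have [i [x ->]] := cell_vertexP v; have [j [y ->]] := cell_vertexP w.
have [ij|/ltW ji] := leP i j.
  by apply: conn; exact: reach_cells.
by apply: rst_sym; apply: conn; exact: reach_cells.
Qed.

Lemma periodic_locally_finite2 (S : set (vertex G)) : finite_set S ->
  finite_set [set e : edge G | S (esrc e) \/ S (etgt e)].
Proof.
move=> /finite_index_bound[N H].
apply: (@sub_finite_set _ _ [set e : edge G | - N <= e.1 <= N]).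
  by move=> e [] h; exact: (H _ _ h).
exact: finite_index_edges.
Qed.

Lemma edge_index_bound (F : set (edge G)) : finite_set F ->
  exists N : int, forall e, F e -> - N <= e.1 <= N.
Proof.
move=> finF; have [N H] := finite_index_bound (finite_image (fun e : edge G => esrc e) finF).
by exists N => e Fe; apply: (H _ (esrc e.2)); exists e.
Qed.

(** A superlevel set containing both ends of [e0] is left by two edges other than
    [e0] and [e1]; one that contains a single end is left by [e0] and by another
    edge. Each end of [e0] thus accounts for one descent. *)
Lemma Hper_escaping : Hper G -> (exists v : vertex G, (3 <= degree v)%N) ->
  escaping G 2.
Proof.
move=> hper deg3 e0 F finF; have [N FN] := edge_index_bound finF.
have [e1 e1N cut] := Hper_far_edge_cut e0.1 (N + 1) hper deg3.
exists e1 => [/FN|w T wfin wT]; first by move=> /andP[_ /(le_trans e1N)]; lia.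
rewrite (_ : _ - _ = \sum_(c <- [:: w (esrc e0); w (etgt e0)]) c); last first.
  by rewrite !big_cons big_nil; lra.
apply: cut_esum_ge => //; first exact: periodic_locally_finite2.
move=> t t0; set S := [set v | t < w v].
have finS : finite_set S by exact: wfin.
have [src|nsrc] := boolP (t < w (esrc e0)); have [tgt|ntgt] := boolP (t < w (etgt e0)).
- have [a [ae0 ae1 ca]] := cut S _ e0 finS src.
  have [b [ba be1 cb]] := cut S _ a finS src.
  have be0 : b <> e0.
    by move=> E; move: cb; rewrite E => -[[_ h]|[h _]]; apply: h.
  exists [:: a; b]; split; first by rewrite /= inE eq_sym; apply/andP; split=> //; apply/eqP.
    by rewrite /= src tgt.
  by move=> e; rewrite !inE => /orP[] /eqP ->.
- have [a [ae0 ae1 ca]] := cut S _ e0 finS src.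
  exists [:: a]; split=> //; first by rewrite /= src (negbTE ntgt).
  by move=> e; rewrite inE => /eqP ->.
- have [a [ae0 ae1 ca]] := cut S _ e0 finS tgt.
  exists [:: a]; split=> //; first by rewrite /= tgt (negbTE nsrc).
  by move=> e; rewrite inE => /eqP ->.
- by exists [::]; split=> //; rewrite /= (negbTE nsrc) (negbTE ntgt).
Qed.

(** For a single descent it suffices to escape to the right from the lower end of
    [e0], because the other end value is at most the peak; the spare edge is taken
    far to the left. *)
Lemma periodic_escaping : escaping G 1.
Proof.
move=> e0 F finF; have [N FN] := edge_index_bound finF.
have [e'] := cell_has_edge.
exists (- (`|N| + `|e0.1| + 1), e') => [/FN|w T wfin wT]; first by move=> /=; lia.
set e1 : edge G := (_, e').
apply: (@le_trans _ _ (\sum_(c <- [:: Num.min (w (esrc e0)) (w (etgt e0))]) c)%:E).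
  rewrite big_cons big_nil addr0 lee_fin; have := wT (esrc e0); have := wT (etgt e0).
  by rewrite le_min => *; apply/andP; split; lra.
apply: cut_esum_ge => //; first exact: periodic_locally_finite2.
move=> t t0; set S := [set v | t < w v].
have finS : finite_set S by exact: wfin.
have [|low] := boolP (t < Num.min (w (esrc e0)) (w (etgt e0))); last first.
  by exists [::]; split=> //; rewrite /= (negbTE low).
rewrite lt_min => /andP[src tgt].
have [a ia ca] := @cut_right _ _ S e0.1 (esrc e0.2) finS src.
exists [:: a]; split=> //; first by rewrite /= lt_min src tgt.
move=> e; rewrite inE => /eqP ->; split=> //; split.
  by move=> E; move: ca; rewrite E => -[[_ h]|[h _]]; apply: h.
by move=> E; move: ia; rewrite E /=; lia.
Qed.

End PeriodicEscape.

(** * Continuously differentiable trial functions *)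

Section TrialFunctions.
Variables (R : realType) (G : metric_graph R) (F : set (edge G)).
Local Notation mu := (@lebesgue_measure R).
Hypothesis finF : finite_set F.

Definition support_int (p : nat) (u : graph_fun G) : R :=
  \sum_(e \in F) seg_int 0 (elen e) (fun x => `|u e x| ^+ p).

(** The function on each edge is extended to the whole line, so that integrability
    and differentiability up to the end points come for free; [W] gives the values
    at the vertices. *)
Definition trial (u u' : graph_fun G) (W : vertex G -> R) :=
  [/\ forall e (x : R), is_derive x 1 (u e) (u' e x),
      forall e, continuous (u' e),
      forall e, u e 0 = W (esrc e) /\ u e (elen e) = W (etgt e) &
      forall e, ~ F e -> forall x, u e x = 0 /\ u' e x = 0].

Lemma esum_support (f : edge G -> R) : (forall e, 0 <= f e) ->
  (forall e, ~ F e -> f e = 0) ->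
  (\esum_(e in [set: edge G]) (f e)%:E)%E = (\sum_(e \in F) f e)%:E.
Proof.
move=> f0 fF; rewrite (esumID F); last by move=> e _; rewrite lee_fin.
rewrite !setTI [X in (_ + X)%E]esum1 ?adde0; last by move=> e /fF ->.
by rewrite esum_fset// ?fsumEFin// => e _; rewrite lee_fin.
Qed.

Variables (u u' : graph_fun G) (W : vertex G -> R).
Hypothesis tu : trial u u' W.

Let uc e : continuous (u e).
Proof.
case: tu => du _ _ _ x.
by apply/differentiable_continuous/derivable1_diffP; case: (du e x).
Qed.

Lemma trial_int_pow p : (0 < p)%N -> int_pow p u = (support_int p u)%:E.
Proof.
move=> p0; rewrite -esum_support.
- apply: eq_esum => e _; rewrite EFin_seg_int//.
  by apply: continuous_seg_integrableT; exact: continuousX.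
- by move=> e; apply: seg_int_ge0 => x _; rewrite exprn_ge0.
- move=> e Fe; rewrite (@eq_seg_int _ _ _ _ (cst 0)) ?seg_int_cst ?mul0r ?ltW ?elen_gt0//.
  move=> x _ /=; case: tu => _ _ _ /(_ e Fe x)[-> _].
  by rewrite normr0 expr0n gtn_eqF.
Qed.

Lemma trial_int_pow_derivative p : (0 < p)%N ->
  int_pow p (graph_derivative u) = (support_int p u')%:E.
Proof.
case: (tu) => du cu' _ off p0; rewrite -esum_support.
- by apply: eq_esum => e _; apply: weak_derivative_C1 => //; exact/ltW/elen_gt0.
- by move=> e; apply: seg_int_ge0 => x _; rewrite exprn_ge0.
- move=> e Fe; rewrite (@eq_seg_int _ _ _ _ (cst 0)) ?seg_int_cst ?mul0r ?ltW ?elen_gt0//.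
  by move=> x _ /=; case: (off e Fe x) => _ ->; rewrite normr0 expr0n gtn_eqF.
Qed.

Lemma trial_H1 : H1 u.
Proof.
case: (tu) => du cu' tr off.
have h1 e : H1_interval (elen e) (u e).
  by apply: (@C1_H1_interval _ _ _ (u' e)) => //; exact/ltW/elen_gt0.
split=> //.
- by split; [move=> e; exact: continuous_subspaceT|exists W].
- split; last by rewrite trial_int_pow// ltry.
  by move=> e; exact: continuous_Lp.
- split; last by rewrite trial_int_pow_derivative// ltry.
  by move=> e; case: (weak_derivativeP (h1 e)).
Qed.

Lemma trialZ (s : R) : trial (fun e x => s * u e x) (fun e x => s * u' e x) (fun v => s * W v).
Proof.
case: tu => du cu' tr off; split.
- by move=> e x; have := is_deriveZ s (du e x).
- by move=> e x; apply: cvgM; [exact: cvg_cst|exact: cu'].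
- by move=> e; case: (tr e) => -> ->.
- by move=> e Fe x; case: (off e Fe x) => -> ->; rewrite mulr0.
Qed.

End TrialFunctions.

Section TrialEnergy.
Variables (R : realType) (G : metric_graph R) (F : set (edge G)).
Hypothesis finF : finite_set F.

Lemma support_intZ p (s : R) (w : graph_fun G) : (forall e, continuous (w e)) ->
  support_int F p (fun e x => s * w e x) = `|s| ^+ p * support_int F p w.
Proof.
move=> wc; rewrite /support_int !fsbig_finite//= mulr_sumr; apply: eq_bigr => e _.
rewrite -seg_intZ; last by apply: continuous_seg_integrableT; exact: continuousX.
by apply: eq_seg_int => x _; rewrite normrM exprMn.
Qed.

Lemma support_int_ge0 p (w : graph_fun G) : 0 <= support_int F p w.
Proof.
rewrite /support_int fsbig_finite//; apply: sumr_ge0 => e _.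
by apply: seg_int_ge0 => x _; rewrite exprn_ge0.
Qed.

(** Normalizing the mass multiplies u by the square root of [m / M], where M is the
    mass of u. *)
Lemma trial_energy (u u' : graph_fun G) (W : vertex G -> R) (m : R) : trial F u u' W ->
  0 < m -> 0 < support_int F 2 u ->
  exists2 v : graph_fun G, H1_mass m v &
    energy v = (2^-1 * (m / support_int F 2 u * support_int F 2 u') -
                6^-1 * ((m / support_int F 2 u) ^+ 3 * support_int F 6 u))%:E.
Proof.
move=> tu m0 M0; set M := support_int F 2 u in M0 *.
pose s := Num.sqrt (m / M).
have s2 : `|s| ^+ 2 = m / M.
  by rewrite real_normK ?num_real// sqr_sqrtr// ltW// divr_gt0.
have ts := trialZ tu s.
have uc e : continuous (u e).
  case: tu => du _ _ _ x.
  by apply/differentiable_continuous/derivable1_diffP; case: (du e x).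
have uc' e : continuous (u' e) by case: tu.
exists (fun e x => s * u e x).
  split; first exact: (trial_H1 finF ts).
  rewrite (trial_int_pow finF ts)// support_intZ// s2 -/M divfK// gt_eqF//.
rewrite /energy (trial_int_pow finF ts)// (trial_int_pow_derivative finF ts)//.
rewrite !support_intZ// s2 -!EFinM -EFinB; congr (_ - _ * (_ * _))%:E.
by rewrite -s2 -exprM.
Qed.

End TrialEnergy.

(** * Solitons lowered to fit an edge *)

Section Sech.
Variable R : realType.
Implicit Types x y z : R.

Definition sech y : R := 2 / (expR y + expR (- y)).
Definition tanh y : R := (expR y - expR (- y)) / (expR y + expR (- y)).
Definition sqrt_sech y : R := Num.sqrt (sech y).

Let den_gt0 y : 0 < expR y + expR (- y). Proof. by rewrite addr_gt0 ?expR_gt0. Qed.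

Lemma sech_gt0 y : 0 < sech y. Proof. by rewrite divr_gt0. Qed.

Lemma sech_tanh y : sech y ^+ 2 = 1 - tanh y ^+ 2.
Proof.
have h : expR y * expR (- y) = 1 by rewrite expRxMexpNx_1.
rewrite /sech /tanh !exprMn exprVn; have := den_gt0 y.
set a := expR y in h *; set b := expR (- y) in h * => ab.
have -> : 2 ^+ 2 / (a + b) ^+ 2 = 1 - (a - b) ^+ 2 / (a + b) ^+ 2 + (4 - 4 * (a * b)) / (a + b) ^+ 2.
  by field; rewrite gt_eqF.
by rewrite h mulr1 subrr mul0r addr0.
Qed.

Lemma is_derive_expRN y : is_derive y 1 (fun y => expR (- y)) (- expR (- y)).
Proof.
have := @is_derive1_comp _ expR (fun y => - y) y _ _ (is_derive_expR (- y)) (is_deriveN (is_derive_id y (1 : R))).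
by rewrite mulrN1.
Qed.

Lemma is_derive_sech y : is_derive y 1 sech (- (sech y * tanh y)).
Proof.
have n0 : expR y + expR (- y) != 0 by rewrite gt_eqF.
have := is_deriveZ 2 (@is_deriveV _ (fun y => expR y + expR (- y)) y _ 1 n0
  (is_deriveD (is_derive_expR y) (is_derive_expRN y))).
move=> H; apply: is_derive_eq; rewrite /GRing.scale/= /sech /tanh.
by field.
Qed.

Lemma is_derive_tanh y : is_derive y 1 tanh (sech y ^+ 2).
Proof.
have n0 : expR y + expR (- y) != 0 by rewrite gt_eqF.
have := is_deriveM (is_deriveB (is_derive_expR y) (is_derive_expRN y))
  (@is_deriveV _ (fun y => expR y + expR (- y)) y _ 1 n0
    (is_deriveD (is_derive_expR y) (is_derive_expRN y))).
move=> H; apply: is_derive_eq; rewrite sech_tanh /GRing.scale/= /tanh.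
have -> : (expR - (fun z : R => expR (- z))) y = expR y - expR (- y) by [].
by field.
Qed.

Lemma is_derive_sqrt_sech y : is_derive y 1 sqrt_sech (- (2^-1 * (sqrt_sech y * tanh y))).
Proof.
have := @is_derive1_comp _ (@Num.sqrt R) sech y _ _ (is_derive1_sqrt (sech_gt0 y)) (is_derive_sech y).
move=> H; apply: is_derive_eq; rewrite -/(sqrt_sech y).
have h0 : 0 < sqrt_sech y by rewrite sqrtr_gt0 sech_gt0.
have -> : sech y = sqrt_sech y ^+ 2 by rewrite sqr_sqrtr// ltW// sech_gt0.
by field; rewrite gt_eqF.
Qed.

Lemma is_derive_gudermann y : is_derive y 1 (fun y => 2 * atan (expR y)) (sech y).
Proof.
have := is_deriveZ 2 (@is_derive1_comp _ atan expR y _ _ (is_derive1_atan (expR y)) (is_derive_expR y)).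
move=> H; apply: is_derive_eq; rewrite /GRing.scale/= /sech expRN.
have e0 := expR_gt0 y.
by field; rewrite !gt_eqF// ?addr_gt0 ?exprn_gt0.
Qed.

Lemma is_derive_sech_tanh y :
  is_derive y 1 (fun y => sech y * tanh y) (sech y - 2 * (sech y * tanh y ^+ 2)).
Proof.
have := is_deriveM (is_derive_sech y) (is_derive_tanh y).
move=> H; apply: is_derive_eq; rewrite /GRing.scale/= sech_tanh; ring.
Qed.

Lemma sech_mono y z : `|y| <= z -> sech z <= sech y.
Proof.
rewrite ler_norml => /andP[zy yz].
rewrite /sech ler_pM2l// lef_pV2 ?posrE//.
have h1 : expR y <= expR z by rewrite ler_expR.
have h2 : 1 <= expR y * expR z.
  by rewrite -expRD -expR0 ler_expR; lra.
have ey : expR y * expR (- y) = 1 by rewrite expRxMexpNx_1.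
have ez : expR z * expR (- z) = 1 by rewrite expRxMexpNx_1.
have p1 := expR_gt0 (- y); have p2 := expR_gt0 (- z).
have : 0 <= (expR z - expR y) * (expR y * expR z - 1) * (expR (- y) * expR (- z)).
  by rewrite mulr_ge0 ?mulr_ge0 ?subr_ge0// ltW.
rewrite (_ : _ * _ = (expR z - expR y) * ((expR y * expR (- y)) * (expR z * expR (- z)))
   - (expR z * expR (- z) * expR (- y) - expR y * expR (- y) * expR (- z))); last by ring.
rewrite ey ez; lra.
Qed.

Lemma sech_le1 y : sech y <= 1.
Proof.
have -> : 1 = sech 0 by rewrite /sech oppr0 expR0 divff// ?gt_eqF.
have [y0|/ltW y0] := leP 0 y; first by apply: sech_mono; rewrite normr0.
have -> : sech y = sech (- y) by rewrite /sech opprK [expR y + _]addrC.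
by apply: sech_mono; rewrite normr0 oppr_ge0.
Qed.

Lemma sech_small z : 0 <= z -> sech z <= 2 / (1 + z).
Proof.
move=> z0; rewrite /sech ler_pM2l// lef_pV2 ?posrE//; last by rewrite ltr_pwDl.
by rewrite (le_trans (expR_ge1Dx z))// lerDl ltW// expR_gt0.
Qed.

Lemma tanh_ge0 y : 0 <= y -> 0 <= tanh y.
Proof.
by move=> y0; rewrite divr_ge0 ?(ltW (den_gt0 _))// subr_ge0 ler_expR; lra.
Qed.

Lemma tanh_le0 y : y <= 0 -> tanh y <= 0.
Proof.
move=> y0; rewrite -[tanh y]opprK oppr_le0 -mulNr opprB divr_ge0 ?(ltW (den_gt0 _))//.
by rewrite subr_ge0 ler_expR; lra.
Qed.

Lemma sqrt_sech_sqr y : sqrt_sech y ^+ 2 = sech y.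
Proof. by rewrite sqr_sqrtr// ltW// sech_gt0. Qed.

Lemma sqrt_sech_gt0 y : 0 < sqrt_sech y.
Proof. by rewrite sqrtr_gt0 sech_gt0. Qed.

Lemma pow_sub_le x k n : 0 <= k -> k <= x ->
  x ^+ n.+1 - (x - k) ^+ n.+1 <= n.+1%:R * k * x ^+ n.
Proof.
move=> k0 kx; have x0 : 0 <= x by exact: le_trans kx.
elim: n => [|n IH]; first by rewrite !expr1 expr0; lra.
have a0 : 0 <= x - k by rewrite subr_ge0.
have ax : (x - k) ^+ n.+1 <= x ^+ n.+1 by rewrite lerXn2r ?nnegrE// gerBl.
have -> : x ^+ n.+2 - (x - k) ^+ n.+2 = x * (x ^+ n.+1 - (x - k) ^+ n.+1) + k * (x - k) ^+ n.+1.
  by rewrite [x ^+ n.+2]exprS [(x - k) ^+ n.+2]exprS; ring.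
have -> : n.+2%:R * k * x ^+ n.+1 = x * (n.+1%:R * k * x ^+ n) + k * x ^+ n.+1.
  by rewrite -[n.+2%:R]natr1 [x ^+ n.+1]exprS; ring.
by rewrite lerD// ler_wpM2l.
Qed.

Lemma is_derive_rescale (f : R -> R) (k c x d : R) : is_derive (k * (x - c)) 1 f d ->
  is_derive x 1 (fun x => f (k * (x - c))) (d * k).
Proof.
move=> df; have da : is_derive x 1 (fun x : R => k * (x - c)) k.
  have := is_deriveZ k (is_deriveB (is_derive_id x (1 : R)) (is_derive_cst c x (1 : R))).
  by move=> H; apply: is_derive_eq; rewrite subr0 /GRing.scale/= mulr1.
exact: (@is_derive1_comp _ f (fun x => k * (x - c)) x d k df da).
Qed.

Lemma continuous_rescale (f : R -> R) (k c : R) : continuous f ->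
  continuous (fun x => f (k * (x - c))).
Proof.
move=> fc x; apply: (@continuous_comp _ _ _ (fun x => k * (x - c)) f); last exact: fc.
by apply: cvgM; [exact: cvg_cst|apply: cvgB; [exact: cvg_id|exact: cvg_cst]].
Qed.

Lemma sech_continuous : continuous sech.
Proof. by move=> y; apply/differentiable_continuous/derivable1_diffP; case: (is_derive_sech y). Qed.

Lemma tanh_continuous : continuous tanh.
Proof. by move=> y; apply/differentiable_continuous/derivable1_diffP; case: (is_derive_tanh y). Qed.

Lemma sqrt_sech_continuous : continuous sqrt_sech.
Proof. by move=> y; apply/differentiable_continuous/derivable1_diffP; case: (is_derive_sqrt_sech y). Qed.

Variables (l k c d : R).
Hypotheses (l0 : 0 < l) (k0 : 0 < k) (cl : 0 <= c <= l)
  (cd : forall x, 0 <= x <= l -> `|x - c| <= d).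

(** The rescaled soliton centred at [c], lowered so as to vanish at distance [d]
    from [c]. *)
Definition bump x : R := Num.sqrt k * (sqrt_sech (k * (x - c)) - sqrt_sech (k * d)).
Definition bump' x : R :=
  Num.sqrt k * (- (2^-1 * (sqrt_sech (k * (x - c)) * tanh (k * (x - c)))) * k).

Lemma is_derive_bump x : is_derive x 1 bump (bump' x).
Proof.
have := is_deriveZ (Num.sqrt k) (is_deriveB
  (@is_derive_rescale sqrt_sech k c x _ (is_derive_sqrt_sech (k * (x - c))))
  (is_derive_cst (sqrt_sech (k * d)) x (1 : R))).
by move=> H; apply: is_derive_eq; rewrite subr0.
Qed.

Lemma bump'_continuous : continuous bump'.
Proof.
move=> x; apply: cvgM; first exact: cvg_cst.
apply: cvgM; last exact: cvg_cst.
apply: cvgN; apply: cvgM; first exact: cvg_cst.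
apply: cvgM; first exact: (@continuous_rescale sqrt_sech k c (@sqrt_sech_continuous)).
exact: (@continuous_rescale tanh k c (@tanh_continuous)).
Qed.

Definition bump_mass_bound := 2 * atan (expR (k * (l - c))) - 2 * atan (expR (k * (0 - c))).

Let bump_continuous : continuous bump.
Proof. by move=> y; apply/differentiable_continuous/derivable1_diffP; case: (is_derive_bump y). Qed.

Let p1 x := sech (k * (x - c)) * k.
Let p2 x := (sech (k * (x - c)) - 2 * (sech (k * (x - c)) * tanh (k * (x - c)) ^+ 2)) * k.

Let p1c : continuous p1.
Proof.
move=> x; apply: cvgM; last exact: cvg_cst.
exact: (@continuous_rescale sech k c (@sech_continuous)).
Qed.

Let p2c : continuous p2.
Proof.
move=> x; apply: cvgM; last exact: cvg_cst.
apply: cvgB; first exact: (@continuous_rescale sech k c (@sech_continuous)).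
apply: cvgM; first exact: cvg_cst.
apply: cvgM; first exact: (@continuous_rescale sech k c (@sech_continuous)).
by apply: cvgM; exact: (@continuous_rescale tanh k c (@tanh_continuous)).
Qed.

Let int_p1 : seg_int 0 l p1 = bump_mass_bound.
Proof.
have H x := @is_derive_rescale _ k c x _ (is_derive_gudermann (k * (x - c))).
exact: (seg_int_FTC (ltW l0) H p1c).
Qed.

Let int_p2 : 0 <= seg_int 0 l p2.
Proof.
have H x := @is_derive_rescale _ k c x _ (is_derive_sech_tanh (k * (x - c))).
rewrite (seg_int_FTC (ltW l0) H p2c); case/andP: cl => c0 lc.
have h1 : 0 <= tanh (k * (l - c)) by apply: tanh_ge0; rewrite mulr_ge0 ?subr_ge0// ltW.
have h2 : tanh (k * (0 - c)) <= 0 by apply: tanh_le0; rewrite pmulr_rle0// sub0r oppr_le0.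
have s1 := sech_gt0 (k * (l - c)); have s2 := sech_gt0 (k * (0 - c)).
have := mulr_ge0 (ltW s1) h1; have := mulr_ge0_le0 (ltW s2) h2; lra.
Qed.

Let sk2 : Num.sqrt k ^+ 2 = k. Proof. by rewrite sqr_sqrtr// ltW. Qed.

(** The soliton equation turns the kinetic energy and the sixth power of the
    soliton into the mass plus boundary terms of sech tanh, whose total has the
    favourable sign as [c] lies in the segment. By Bernoulli's inequality,
    lowering the soliton by [kappa] costs at most [6 * kappa] times the mass in
    the sixth power. *)
Lemma bump_bounds (kappa := sqrt_sech (k * d)) :
  let M := seg_int 0 l (fun x => `|bump x| ^+ 2) in
  [/\ M <= bump_mass_bound, 0 < bump_mass_bound,
    seg_int 0 l (fun x => `|bump' x| ^+ 2) <= k ^+ 2 / 8 * bump_mass_bound,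
    k ^+ 2 * (2^-1 - 6 * kappa) * bump_mass_bound <= seg_int 0 l (fun x => `|bump x| ^+ 6) &
    seg_int 0 l (fun x => `|bump x| ^+ 6) <= k ^+ 2 * M].
Proof.
have kap0 : 0 < kappa by exact: sqrt_sech_gt0.
have kapx x : 0 <= x <= l -> kappa <= sqrt_sech (k * (x - c)).
  move=> xl; rewrite ler_wsqrtr// sech_mono// normrM gtr0_norm// ler_wpM2l ?(ltW k0)//.
  exact: cd.
have i1 : seg_integrable 0 l p1 by exact: continuous_seg_integrableT.
have i2 : seg_integrable 0 l p2 by exact: continuous_seg_integrableT.
have ib n : seg_integrable 0 l (fun x => `|bump x| ^+ n).
  by apply: continuous_seg_integrableT; exact: continuousX.
have b2 x : `|bump x| ^+ 2 = k * (sqrt_sech (k * (x - c)) - kappa) ^+ 2.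
  by rewrite real_normK ?num_real// exprMn sk2.
have b6 x : `|bump x| ^+ 6 = (`|bump x| ^+ 2) ^+ 3 by rewrite -exprM.
have le2 x : 0 <= x <= l -> `|bump x| ^+ 2 <= p1 x.
  move=> /kapx h; rewrite b2 /p1 mulrC -sqrt_sech_sqr ler_wpM2r ?(ltW k0)//.
  by rewrite lerXn2r ?nnegrE ?subr_ge0// ?(ltW (sqrt_sech_gt0 _))// gerBl ltW.
split.
- by rewrite -int_p1; apply: le_seg_int.
- rewrite -int_p1; apply: (@lt_le_trans _ _ (seg_int 0 l (cst (sech (k * d) * k)))).
    rewrite (seg_int_cst (sech (k * d) * k) (ltW l0)) subr0.
    by apply: mulr_gt0 => //; apply: mulr_gt0 => //; exact: sech_gt0.
  apply: le_seg_int => //; first exact: seg_integrable_cst.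
  move=> x xl /=; rewrite /p1 ler_wpM2r ?(ltW k0)// sech_mono// normrM gtr0_norm//.
  by rewrite ler_wpM2l ?(ltW k0)// cd.
- have -> : seg_int 0 l (fun x => `|bump' x| ^+ 2) =
      k ^+ 2 / 8 * (seg_int 0 l p1 - seg_int 0 l p2).
    rewrite -(seg_intB i1 i2) -(seg_intZ _ (seg_integrableB i1 i2)).
    apply: eq_seg_int => x _; rewrite real_normK ?num_real// /bump' exprMn sk2.
    rewrite /p1 /p2 -sqrt_sech_sqr; set a := sqrt_sech _; set b := tanh _.
    by field.
  rewrite int_p1 ler_wpM2l ?divr_ge0 ?sqr_ge0// gerBl//.
- have [j1 j2] := (seg_integrableZ (k ^+ 2 * (2^-1 - 6 * kappa)) i1, seg_integrableZ (k ^+ 2 / 2) i2).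
  apply: (@le_trans _ _ (seg_int 0 l (fun x => k ^+ 2 * (2^-1 - 6 * kappa) * p1 x + k ^+ 2 / 2 * p2 x))).
    rewrite (seg_intD j1 j2) (seg_intZ _ i1) (seg_intZ _ i2) int_p1 lerDl mulr_ge0//.
    by rewrite divr_ge0// sqr_ge0.
  apply: le_seg_int; [exact: seg_integrableD|exact: ib|move=> x /kapx h].
  rewrite b6 b2 exprMn -exprM.
  have := pow_sub_le 5 (ltW kap0) h.
  set y := sqrt_sech _ in h *; move=> bern.
  have y0 : 0 < y by exact: sqrt_sech_gt0.
  have y1 : y <= 1 by rewrite -[leRHS]sqrtr1 ler_wsqrtr// sech_le1.
  have y52 : y ^+ 5 <= y ^+ 2 by rewrite ler_wiXn2l// ltW.
  have S1 : sech (k * (x - c)) = y ^+ 2 by rewrite sqrt_sech_sqr.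
  have S3 : sech (k * (x - c)) - sech (k * (x - c)) * tanh (k * (x - c)) ^+ 2 = y ^+ 6.
    rewrite (_ : y ^+ 6 = (y ^+ 2) ^+ 3); last by rewrite -exprM.
    by rewrite -S1 [RHS]exprS sech_tanh; ring.
  have -> : k ^+ 2 * (2^-1 - 6 * kappa) * p1 x + k ^+ 2 / 2 * p2 x =
      k ^+ 3 * (y ^+ 6 - 6 * kappa * y ^+ 2).
    by rewrite -S3 -S1 /p1 /p2; field.
  rewrite ler_wpM2l ?exprn_ge0 ?(ltW k0)//.
  have := ler_wpM2l (ltW kap0) y52; lra.
- rewrite -(seg_intZ _ (ib 2)); apply: le_seg_int; [exact: ib|exact: seg_integrableZ|].
  move=> x xl; rewrite b6 exprSr ler_wpM2r ?exprn_ge0// lerXn2r ?nnegrE ?exprn_ge0// ?(ltW k0)//.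
  rewrite (le_trans (le2 x xl))// /p1 -[leRHS]mul1r ler_wpM2r ?(ltW k0)// sech_le1//.
Qed.

End Sech.

(** * Trial functions concentrating on one edge *)

Section Concentration.
Variables (R : realType) (G : metric_graph R) (e0 : edge G).
Local Notation l := (elen e0).
Variables (c d q : R).
Hypotheses (d0 : 0 < d) (cl : 0 <= c <= l) (q0 : 0 < q).
Hypothesis cd : forall x, 0 <= x <= l -> `|x - c| <= d.
Hypothesis bump_trace : forall k, 0 < k -> exists W : vertex G -> R, forall e,
  (if e == e0 then bump k c d 0 else 0) = W (esrc e) /\
  (if e == e0 then bump k c d l else 0) = W (etgt e).
Hypothesis mass_bound : forall k, 0 < k -> bump_mass_bound l k c <= q.

(** With a bump of scale [k] the energy is at most [k ^+ 2] times a constant which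
    is negative as soon as [kappa], the constant subtracted from the soliton, is
    small compared with the gap between the two masses; and [kappa] tends to 0 as
    [k] grows. *)
Lemma concentrated_energy m A : Num.sqrt 3 / 2 * q < m ->
  exists2 v : graph_fun G, H1_mass m v & (energy v <= A%:E)%E.
Proof.
set th := Num.sqrt 3 / 2 * q => thm.
have th0 : 0 < th by rewrite mulr_gt0// divr_gt0// sqrtr_gt0.
have m0 : 0 < m by exact: lt_trans thm.
have th2 : th ^+ 2 = 3 / 4 * q ^+ 2.
  by rewrite exprMn exprMn sqr_sqrtr// expr2; field.
have g0 : 0 < m ^+ 2 - th ^+ 2 by rewrite subr_gt0 ltrXn2r// ltW.
set g := m ^+ 2 - th ^+ 2 in g0.
(* With kappa at most [de], the factor 1 - 12 kappa in the sixth power costs at most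
   half of the gap [g]. *)
pose de := g / (24 * m ^+ 2).
have de0 : 0 < de by rewrite divr_gt0// mulr_gt0// exprn_gt0.
have dele : 24 * de <= 1.
  rewrite /de (_ : 24 * _ = g / m ^+ 2); last by field; rewrite gt_eqF.
  by rewrite ler_pdivrMr ?exprn_gt0// mul1r /g gerBl exprn_ge0// ltW.
(* The scale is at least [a1] to make kappa at most [de], and at least [a2] to bring
   the energy below [A]. *)
pose a1 := 2 / (d * de ^+ 2); pose a2 := `|A| * (24 * q ^+ 2) / (m * g).
have a10 : 0 <= a1 by rewrite divr_ge0// mulr_ge0 ?exprn_ge0// ltW.
have a20 : 0 <= a2.
  by rewrite divr_ge0// ?mulr_ge0 ?exprn_ge0// ltW.
pose k := 1 + a1 + a2.
have k1 : 1 <= k by rewrite /k -addrA lerDl addr_ge0.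
have k0 : 0 < k by exact: lt_le_trans k1.
have kap : sqrt_sech (k * d) <= de.
  rewrite -(@ler_pXn2r _ 2) ?nnegrE ?(ltW (sqrt_sech_gt0 _)) ?(ltW de0)//.
  rewrite sqrt_sech_sqr (le_trans (sech_small _))//; first by rewrite mulr_ge0// ltW.
  rewrite ler_pdivrMr; last by rewrite addr_gt0// mulr_gt0.
  have : de ^+ 2 * (a1 * d) <= de ^+ 2 * (1 + k * d).
    rewrite ler_wpM2l ?exprn_ge0 ?(ltW de0)// (@le_trans _ _ (k * d))//.
      by rewrite ler_wpM2r ?(ltW d0)// /k; lra.
    by rewrite lerDr.
  apply: le_trans; rewrite /a1 (_ : _ * _ = 2) ?lexx//.
  by field; rewrite !gt_eqF.
have [MP P0 DP SP SM] := bump_bounds (elen_gt0 e0) k0 cl cd.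
have Pq := mass_bound k0.
set P := bump_mass_bound _ _ _ in MP P0 DP SP Pq.
set kp := sqrt_sech _ in kap SP.
have [W trW] := bump_trace k0.
pose u : graph_fun G := fun e x => if e == e0 then bump k c d x else 0.
pose u' : graph_fun G := fun e x => if e == e0 then bump' k c x else 0.
have tu : trial [set e0] u u' W.
  rewrite /u /u'; split => [e x|e|e|e ne x].
  - by case: eqP => _; [exact: is_derive_bump|exact: is_derive_cst].
  - by case: eqP => _; [exact: bump'_continuous|exact: cst_continuous].
  - by case: (trW e); case: (eqVneq e e0) => // ->.
  - by case: (eqVneq e e0) ne => [->/(_ erefl)|].
have supE p (w : graph_fun G) : support_int [set e0] p w = seg_int 0 l (fun x => `|w e0 x| ^+ p).
  by rewrite /support_int fsbig_set1.
have M0 : 0 < support_int [set e0] 2 u.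
  rewrite supE /u eqxx -(@pmulr_rgt0 _ (k ^+ 2)) ?exprn_gt0//.
  apply: lt_le_trans SM; apply: lt_le_trans SP.
  by rewrite mulr_gt0// mulr_gt0 ?exprn_gt0//; lra.
have [v vm vE] := trial_energy (finite_set1 e0) tu m0 M0.
exists v => //; rewrite vE lee_fin; move: M0; rewrite !supE /u /u' eqxx.
set M := seg_int _ _ _ in MP SM *; set D := seg_int _ _ _ in DP *.
set S := seg_int _ _ _ in SP SM * => M0.
pose x := m / M.
have x0 : 0 < x by rewrite divr_gt0.
have xq : m / q <= x by rewrite ler_pM2l// lef_pV2 ?posrE// (le_trans MP).
have xP : m <= x * P by rewrite /x -mulrAC ler_pdivlMr// ler_wpM2l// ltW.
have x2 : (m / q) ^+ 2 <= x ^+ 2 by rewrite lerXn2r// nnegrE ltW// divr_gt0.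
have k2 : 0 < k ^+ 2 by rewrite exprn_gt0.
apply: (@le_trans _ _ (x * k ^+ 2 * P * (16^-1 - x ^+ 2 * (1 - 12 * kp) / 12))).
  have h1 := ler_wpM2l (ltW x0) DP.
  have h2 : x ^+ 3 * (k ^+ 2 * (2^-1 - 6 * kp) * P) <= x ^+ 3 * S.
    by rewrite ler_wpM2l// exprn_ge0// ltW.
  rewrite -/x (_ : _ * (_ - _) = 2^-1 * (x * (k ^+ 2 / 8 * P)) - 6^-1 * (x ^+ 3 * (k ^+ 2 * (2^-1 - 6 * kp) * P))); last by field.
  by lra.
have br : 16^-1 - x ^+ 2 * (1 - 12 * kp) / 12 <= - (g / (24 * q ^+ 2)).
  have kp1 : 0 <= 1 - 12 * kp by lra.
  have h := ler_wpM2r kp1 x2.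
  have h3 : 12 * kp * m ^+ 2 <= g / 2.
    have -> : g / 2 = 12 * de * m ^+ 2 by rewrite /de; field; rewrite gt_eqF.
    by rewrite ler_wpM2r ?exprn_ge0 ?(ltW m0)// ler_wpM2l.
  have h4 : 16^-1 - (m / q) ^+ 2 * (1 - 12 * kp) / 12 =
      (th ^+ 2 - m ^+ 2 + 12 * kp * m ^+ 2) / (12 * q ^+ 2).
    by rewrite th2; field; rewrite gt_eqF.
  apply: (@le_trans _ _ (16^-1 - (m / q) ^+ 2 * (1 - 12 * kp) / 12)); first by lra.
  rewrite h4 (_ : - (g / _) = (- (g / 2)) / (12 * q ^+ 2)); last by field; rewrite gt_eqF.
  rewrite ler_pM2r ?invr_gt0 ?mulr_gt0 ?exprn_gt0//.
  by rewrite /g in h3 *; lra.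
have q2 : 0 < q ^+ 2 by rewrite exprn_gt0.
apply: (@le_trans _ _ (x * k ^+ 2 * P * - (g / (24 * q ^+ 2)))).
  apply: ler_wpM2l br; apply/ltW; apply: mulr_gt0 => //; exact: mulr_gt0.
rewrite mulrN lerNl (le_trans (ler_norm _))// normrN.
have -> : `|A| = m * a2 * (g / (24 * q ^+ 2)).
  by rewrite /a2; field; rewrite !gt_eqF.
apply: ler_wpM2r; first by apply/ltW/divr_gt0 => //; apply: mulr_gt0.
apply: (@le_trans _ _ (m * k ^+ 2)); last first.
  by rewrite [leRHS]mulrAC; apply: ler_wpM2r xP; exact: ltW.
rewrite ler_wpM2l ?(ltW m0)// (@le_trans _ _ k)//; first by rewrite /k; lra.
by rewrite expr2 ler_peMr// ltW.
Qed.

End Concentration.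

Section ConcentrationAtVertices.
Variables (R : realType) (G : metric_graph R).

Lemma bump_end k c d (x : R) : `|x - c| = d -> 0 < k -> bump k c d x = 0.
Proof.
move=> xd k0; rewrite /bump -xd.
have -> : sqrt_sech (k * `|x - c|) = sqrt_sech (k * (x - c)).
  rewrite /sqrt_sech; congr Num.sqrt; case: (ger0P (x - c)) => // _.
  by rewrite mulrN /sech opprK [_ + expR _]addrC.
by rewrite subrr mulr0.
Qed.

Lemma atan_expR_bounds (y : R) : 0 <= atan (expR y) <= pi / 2.
Proof.
by rewrite (ltW (atan_ltpi2 _)) andbT -atan0 le_atan// expR_ge0.
Qed.

(** A whole soliton fits inside any edge. *)
Lemma concentrated_inside (e0 : edge G) m A : Num.sqrt 3 / 2 * pi < m ->
  exists2 v : graph_fun G, H1_mass m v & (energy v <= A%:E)%E.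
Proof.
have l0 := elen_gt0 e0.
move=> hm; apply: (@concentrated_energy _ _ e0 (elen e0 / 2) (elen e0 / 2) pi) => //.
- by rewrite divr_gt0.
- by apply/andP; split; lra.
- exact: pi_gt0.
- by move=> x /andP[x0 xl]; rewrite ler_norml; apply/andP; split; lra.
- move=> k k0; exists (fun=> 0) => e; case: eqP => // _.
  split; apply: bump_end => //.
    by rewrite sub0r normrN ger0_norm// divr_ge0// ltW.
  by rewrite (_ : elen e0 - _ = elen e0 / 2) ?ger0_norm ?divr_ge0 ?(ltW l0)//; field.
- move=> k k0; rewrite /bump_mass_bound.
  have /andP[a1 a2] := atan_expR_bounds (k * (elen e0 - elen e0 / 2)).
  have /andP[b1 b2] := atan_expR_bounds (k * (0 - elen e0 / 2)).
  lra.
Qed.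

Hypothesis finite_ends : forall v : vertex G, finite_set (edge_ends v).

(** At a terminal vertex, half a soliton suffices. *)
Lemma concentrated_at_tip (e0 : edge G) m A : terminal_edge e0 ->
  Num.sqrt 3 / 2 * (pi / 2) < m ->
  exists2 v : graph_fun G, H1_mass m v & (energy v <= A%:E)%E.
Proof.
have l0 := elen_gt0 e0.
case=> tip [ends deg1] hm.
have [b tipb] : exists b, (if b then etgt e0 else esrc e0) = tip.
  by case: ends => h; [exists false|exists true].
have tipE (e : edge G) b' : (if b' then etgt e else esrc e) = tip -> e = e0 /\ b' = b.
  move=> h; have [z zE] : exists z, fset_set (edge_ends tip) = [fset z]%fset.
    by apply/cardfs1P; rewrite -deg1.
  have in1 : (e, b') \in fset_set (edge_ends tip).
    by rewrite in_fset_set// inE.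
  have in2 : (e0, b) \in fset_set (edge_ends tip).
    by rewrite in_fset_set// inE.
  move: in1 in2; rewrite zE !inE => /eqP ez /eqP; rewrite -ez => -[-> ->].
  by [].
apply: (@concentrated_energy _ _ e0 (if b then elen e0 else 0) (elen e0) (pi / 2)) => //.
- by case: (b); rewrite ?lexx ?andbT ltW.
- by rewrite divr_gt0// pi_gt0.
- by move=> x /andP[x0 xl]; case: (b); rewrite ler_norml; apply/andP; split; lra.
- move=> k k0; set c := (if b then _ else _).
  exists (fun v => if v == tip then bump k c (elen e0) c else 0) => e.
  have key b' : (if e == e0 then bump k c (elen e0) (if b' then elen e0 else 0) else 0) =
      if (if b' then etgt e else esrc e) == tip then bump k c (elen e0) c else 0.
    case: eqVneq => [->|ne].
      have [/tipE[_ ->]//|nt] := eqVneq (if b' then etgt e0 else esrc e0) tip.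
      have bb' : b' = ~~ b.
        by case: (b') (b) tipb nt => [] [] //= ->; rewrite eqxx.
      apply: bump_end => //; rewrite bb' /c; case: (b) => /=.
        by rewrite sub0r normrN ger0_norm// ltW.
      by rewrite subr0 ger0_norm// ltW.
    by case: eqP => // /tipE[ee0]; rewrite ee0 eqxx in ne.
  by split; [exact: (key false)|exact: (key true)].
- move=> k k0; rewrite /bump_mass_bound.
  have a0 : atan (expR 0) = pi / 4 :> R by rewrite expR0 atan1.
  have /andP[a1 a2] := atan_expR_bounds (k * elen e0).
  have /andP[b1 b2] := atan_expR_bounds (k * (0 - elen e0)).
  by case: (b); rewrite subrr mulr0 a0 ?subr0; lra.
Qed.

End ConcentrationAtVertices.

(** * Trial functions spreading over many cells *)

Section Spreading.
Variables (R : realType) (K : periodicity_cell R).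
Local Notation G := (periodic_graph K).

Definition tent (N : nat) (i : int) : R := Num.max 0 (1 - `|i%:~R| / N%:R).

Lemma tent_lipschitz N i : (0 < N)%N -> `|tent N i - tent N (i + 1)| <= N%:R^-1.
Proof.
move=> N0; have n0 : (0 : R) < N%:R by rewrite ltr0n.
have -> : tent N i - tent N (i + 1) =
  Num.max 0 (1 - `|i%:~R| / N%:R) - Num.max 0 (1 - `|i%:~R + 1| / N%:R).
  by rewrite /tent intrD.
have addN1 (x : R) : x / N%:R + N%:R^-1 = (x + 1) / N%:R by rewrite mulrDl mul1r.
have h1 : `|i%:~R + 1| / N%:R <= `|i%:~R| / N%:R + N%:R^-1 :> R.
  rewrite addN1 ler_pM2r ?invr_gt0//.
  by rewrite (le_trans (ler_normD _ _))// normr1.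
have h2 : `|i%:~R| / N%:R <= `|i%:~R + 1| / N%:R + N%:R^-1 :> R.
  rewrite addN1 ler_pM2r ?invr_gt0//.
  by rewrite -{1}[i%:~R](addrK 1) (le_trans (ler_normB _ _))// normr1.
have p0 : 0 < N%:R^-1 :> R by rewrite invr_gt0.
move: h1 h2; set a := _ / _; set b := _ / _ => h1 h2.
rewrite ler_norml; case: (leP 0 (1 - b)) => ?; case: (leP 0 (1 - a)) => ?; lra.
Qed.

Lemma tent_far N (i : int) : (0 < N)%N -> N%:Z <= `|i| -> tent N i = 0.
Proof.
move=> N0 Ni; rewrite /tent max_l// subr_le0 ler_pdivlMr ?ltr0n// mul1r.
by rewrite -intr_norm -[N%:R]/(N%:Z%:~R) ler_int.
Qed.

Lemma tent_near N i : (2 <= N)%N -> `|i| <= 1 -> 2^-1 <= tent N i.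
Proof.
move=> N2 i1; rewrite /tent le_max; apply/orP; right.
have h : `|i%:~R| <= 1 :> R by rewrite -intr_norm -[1]/(1%:~R) ler_int.
have n2 : 2 <= N%:R :> R by rewrite ler_nat.
have n0 : 0 < N%:R :> R by exact: lt_le_trans n2.
have : `|i%:~R| / N%:R <= 2^-1 :> R by rewrite ler_pdivrMr//; lra.
by lra.
Qed.

(** A pasting vertex belongs to two consecutive cells: it takes the height of
    the later one. *)
Definition spread_height N (x : int * vertex (cell K)) : R :=
  tent N (if x.2 \in dset K then x.1 + 1 else x.1).

Definition spread_trace N (v : vertex G) : R := spread_height N (repr v).

Lemma spread_trace_cell N i x : spread_trace N (cell_vertex i x) = spread_height N (i, x).
Proof.
have paste a b : pasted a b -> @spread_height N a = spread_height N b.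
  move=> ab; have /pastedP[aD bE] := ab; rewrite /spread_height mem_set//.
  have -> : (b.2 \in dset K) = false.
    apply/negP => /set_mem bD; apply: (@pasted2F R K a b (b.1 + 1, pasting K b.2)) => //.
    exact/pastedP.
  by rewrite bE.
have : @paste_rel R K (repr (cell_vertex i x : vertex G)) (i, x).
  by apply/(@eqquotP _ _ (@periodic_vertex R K)); rewrite reprK.
by rewrite /spread_trace => /or3P[/eqP->|/paste|/paste].
Qed.

Definition spread_slope N (e : edge G) : R :=
  (spread_trace N (etgt e) - spread_trace N (esrc e)) / elen e.

Definition spread_fun N : graph_fun G :=
  fun e x => spread_trace N (esrc e) + spread_slope N e * x.

Definition spread_support (N : nat) := [set e : edge G | - N%:Z <= e.1 <= N%:Z].

Lemma spread_trial N : (0 < N)%N ->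
  trial (spread_support N) (spread_fun N) (fun e => cst (spread_slope N e)) (spread_trace N).
Proof.
move=> N0; split.
- move=> e x.
  have := is_deriveD (is_derive_cst (spread_trace N (esrc e)) x (1 : R))
    (is_deriveZ (spread_slope N e) (is_derive_id x (1 : R))).
  by move=> H; apply: is_derive_eq; rewrite add0r /GRing.scale/= mulr1.
- by move=> e; exact: cst_continuous.
- move=> e; rewrite /spread_fun /spread_slope mulr0 addr0 divfK ?gt_eqF ?elen_gt0//.
  by split=> //; rewrite addrC subrK.
- move=> e /= far x.
  have z y : spread_trace N (cell_vertex e.1 y) = 0.
    rewrite spread_trace_cell /spread_height /= tent_far//.
    move: far; case: e => i e /= /negP; rewrite negb_and -!ltNge => /= far.
    by case: ifP => _; lia.
  by rewrite /spread_fun /spread_slope esrc_cell etgt_cell !z subrr mul0r add0r mul0r.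
Qed.

Lemma spread_slope_le N (e : edge G) : (0 < N)%N ->
  `|spread_slope N e| <= N%:R^-1 / elen e.
Proof.
move=> N0; rewrite normrM normfV (gtr0_norm (elen_gt0 e)) ler_pM2r ?invr_gt0 ?elen_gt0//.
rewrite esrc_cell etgt_cell !spread_trace_cell /spread_height /=.
have := tent_lipschitz e.1 N0.
by case: ifP => _; case: ifP => _; rewrite ?subrr ?normr0 ?invr_ge0// distrC.
Qed.

Lemma spread_fun_ge N (e : edge G) (x : R) : (2 <= N)%N -> e.1 = 0 -> 0 <= x <= elen e ->
  2^-1 <= spread_fun N e x.
Proof.
move=> N2 e0 /andP[x0 xl]; rewrite /spread_fun /spread_slope.
have h y : 2^-1 <= spread_trace N (cell_vertex e.1 y).
  by rewrite spread_trace_cell /spread_height /= tent_near// e0; case: ifP.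
have := h (esrc e.2); have := h (etgt e.2); rewrite -esrc_cell -etgt_cell.
set a := spread_trace N (esrc e); set b := spread_trace N (etgt e) => hb ha.
have l0 := elen_gt0 e.
have t0 : 0 <= x / elen e by rewrite divr_ge0// ltW.
have t1 : x / elen e <= 1 by rewrite ler_pdivrMr// mul1r.
have -> : a + (b - a) / elen e * x = a + (b - a) * (x / elen e).
  by rewrite -mulrA [_^-1 * x]mulrC.
move: t0 t1; set t := x / elen e => t0 t1.
have : 0 <= (b - 2^-1) * t by rewrite mulr_ge0// subr_ge0.
have : 0 <= (a - 2^-1) * (1 - t) by rewrite mulr_ge0// subr_ge0.
lra.
Qed.

Lemma spread_support_card N :
  (#|` fset_set (spread_support N)| <=
    (N + N).+1 * #|` fset_set [set: edge (cell K)]|)%N.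
Proof.
have finE : finite_set [set: edge (cell K)] by case: (cell_compact K).
set E := fset_set [set: edge (cell K)]; pose s := [seq ((k%:Z - N%:Z, e) : edge G) | k <- iota 0 (N + N).+1, e <- E].
have -> : ((N + N).+1 * #|` E|)%N = size s by rewrite size_allpairs size_iota.
apply: uniq_leq_size; first exact: fset_uniq.
move=> [i e]; rewrite in_fset_set; last exact: finite_index_edges.
rewrite inE/= => iN; apply/allpairsP; exists (absz (i + N%:Z), e) => /=; split.
- by rewrite -[_ :: _]/(iota 0 (N + N).+1) mem_iota; move: iN; rewrite /spread_support/=; lia.
- by rewrite in_fset_set// inE.
- by congr (_, _); move: iN; rewrite /spread_support/=; lia.
Qed.

(** Spreading a fixed mass over [N] cells costs a kinetic energy of order
    [1 / N]. *)
Lemma spread_energy m eps : 0 < m -> 0 < eps ->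
  exists2 v : graph_fun G, H1_mass m v & (energy v <= eps%:E)%E.
Proof.
move=> m0 eps0; have [lmin [lmax [lmin0 len]]] := periodic_elen_bounds K.
have [e'] := cell_has_edge K; pose e0 : edge G := (0, e').
pose n : R := #|` fset_set [set: edge (cell K)]|%:R.
pose C := 6 * m * n / lmin ^+ 2.
have C0 : 0 <= C.
  apply: divr_ge0; last exact: sqr_ge0.
  by apply: mulr_ge0; rewrite ?ler0n//; apply: mulr_ge0 => //; exact: ltW.
pose N := (Num.truncn (C / eps)).+2.
have NC : C / eps <= N%:R.
  by rewrite ltW// (lt_le_trans (truncnS_gt _))// ler_nat.
have N2 : (2 <= N)%N by [].
have N0 : (0 < N)%N by [].
have n0 : (0 : R) < N%:R by rewrite ltr0n.
have finF : finite_set (spread_support N) by exact: finite_index_edges.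
have tu := spread_trial N0.
have uc e : continuous (spread_fun N e).
  case: tu => du _ _ _ x.
  by apply/differentiable_continuous/derivable1_diffP; case: (du e x).
have pos p (w : graph_fun G) e : 0 <= seg_int 0 (elen e) (fun x => `|w e x| ^+ p).
  by apply: seg_int_ge0 => x _; rewrite exprn_ge0.
have mass : lmin / 4 <= support_int (spread_support N) 2 (spread_fun N).
  have e0F : e0 \in fset_set (spread_support N).
    rewrite in_fset_set// inE; change (- N%:Z <= (0 : int) <= N%:Z); lia.
  rewrite /support_int fsbig_finite//= (bigD1_seq e0 e0F (fset_uniq _))/=.
  apply: (@le_trans _ _ (seg_int 0 (elen e0) (cst 4^-1))).
    rewrite (seg_int_cst _ (ltW (elen_gt0 e0))) subr0 mulrC ler_pM2l ?invr_gt0//.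
    by case/andP: (len e0).
  rewrite -[leLHS]addr0 lerD//; last by apply: sumr_ge0 => i _; exact: (pos 2%N (spread_fun N) i).
  apply: le_seg_int.
  - exact: seg_integrable_cst.
  - by apply: continuous_seg_integrableT; apply: continuousX; exact: uc.
  - move=> x xl /=; have h := @spread_fun_ge N e0 x N2 erefl xl.
    rewrite ger0_norm; last by rewrite (le_trans _ h).
    rewrite (_ : 4^-1 = 2^-1 ^+ 2); last by field.
    by rewrite lerXn2r ?nnegrE// (le_trans _ h).
have M0 : 0 < support_int (spread_support N) 2 (spread_fun N).
  by apply: lt_le_trans mass; rewrite divr_gt0.
have kin : support_int (spread_support N) 2 (fun e => cst (spread_slope N e)) <=
    3 * n / (lmin * N%:R).
  rewrite /support_int fsbig_finite//=.
  apply: (@le_trans _ _ (\sum_(e <- fset_set (spread_support N)) (N%:R ^- 2 / lmin))).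
    apply: ler_sum => i _; pose e : edge G := i.
    rewrite (seg_int_cst (`|spread_slope N e| ^+ 2) (ltW (elen_gt0 e))) subr0.
    have le := elen_gt0 e; have /andP[l1 _] := len e.
    apply: (@le_trans _ _ ((N%:R^-1 / elen e) ^+ 2 * elen e)).
      rewrite ler_pM2r// lerXn2r ?nnegrE// ?spread_slope_le//.
      by rewrite divr_ge0// ?invr_ge0 ltW.
    rewrite (_ : _ * _ = N%:R ^- 2 / elen e); last by field; rewrite !gt_eqF.
    by rewrite ler_pM2l ?lef_pV2 ?posrE// invr_gt0 exprn_gt0.
  rewrite big_const_seq count_predT iter_addr_0 -[leLHS]mulr_natr.
  have card : (#|` fset_set (spread_support N)|)%:R <= 3 * N%:R * n.
    apply: (@le_trans _ _ (((N + N).+1 * #|` fset_set [set: edge (cell K)]|)%N%:R)).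
      by rewrite ler_nat spread_support_card.
    rewrite natrM ler_wpM2r ?ler0n// -natr1 natrD.
    have : 1 <= N%:R :> R by rewrite ler1n.
    by lra.
  apply: (@le_trans _ _ (N%:R ^- 2 / lmin * (3 * N%:R * n))).
    by rewrite ler_wpM2l// divr_ge0 ?invr_ge0 ?exprn_ge0 ?(ltW lmin0) ?ler0n.
  by rewrite le_eqVlt; apply/orP; left; apply/eqP; field; rewrite !gt_eqF.
have [v vm vE] := trial_energy finF tu m0 M0.
exists v => //; rewrite vE lee_fin.
move: M0 mass kin; set M := support_int _ 2 _; set D := support_int _ 2 _ => M0 mass kin.
have S0 : 0 <= support_int (spread_support N) 6 (spread_fun N).
  exact: support_int_ge0.
apply: (@le_trans _ _ (2^-1 * (m / M * D))).
  by rewrite gerBl mulr_ge0// mulr_ge0// exprn_ge0// divr_ge0// ltW.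
have D0 : 0 <= D by exact: support_int_ge0.
apply: (@le_trans _ _ (2^-1 * (m / (lmin / 4) * (3 * n / (lmin * N%:R))))).
  rewrite ler_wpM2l// ler_pM//; first by rewrite divr_ge0 ?ltW.
  by rewrite ler_pM2l// lef_pV2// posrE divr_gt0.
have simp (a b c r : R) : b != 0 -> r != 0 ->
    2^-1 * (a / (b / 4) * (3 * c / (b * r))) = 6 * a * c / b ^+ 2 / r.
  by move=> b0 r0; field; rewrite ?b0 ?r0.
rewrite simp ?gt_eqF// -/C.
by rewrite ler_pdivrMr// mulrC -ler_pdivrMr.
Qed.

End Spreading.

(** * Ground energies and critical mass *)

Lemma int_pow_ge0 (R : realType) (G : metric_graph R) p (u : graph_fun G) :
  (0 <= int_pow p u)%E.
Proof.
apply: esum_ge0 => e _; apply: integral_ge0 => x _.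
by rewrite lee_fin exprn_ge0.
Qed.

Section Dichotomy.
Variables (R : realType) (G : metric_graph R) (mc : R).
Hypothesis mc0 : 0 < mc.
Hypothesis sharp : forall (u : graph_fun G) m, H1 u -> int_pow 2 u = m%:E -> 0 < m ->
  exists E T : R, [/\ energy u = E%:E, 0 < T & T ^+ 4 / 6 * (mc - m) < E].
Hypothesis sharp_GN : forall u : graph_fun G, H1 u ->
  (int_pow 6 u <= (3 / mc ^+ 2)%:E * int_pow 2 u ^+ 2 * int_pow 2 (graph_derivative u))%E.
Hypothesis spread : forall m eps, 0 < m -> 0 < eps ->
  exists2 v : graph_fun G, H1_mass m v & (energy v <= eps%:E)%E.
Hypothesis concentrate : forall m A, mc < m ->
  exists2 v : graph_fun G, H1_mass m v & (energy v <= A%:E)%E.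

Lemma ground_energy_dichotomy m : 0 < m ->
  ground_energy G m = if m <= mc then 0%E else -oo%E.
Proof.
move=> m0; case: leP => [mmc|mcm].
- apply/eqP; rewrite eq_le; apply/andP; split.
  + apply/lee_addgt0Pr => eps eps0; rewrite add0e.
    have [v vm ve] := spread m0 eps0.
    by apply: le_trans ve; apply: ereal_inf_lbound; exists v.
  + apply: le_ereal_inf_tmp => _ [u [uH um] <-].
    have [E [T [-> T0 h]]] := sharp uH um m0.
    rewrite lee_fin ltW// (le_lt_trans _ h)// mulr_ge0 ?subr_ge0//.
    by rewrite divr_ge0// exprn_ge0// ltW.
- have ub A : (ground_energy G m <= A%:E)%E.
    have [v vm ve] := concentrate A mcm.
    by apply: le_trans ve; apply: ereal_inf_lbound; exists v.
  case: (ground_energy G m) ub => [r|/(_ 0)|] //.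
  by move=> /(_ (r - 1)); rewrite lee_fin => h; exfalso; lra.
Qed.

(** Below the critical mass every energy is positive, above it every energy is
    finite. *)
Lemma ground_energy_not_attained m : 0 < m ->
  ~ exists u : graph_fun G, H1_mass m u /\ energy u = ground_energy G m.
Proof.
move=> m0 [u [[uH um]]]; rewrite ground_energy_dichotomy//.
have [E [T [-> T0 h]]] := sharp uH um m0.
case: leP => // mmc [E0]; move: h; rewrite E0 ltNge mulr_ge0 ?subr_ge0//.
by rewrite divr_ge0// exprn_ge0// ltW.
Qed.

(** A better constant than [3 / mc ^+ 2] would make the energy nonnegative for
    some masses above [mc]. *)
Lemma critical_mass_eq : critical_mass G = mc.
Proof.
have mc2 : 0 < mc ^+ 2 by rewrite exprn_gt0.
suff E : GN_constant G = 3 / mc ^+ 2.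
  rewrite /critical_mass E (_ : 3 / _ = mc ^+ 2); last by field; rewrite gt_eqF.
  by rewrite sqrtr_sqr gtr0_norm.
rewrite /GN_constant; set A := [set C | _].
have lbA : lbound A (3 / mc ^+ 2).
  move=> C GNC; rewrite leNgt; apply/negP => Cmc.
  have [m mcm Cm] : exists2 m, mc < m & C * m ^+ 2 <= 3.
    have [C0|C0] := leP C 0.
      exists (mc + 1); first by rewrite ltrDl.
      by rewrite (@le_trans _ _ 0)// mulr_le0_ge0// sqr_ge0.
    exists (Num.sqrt (3 / C)); last first.
      by rewrite sqr_sqrtr ?divr_ge0 ?(ltW C0)// mulrC divfK ?gt_eqF.
    rewrite -(@ltr_pXn2r _ 2) ?nnegrE ?sqrtr_ge0 ?(ltW mc0)//.
    rewrite sqr_sqrtr ?divr_ge0 ?(ltW C0)// ltr_pdivlMr//.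
    by move: Cmc; rewrite ltr_pdivlMr// mulrC.
  have m0 : 0 < m by exact: lt_trans mcm.
  have [v [vH vm]] := concentrate (-1) mcm.
  have h6 := GNC _ vH; have [_ _ _ [_ fin]] := vH.
  have p2 : (0 <= int_pow 2 (graph_derivative v))%E by exact: int_pow_ge0.
  have p6 : (0 <= int_pow 6 v)%E by exact: int_pow_ge0.
  move: h6; rewrite vm /energy -(fineK (x := int_pow 2 (graph_derivative v))) ?ge0_fin_numE//.
  set D := fine _; rewrite -EFin_expe -!EFinM => h6.
  have D0 : 0 <= D by exact: fine_ge0.
  have fin6 : int_pow 6 v \is a fin_num.
    by rewrite ge0_fin_numE// (le_lt_trans h6)// ltry.
  move: h6; rewrite -(fineK fin6).
  set S := fine _; rewrite -!EFinM -EFinB !lee_fin => h6 neg.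
  have := ler_wpM2r D0 Cm; lra.
apply/eqP; rewrite eq_le; apply/andP; split.
- by apply: ge_inf => //; exists (3 / mc ^+ 2).
- by apply: lb_le_inf => //; exists (3 / mc ^+ 2).
Qed.

End Dichotomy.

Section PeriodicDichotomy.
Variables (R : realType) (K : periodicity_cell R) (k : nat).
Local Notation G := (periodic_graph K).
Local Notation mc := (k%:R * (Num.sqrt 3 / 4 * pi) : R).
Hypothesis k0 : (0 < k)%N.
Hypothesis esc : escaping G k.
Hypothesis concentrate : forall m A, mc < m ->
  exists2 v : graph_fun G, H1_mass m v & (energy v <= A%:E)%E.

Lemma periodic_dichotomy :
  [/\ critical_mass G = mc,
    forall m : R, 0 < m -> ground_energy G m = if m <= mc then 0%E else -oo%E &
    forall m : R, 0 < m -> ~ exists u : graph_fun G, H1_mass m u /\ energy u = ground_energy G m].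
Proof.
have [lmin [lmax [lmin0 len]]] := periodic_elen_bounds K.
have inc := @periodic_incident R K.
have mc0 : 0 < mc.
  by rewrite mulr_gt0 ?ltr0n// mulr_gt0 ?pi_gt0// divr_gt0// sqrtr_gt0.
have sharp (u : graph_fun G) m (uH : H1 u) (um : int_pow 2 u = m%:E) (m0 : 0 < m) :=
  energy_gt lmin0 len inc (@periodic_connected R K) uH esc um m0.
have GN (u : graph_fun G) (uH : H1 u) := gagliardo_nirenberg lmin0 len inc uH esc k0.
have spread m eps (m0 : 0 < m) (eps0 : 0 < eps) := spread_energy K m0 eps0.
split=> [|m m0|m m0].
- exact: critical_mass_eq.
- exact: ground_energy_dichotomy.
- exact: (@ground_energy_not_attained R G mc sharp spread concentrate m m0).
Qed.

End PeriodicDichotomy.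

Theorem theorem1p2 (R : realType) (K : periodicity_cell R)
    (deg3 : exists v : vertex (periodic_graph K), (3 <= degree v)%N) :
  let G := periodic_graph K in
  [/\ Hper G ->
        critical_mass G = mu_line R /\
        (forall m : R, 0 < m ->
           ground_energy G m = if m <= mu_line R then 0%E else -oo%E),
      (exists e : edge G, terminal_edge e) ->
        critical_mass G = mu_halfline R /\
        (forall m : R, 0 < m ->
           ground_energy G m = if m <= mu_halfline R then 0%E else -oo%E)
    & Hper G \/ (exists e : edge G, terminal_edge e) ->
        forall m : R, 0 < m ->
          ~ (exists u : graph_fun G,
               H1_mass m u /\ energy u = ground_energy G m)].
Proof.
move=> G.
have line : 2%:R * (Num.sqrt 3 / 4 * pi) = mu_line R by rewrite /mu_line; field.
have half : 1%:R * (Num.sqrt 3 / 4 * pi) = mu_halfline R by rewrite mul1r.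
have [e0] := cell_has_edge K.
have inside m A : 2%:R * (Num.sqrt 3 / 4 * pi) < m ->
    exists2 v : graph_fun G, H1_mass m v & (energy v <= A%:E)%E.
  by rewrite line; exact: (@concentrated_inside _ G (0, e0)).
have at_tip (e : edge G) (te : terminal_edge e) m A : 1%:R * (Num.sqrt 3 / 4 * pi) < m ->
    exists2 v : graph_fun G, H1_mass m v & (energy v <= A%:E)%E.
  rewrite half => hm; apply: (@concentrated_at_tip R G _ e m A te).
    move=> v; have fin := periodic_locally_finite2 (finite_set1 v).
    have finb : finite_set [set: bool] by exact: finite_finset.
    apply: sub_finite_set (finite_setX fin finb).
    by move=> [f b] /= <-; split=> //; case: b; [right|left].
  have -> : Num.sqrt 3 / 2 * (pi / 2) = mu_halfline R by rewrite /mu_halfline; field.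
  exact: hm.
split=> [hper|[e te]|].
- have [c g _] := periodic_dichotomy (isT : (0 < 2)%N) (Hper_escaping hper deg3) inside.
  by rewrite -line.
- have [c g _] := periodic_dichotomy (isT : (0 < 1)%N) (@periodic_escaping R K) (at_tip e te).
  by rewrite -half.
- case=> [hper|[e te]].
    by have [_ _ n] := periodic_dichotomy (isT : (0 < 2)%N) (Hper_escaping hper deg3) inside.
  by have [_ _ n] := periodic_dichotomy (isT : (0 < 1)%N) (@periodic_escaping R K) (at_tip e te).
Qed.
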